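(* Assume $\mathcal D$ is either $\mathcal F_0(s)$ with $0\le s<s_{\max}(\delta)$ or $\mathcal F_p(\xi)$ with $\xi,p>0$. There exist constants $\gamma,c,C>0$ depending only on $\Omega$ such that for all $\theta^\star\in\mathcal D$, all $\lambda\in[\lambda_{\min},\lambda_{\max}]$ and all $\epsilon\in(0,1]$, $$\mathbb P\Big(\exists w\in\mathbb R^N:\ \tfrac1N\|w-\mathsf w_\lambda\|^2>\epsilon\ \text{and}\ L_\lambda(w)\le\min_{v\in\mathbb R^N}L_\lambda(v)+\gamma\epsilon\Big)\le\frac C\epsilon e^{-cn\epsilon^2}.$$
   Context: Fix $\delta>0$, $\sigma>0$; for integers $N$ let $n=\delta N$ (an integer); $\theta^\star\in\mathbb R^N$ deterministic. Let $g\sim\mathcal N(0,I_N)$, $g'\sim\mathcal N(0,1)$, $h\sim\mathcal N(0,I_n)$ be independent. For $\lambda>0$ and $w\in\mathbb R^N$, $$L_\lambda(w)=\frac12\Big(\sqrt{\tfrac{\|w\|^2}n+\sigma^2}\,\tfrac{\|h\|}{\sqrt n}-\tfrac1ng^{\mathsf T}w+\tfrac{g'\sigma}{\sqrt n}\Big)_+^2+\frac\lambda n\|w+\theta^\star\|_1-\frac\lambda n\|\theta^\star\|_1.$$ $\eta(x;b)=\mathrm{sign}(x)(|x|-b)_+$; $\phi,\Phi$ standard normal density and cdf. Let $(\Theta,Z)\sim\hat\mu_{\theta^\star}\otimes\mathcal N(0,1)$ with $\hat\mu_{\theta^\star}=\frac1N\sum_i\delta_{\theta^\star_i}$, and $\psi_\lambda(\beta,\tau)=(\frac{\sigma^2}{\tau}+\tau)\frac\beta2-\frac12\beta^2+\frac1\delta\mathbb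 E\min_{w\in\mathbb R}\{\frac{w^2}{2\tau}\beta-\beta Zw+\lambda|w+\Theta|-\lambda|\Theta|\}$; $(\beta_*(\lambda),\tau_*(\lambda))$ is the unique pair attaining $\max_{\beta\ge0}\min_{\tau\ge\sigma}\psi_\lambda$. Define $\mathsf w_\lambda\in\mathbb R^N$ by $\mathsf w_{\lambda,i}=\eta\big(\theta^\star_i+\tau_*(\lambda)g_i;\tau_*(\lambda)\lambda/\beta_*(\lambda)\big)-\theta^\star_i$. $\mathcal F_p(\xi)=\{x:\frac1N\sum|x_i|^p\le\xi^p\}$, $\mathcal F_0(s)=\{x:\|x\|_0\le sN\}$, $s_{\max}(\delta)=\delta\max_{\alpha\ge0}\frac{1-\frac2\delta M(\alpha)}{1+\alpha^2-2M(\alpha)}$ with $M(\alpha)=(1+\alpha^2)\Phi(-\alpha)-\alpha\phi(\alpha)$. Fix $0<\lambda_{\min}\le\lambda_{\max}$; $\Omega=(\delta,\sigma,\mathcal D,\lambda_{\min},\lambda_{\max})$; constants depending only on $\Omega$ do not depend on $N,\theta^\star,\lambda$. *)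

(* Defs.v *)
From HB Require Import structures.
From mathcomp Require Import all_boot all_order all_algebra.
From mathcomp Require Import all_classical all_reals all_analysis.
Set Implicit Arguments. Unset Strict Implicit. Unset Printing Implicit Defensive.
Import Order.TTheory GRing.Theory Num.Def Num.Theory.
Import numFieldNormedType.Exports.
Local Open Scope classical_set_scope.
Local Open Scope ring_scope.

Section LassoDefs.
Variable R : realType.

Definition sqnorm (N : nat) (x : 'I_N -> R) : R := \sum_(i < N) x i ^+ 2.
Definition norm1 (N : nat) (x : 'I_N -> R) : R := \sum_(i < N) `|x i|.
Definition inner (N : nat) (x y : 'I_N -> R) : R := \sum_(i < N) x i * y i.
Definition pospart (x : R) : R := Num.max x 0.

Definition soft_thr (x b : R) : R := Num.sg x * pospart (`|x| - b).

Definition phi (x : R) : R := normal_pdf 0 1 x.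
Definition Phi (x : R) : R := fine (normal_prob (0:R) 1 `]-oo, x]).

Definition lassoL (N n : nat) (sigma lam : R) (theta : 'I_N -> R)
    (g : 'I_N -> R) (g' : R) (h : 'I_n -> R) (w : 'I_N -> R) : R :=
  2^-1 * (pospart (Num.sqrt (sqnorm w / n%:R + sigma ^+ 2)
                     * (Num.sqrt (sqnorm h) / Num.sqrt n%:R)
                   - inner g w / n%:R + g' * sigma / Num.sqrt n%:R)) ^+ 2
  + lam / n%:R * norm1 (fun i => w i + theta i) - lam / n%:R * norm1 theta.

Definition scalar_min (beta tau lam Th z : R) : R :=
  inf (range (fun w : R => w ^+ 2 / (2 * tau) * beta - beta * z * w
                           + lam * `|w + Th| - lam * `|Th|)).

(* psi_lambda(beta, tau); the expectation over (Theta, Z) ~ hat mu_theta (x) N(0,1)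
   is written as (1/N) sum_i E_Z[ ... Theta := theta_i ... ] *)
Definition psi (N : nat) (delta sigma lam : R) (theta : 'I_N -> R)
    (beta tau : R) : R :=
  (sigma ^+ 2 / tau + tau) * beta / 2 - 2^-1 * beta ^+ 2
  + delta^-1 * ((\sum_(i < N)
        Rintegral (normal_prob (0:R) 1) setT
                  (fun z => scalar_min beta tau lam (theta i) z)) / N%:R).

(* (beta, tau) attains max_{beta >= 0} min_{tau >= sigma} psi:
   tau minimizes psi(beta, .) over [sigma, oo), and
   psi(beta, tau) = min_t psi(beta, t) >= inf_{t >= sigma} psi(beta', t) for every beta' >= 0 *)
Definition attains_maxmin (N : nat) (delta sigma lam : R) (theta : 'I_N -> R)
    (beta tau : R) : Prop :=
  [/\ 0 <= beta, sigma <= tau,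
      (forall t, sigma <= t -> psi delta sigma lam theta beta tau
                               <= psi delta sigma lam theta beta t) &
      (forall beta', 0 <= beta' -> forall e, 0 < e ->
         exists t, sigma <= t /\
           psi delta sigma lam theta beta' t <= psi delta sigma lam theta beta tau + e)].

Definition wlam (N : nat) (theta g : 'I_N -> R) (beta tau lam : R) : 'I_N -> R :=
  fun i => soft_thr (theta i + tau * g i) (tau * lam / beta) - theta i.

Definition Mfun (a : R) : R := (1 + a ^+ 2) * Phi (- a) - a * phi a.
Definition smax_ratio (delta a : R) : R :=
  (1 - 2 / delta * Mfun a) / (1 + a ^+ 2 - 2 * Mfun a).
Definition smax (delta : R) : \bar R :=
  mule delta%:E (ereal_sup [set (smax_ratio delta a)%:E | a in [set a : R | 0 < a]]).

Definition F0 (s : R) : forall N : nat, ('I_N -> R) -> Prop :=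
  fun N x => (#|[pred i : 'I_N | x i != 0]|)%:R <= s * N%:R.
Definition Fp (p xi : R) : forall N : nat, ('I_N -> R) -> Prop :=
  fun N x => (\sum_(i < N) `|x i| `^ p) / N%:R <= xi `^ p.

(* index set for (g, g', h): 'I_N + ('I_1 + 'I_n) *)
Definition gidx (N n : nat) := ('I_N + ('I_1 + 'I_n))%type.

Definition iid_std_normal (I : finType) (d : measure_display) (T : measurableType d)
    (P : probability T R) (X : I -> T -> R) : Prop :=
  (forall i, measurable_fun setT (X i)) /\
  (forall A : I -> set R, (forall i, measurable (A i)) ->
     P (\bigcap_(i in setT) (X i @^-1` A i)) =
     (\big[*%E/1%E]_(i : I) normal_prob (0:R) 1 (A i))%E).

End LassoDefs.

(* Main.v *)
Require Import Defs.
From HB Require Import structures.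
From mathcomp Require Import all_boot all_order all_algebra.
From mathcomp Require Import all_classical all_reals all_analysis.
From mathcomp Require Import measurable_realfun.
From mathcomp Require Import ring lra.
Import Order.TTheory GRing.Theory Num.Def Num.Theory.
Import numFieldNormedType.Exports.
Local Open Scope classical_set_scope.
Local Open Scope ring_scope.
Set Implicit Arguments. Unset Strict Implicit. Unset Printing Implicit Defensive.

(** With [(beta, tau)] the saddle point and [w = w_lambda], the saddle conditions read
    [tau^2 = sigma^2 + E|w|^2 / delta] and [beta = tau - E[Z w] / delta].  They are obtained by
    perturbing [tau], then [beta], in [psi], without differentiating under the expectation.
    At [w_lambda] the quantities [|w|^2 / n], [g.w / n], [|h|^2 / n] and [g' / sqrt n] are
    averages of functions of quadratic growth of independent gaussians, so a Bernstein bound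
    keeps them within [c sqrt eps] of these values.  On that event the argument of the positive
    part in [L_lambda] is nearly [beta], soft thresholding provides the subgradient of the l1
    norm, and the curvature of [w |-> sqrt (|w|^2 / n + sigma^2)] makes [L_lambda] exceed
    [L_lambda (w_lambda)] by a multiple of [eps] at every [w] at distance [sqrt eps] or more:
    no convexity argument is needed.  Uniformity in [theta] and [lambda] amounts to an upper
    bound on [tau] and a lower bound on [beta]; both come from a subgradient [nu] of the l1
    norm at [theta] and a level [a] with [E (Z - a nu)^2 < delta], which exists on each of
    the two classes (for [F0 s] this is exactly [s < smax delta]). *)

(** * Gaussian expectations *)

(** Two elementary facts, the curvature bound [hyper_gap] and the subgradient inequality
    [wopt_subgrad], serve twice: on the population function in [psi_gap] and on the random objective
    in [lassoL_gap] and [lassoL_far]. At distance x from the base point the curvature is of order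
    x^2/(1 + x), hence linear in x far away, while fluctuations of size eta cost only multiples of
    eta x and eta^2. With eta a small multiple of sqrt eps the curvature wins at all the required
    distances at once. The definition of the saddle point shapes the population half: beta is
    compared with another value b only through the minimum over tau, at some t that nothing
    controls. Lower bounds on [psi] at b therefore have to hold for every t; in [psi_gap] AM-GM
    removes t. Positivity of beta must be settled before anything else, because the threshold
    [tau * lam / beta] makes no sense at beta = 0. As eta^2 is of order eps, the failure probability
    found is of order exp(-c n eps). *)

Section weighted_image.
Local Open Scope ereal_scope.
Import HBNNSimple.

(** The hypothesis says, on sets, that the image under [X] of the measure with density [F] is [c]
    times [nu]; linearity extends this to simple functions and monotone convergence to nonnegative
    [g]. It is applied with [X] the identity and [F] the gaussian density, and with [F] the product
    of the other factors of an independent family. *)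
Lemma ge0_integral_weighted_image (R : realType) d d' (T : measurableType d)
    (Y : measurableType d') (mu : {measure set T -> \bar R})
    (nu : {measure set Y -> \bar R}) (F : T -> R) (X : T -> Y) (c : R) (g : Y -> R) :
  measurable_fun setT F -> (forall x, 0 <= F x)%R -> measurable_fun setT X ->
  (0 <= c)%R ->
  (forall A : set Y, measurable A ->
     \int[mu]_(x in X @^-1` A) (F x)%:E = c%:E * nu A) ->
  measurable_fun setT g -> (forall y, 0 <= g y)%R ->
  \int[mu]_x (F x * g (X x))%:E = c%:E * \int[nu]_y (g y)%:E.
Proof.
move=> mF F0 mX c0 FX mg g0.
have mEg : measurable_fun setT (EFin \o g) by exact/measurable_EFinP.
pose g_ := nnsfun_approx measurableT mEg.
have simple n : \int[mu]_x (F x * g_ n (X x))%:E = c%:E * \int[nu]_y (g_ n y)%:E.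
  have mgX r : measurable (X @^-1` (g_ n @^-1` [set r])).
    by rewrite -[X in measurable X]setTI; apply: mX.
  have mI k : measurable_fun setT
      (fun x => (F x * \1_(X @^-1` (g_ n @^-1` [set k])) x)%:E).
    by apply/measurable_EFinP/measurable_funM => //; exact: measurable_indic.
  transitivity (\sum_(k \in range (g_ n))
      \int[mu]_x (k%:E * (F x * \1_(X @^-1` (g_ n @^-1` [set k])) x)%:E)).
    rewrite -ge0_integral_fsum//; last 2 first.
    - by move=> r; exact: measurable_funeM.
    - move=> r x _; rewrite -EFinM mulrCA lee_fin mulr_ge0//.
      exact: (nnfun_muleindic_ge0 (g_ n) r (X x)).
    apply: eq_integral => x _; rewrite fimfunE EFinM -fsumEFin//.
    rewrite ge0_mule_fsumr//; last first.
      by move=> r; rewrite lee_fin; exact: (nnfun_muleindic_ge0 (g_ n) r (X x)).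
    by apply: eq_fsbigr => r _; rewrite -!EFinM mulrCA.
  transitivity (c%:E * \sum_(k \in range (g_ n))
      \int[nu]_y (k * \1_(g_ n @^-1` [set k]) y)%:E); last first.
    congr (_ * _); rewrite -ge0_integral_fsum//.
    - by apply: eq_integral => x _; rewrite fsumEFin// -fimfunE.
    - by move=> r; exact/measurable_EFinP/measurable_funM.
    - by move=> r x _; rewrite nnfun_muleindic_ge0.
  rewrite ge0_mule_fsumr//; last first.
    by move=> r; apply: integral_ge0 => y _; rewrite nnfun_muleindic_ge0.
  apply: eq_fsbigr => r; rewrite inE/= => -[y _ <-]; set k := g_ n y.
  have k0 : (0 <= k)%R by [].
  under [in RHS]eq_integral do rewrite EFinM.
  rewrite (ge0_integralZl_EFin _ _ _ _ k0)//; last first.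
    by move=> x _; rewrite lee_fin mulr_ge0.
  rewrite (ge0_integralZl_EFin _ _ _ _ k0)//; last first.
    exact/measurable_EFinP/measurable_indic.
  rewrite muleCA; congr (_ * _).
  rewrite integral_indic// setIT -FX//.
  rewrite [in RHS]integral_mkcond; apply: eq_integral => x _.
  by rewrite epatch_indic EFinM.
have cg y : (fun n => (g_ n y)%:E) @ \oo --> (g y)%:E.
  by apply: (cvg_nnsfun_approx measurableT mEg) => // z _; rewrite lee_fin.
have nd_g y : nondecreasing_seq (fun n => (g_ n y)%:E).
  by move=> m n mn; rewrite lee_fin; exact/lefP/nd_nnsfun_approx.
transitivity (\int[mu]_x limn (fun n => (F x * g_ n (X x))%:E)).
  apply: eq_integral => x _; apply/esym/cvg_lim => //.
  by under eq_fun do rewrite EFinM; rewrite EFinM; exact: cvgeZl.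
rewrite monotone_convergence//; last 3 first.
- move=> n; apply/measurable_EFinP/measurable_funM => //.
  exact: measurableT_comp.
- by move=> n x _; rewrite lee_fin mulr_ge0.
- by move=> x _ m n mn; rewrite lee_fin ler_wpM2l// -lee_fin; exact: nd_g.
under eq_fun do rewrite simple.
rewrite limeMl//; last first.
  apply: ereal_nondecreasing_is_cvgn => m n mn.
  apply: ge0_le_integral => //; [by move=> y _; rewrite lee_fin|exact/measurable_EFinP..|].
  by move=> y _; exact: nd_g.
congr (_ * _).
rewrite -monotone_convergence//; last 2 first.
- by move=> n; exact/measurable_EFinP.
- by move=> n x _; rewrite lee_fin.
by apply: eq_integral => y _; apply/cvg_lim => //; exact: cg.
Qed.

End weighted_image.

(** * The standard gaussian: integrability, moments, truncated second moments *)

Section gauss.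
Variable R : realType.
Implicit Types (f g : R -> R) (a b c K : R).

Notation gamma := (normal_prob (0 : R) 1).
Notation leb := (@lebesgue_measure R).
Notation "'E f" := (Rintegral gamma setT f) (at level 10, f at level 8).

Lemma phiE x : phi x = normal_peak 1 * expR (- x ^+ 2 / 2) :> R.
Proof.
by rewrite /phi normal_pdfE ?oner_eq0// /normal_fun subr0 expr1n.
Qed.

Lemma phi_ge0 x : 0 <= phi x :> R. Proof. exact: normal_pdf_ge0. Qed.

Lemma continuous_phi : continuous (@phi R).
Proof. exact: continuous_normal_pdf. Qed.

Lemma ge0_integral_gauss (g : R -> R) : measurable_fun setT g -> (forall y, 0 <= g y) ->
  (\int[leb]_x (phi x * g x)%:E = \int[gamma]_y (g y)%:E)%E.
Proof.
move=> mg g0.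
rewrite (@ge0_integral_weighted_image R _ _ _ _ leb (normal_prob 0 1) (@phi R) id 1 g)//.
- by rewrite mul1e.
- exact: measurable_normal_pdf.
- exact: phi_ge0.
- by move=> A mA; rewrite mul1e preimage_id.
Qed.

(* The rate 1/4 is half the decay rate 1/2 of the gaussian density, and still covers [exp] of small multiples of quadratic functions. *)
Definition tame f := measurable_fun setT f /\
  exists K, forall z, `|f z| <= K * expR (z ^+ 2 / 4).

Lemma measurable_expR_sqr4 : measurable_fun setT (fun z : R => expR (z ^+ 2 / 4)).
Proof.
by apply: measurableT_comp => //; apply: measurable_funM.
Qed.

(** Under the gaussian density exp(y^2/4) leaves exp(-y^2/4), a constant multiple of the normal
    density of variance 2. *)
Lemma integral_gauss_expR_lty : (\int[gamma]_y (expR (y ^+ 2 / 4))%:E < +oo)%E.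
Proof.
rewrite -ge0_integral_gauss; [|exact: measurable_expR_sqr4|by move=> y; exact: expR_ge0].
have s20 : Num.sqrt 2 != 0 :> R by rewrite gt_eqF// sqrtr_gt0.
under eq_integral => x _.
  rewrite (_ : phi x * expR (x ^+ 2 / 4) =
    normal_peak 1 / normal_peak (Num.sqrt 2) * normal_pdf 0 (Num.sqrt 2) x).
    rewrite EFinM; over.
  rewrite phiE normal_pdfE//= -[LHS]mulrA -expRD [RHS]mulrA divfK; last first.
    by rewrite gt_eqF// normal_peak_gt0.
  congr (_ * _).
  rewrite /normal_fun subr0 sqr_sqrtr//; congr expR; lra.
rewrite integralZl//; last exact: integrable_normal_pdf.
by rewrite integral_normal_pdf mule1 ltry.
Qed.

Lemma tame_integrable f : tame f -> gamma.-integrable setT (EFin \o f).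
Proof.
move=> [mf [K fK]].
have m4 := measurable_expR_sqr4.
have K0 : 0 <= K.
  have := le_trans (normr_ge0 _) (fK 0).
  by rewrite expr0n/= mul0r expR0 mulr1.
apply/integrableP; split; first exact/measurable_EFinP.
apply: (@le_lt_trans _ _ (\int[gamma]_y (K%:E * (expR (y ^+ 2 / 4))%:E))%E).
  apply: ge0_le_integral => //.
  - by apply: measurableT_comp => //; exact/measurable_EFinP.
  - by apply: measurable_funeM; exact/measurable_EFinP.
  - by move=> y _; rewrite -EFinM lee_fin; exact: fK.
rewrite ge0_integralZl//; last exact/measurable_EFinP.
by rewrite lte_mul_pinfty// integral_gauss_expR_lty.
Qed.

Lemma tame_cst c : tame (cst c).
Proof.
split=> //; exists `|c| => z; rewrite ler_peMr// -expR0 ler_expR.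
by rewrite divr_ge0// sqr_ge0.
Qed.

Lemma tameD f g : tame f -> tame g -> tame (fun z => f z + g z).
Proof.
move=> [mf [K fK]] [mg [K' gK]]; split; first exact: measurable_funD.
by exists (K + K') => z; rewrite mulrDl (le_trans (ler_normD _ _))// lerD.
Qed.

Lemma tameZ c f : tame f -> tame (fun z => c * f z).
Proof.
move=> [mf [K fK]]; split; first exact: measurable_funM.
by exists (`|c| * K) => z; rewrite normrM -mulrA ler_wpM2l.
Qed.

Lemma tameN f : tame f -> tame (fun z => - f z).
Proof. by move=> /(tameZ (-1)); under eq_fun do rewrite mulN1r. Qed.

Lemma tameB f g : tame f -> tame g -> tame (fun z => f z - g z).
Proof. by move=> tf tg; apply: tameD => //; exact: tameN. Qed.

Lemma tame_le f g : measurable_fun setT f -> tame g -> (forall z, `|f z| <= `|g z|) -> tame f.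
Proof.
move=> mf [_ [K gK]] fg; split => //; exists K => z.
exact: le_trans (fg z) (gK z).
Qed.

Lemma tameM_indic f (A : set R) : tame f -> measurable A -> tame (fun z => f z * \1_A z).
Proof.
move=> tf mA; apply: (@tame_le _ f) => //.
  by apply: measurable_funM; [exact: tf.1|exact: measurable_indic].
move=> z; rewrite normrM indicE; case: (_ \in _); first by rewrite normr1 mulr1.
by rewrite normr0 mulr0.
Qed.

Lemma gaussD f g : tame f -> tame g ->
  'E (fun z => f z + g z) = 'E f + 'E g.
Proof. by move=> /tame_integrable tf /tame_integrable tg; exact: RintegralD. Qed.

Lemma gaussZ c f : tame f -> 'E (fun z => c * f z) = c * 'E f.
Proof. by move=> /tame_integrable tf; exact: RintegralZl. Qed.

Lemma gaussN f : tame f -> 'E (fun z => - f z) = - 'E f.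
Proof. by move=> tf; under eq_Rintegral do rewrite -mulN1r; rewrite gaussZ// mulN1r. Qed.

Lemma gaussB f g : tame f -> tame g ->
  'E (fun z => f z - g z) = 'E f - 'E g.
Proof. by move=> tf tg; rewrite gaussD ?gaussN//; exact: tameN. Qed.

Lemma gauss_cst c : 'E (cst c) = c.
Proof. by rewrite Rintegral_cst//= /normal_prob integral_normal_pdf/= mulr1. Qed.

Lemma gauss_le f g : tame f -> tame g -> (forall z, f z <= g z) -> 'E f <= 'E g.
Proof.
by move=> /tame_integrable tf /tame_integrable tg fg; apply: le_Rintegral => // z _; exact: fg.
Qed.

Lemma gauss_eq f g : f =1 g -> 'E f = 'E g.
Proof. by move=> fg; apply: eq_Rintegral => z _; exact: fg. Qed.

Lemma quad_le_expR (z : R) : 1 + z ^+ 2 <= 4 * expR (z ^+ 2 / 4).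
Proof. by have := expR_ge1Dx (z ^+ 2 / 4); have := sqr_ge0 z; nra. Qed.

Lemma tame_quad f : measurable_fun setT f ->
  (exists K, forall z, `|f z| <= K * (1 + z ^+ 2)) -> tame f.
Proof.
move=> mf [K fK]; split => //; exists (4 * `|K|) => z.
apply: le_trans (fK z) _; apply: (@le_trans _ _ (`|K| * (1 + z ^+ 2))).
  by rewrite ler_wpM2r ?ler_norm// addr_ge0// sqr_ge0.
by rewrite [4 * _]mulrC -mulrA ler_wpM2l// quad_le_expR.
Qed.

Lemma gauss_RintegralE g : tame g -> 'E g = Rintegral leb setT (fun z => phi z * g z).
Proof.
move=> tg; have mg := tg.1.
rewrite /Rintegral [in LHS]integralE [in RHS]integralE.
have mp : measurable_fun setT (fun z => Num.max (g z) 0) by exact: measurable_maxr.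
have mn : measurable_fun setT (fun z => Num.max (- g z) 0).
  by apply: measurable_maxr => //; exact: measurable_funN.
congr (fine (_ - _)%E).
- transitivity (\int[gamma]_z (Num.max (g z) 0)%:E)%E.
    by apply: eq_integral => z _; rewrite funeposE -EFin_max.
  rewrite -ge0_integral_gauss//; last by move=> z; rewrite le_max lexx orbT.
  by apply: eq_integral => z _; rewrite funeposE -EFin_max maxr_pMr ?phi_ge0// mulr0.
- transitivity (\int[gamma]_z (Num.max (- g z) 0)%:E)%E.
    by apply: eq_integral => z _; rewrite funenegE -EFin_max.
  rewrite -ge0_integral_gauss//; last by move=> z; rewrite le_max lexx orbT.
  by apply: eq_integral => z _; rewrite funenegE -EFin_max maxr_pMr ?phi_ge0// mulr0 mulrN.
Qed.

Lemma gauss_FTC g F a b : a < b -> continuous g -> tame g ->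
  (forall x : R, is_derive x 1 F (phi x * g x)) ->
  'E (fun z => g z * \1_`[a, b] z) = F b - F a.
Proof.
move=> ab cg tg dF.
have tgI : tame (fun z => g z * \1_`[a, b] z) by exact: tameM_indic.
rewrite gauss_RintegralE//.
transitivity (Rintegral leb `[a, b] (fun z => phi z * g z)).
  rewrite [RHS]Rintegral_mkcond; apply: eq_Rintegral => z _.
  by rewrite patchE indicE; case: (_ \in _); rewrite ?mulr1// !mulr0.
rewrite /Rintegral (@continuous_FTC2 _ _ F)//.
- apply: continuous_subspaceT => z.
  by apply: cvgM; [exact: continuous_phi|exact: cg].
- have dd (x : R) : derivable F x 1 by have [] := dF x.
  have cF : continuous F.
    by move=> x; apply/differentiable_continuous/derivable1_diffP.
  split.
  + by move=> x _.
  + by apply: cvg_at_right_filter; exact: cF.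
  + by apply: cvg_at_left_filter; exact: cF.
- by move=> x _; rewrite derive1E; have [_ ->] := dF x.
Qed.

(** Dominated convergence lets the segments of [gauss_FTC] grow. Asking only that the indicators
    agree eventually at each point treats the line and both half-lines with one statement. *)
Lemma gauss_FTC_lim g F (A : set R) (a b : R^nat) (l : R) :
  (\forall n \near \oo, a n < b n) -> continuous g -> tame g ->
  (forall x : R, is_derive x 1 F (phi x * g x)) -> measurable A ->
  (forall z, \forall n \near \oo, \1_`[a n, b n] z = \1_A z :> R) ->
  (fun n => F (b n) - F (a n)) @ \oo --> l ->
  'E (fun z => g z * \1_A z) = l.
Proof.
move=> ab cg tg dF mA hA Fl.
have tI B : measurable B -> tame (fun z => g z * \1_B z) by exact: tameM_indic.
have [|||||_ _] := @dominated_convergence _ _ _ (normal_prob 0 1) setT measurableT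
  (fun n z => (g z * \1_`[a n, b n] z)%:E) (fun z => (g z * \1_A z)%:E)
  (fun z => `|(g z)%:E|)%E.
- by move=> n; apply/measurable_EFinP; exact: (tI _ _).1.
- by apply/measurable_EFinP; exact: (tI _ mA).1.
- apply: aeW => z _; apply: cvg_near_cst.
  by apply: filterS (hA z) => n /= ->.
- by apply: integrable_abse; exact: tame_integrable.
- apply: aeW => z n _; rewrite lee_fin normrM indicE.
  by case: (_ \in _); rewrite ?normr1 ?mulr1// normr0 mulr0.
move=> cvE.
have /fine_cvgP[_] : (\int[normal_prob 0 1]_z (g z * \1_`[a n, b n] z)%:E)%E @[n --> \oo] -->
    (fine (\int[normal_prob 0 1]_z (g z * \1_A z)%:E)%E)%:E.
  rewrite fineK//; apply: integrable_fin_num => //.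
  exact: (tame_integrable (tI _ mA)).
move=> h.
suff h2 : (fine \o (fun n => \int[normal_prob 0 1]_z (g z * \1_`[a n, b n] z)%:E)%E) x
    @[x --> \oo] --> l by exact: (cvg_unique (@Rhausdorff R) h h2).
apply: cvg_trans Fl; apply: near_eq_cvg.
by apply: filterS ab => n abn /=; rewrite -(gauss_FTC abn cg tg dF).
Qed.

Lemma is_derive_phi (x : R) : is_derive x 1 (@phi R) (- x * phi x).
Proof.
rewrite (_ : @phi R = (fun z => normal_peak 1 * expR (- z ^+ 2 / 2))); last first.
  by apply/funext => z; rewrite phiE.
apply: is_derive_eq.
by rewrite /GRing.scale/=; field.
Qed.

(** As the derivative of [phi] is -z [phi], primitives of this form yield every first and second
    moment computed below, full or truncated, up to tail masses. *)
Lemma is_derive_affine_phi (c0 c1 x : R) :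
  is_derive x 1 (fun z => (c0 + c1 * z) * phi z) (phi x * (c1 - x * (c0 + c1 * x))).
Proof.
have := is_derive_phi x => dphi.
apply: is_derive_eq.
rewrite /GRing.scale/=; ring.
Qed.

Lemma affine_phi_cvg0 (c0 c1 : R) (s : R) : s ^+ 2 = 1 ->
  (fun n : nat => (c0 + c1 * (s * n.+1%:R)) * phi (s * n.+1%:R)) @ \oo --> (0 : R).
Proof.
move=> s1; have s1' : `|s| = 1 by apply/eqP; rewrite -(@eqrXn2 _ 2)// real_normK ?num_real// s1 expr1n.
pose C := (`|c0| + `|c1|) * normal_peak 1 * 4.
have C0 : (fun n : nat => C * n.+1%:R^-1) @ \oo --> (0 : R).
  by rewrite -[X in _ --> X](mulr0 C); apply: cvgMr; exact: cvg_harmonic.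
apply/norm_cvg0P; apply: (@squeeze_cvgr _ _ _ _ (cst 0) (fun n : nat => C * n.+1%:R^-1)).
- apply: nearW => n; rewrite normr_ge0/= phiE exprMn s1 mul1r normrM.
  have n0 : 0 <= n.+1%:R :> R by [].
  have -> : `|normal_peak 1 * expR (- n.+1%:R ^+ 2 / 2)| = normal_peak 1 * expR (- n.+1%:R ^+ 2 / 2) :> R.
    by rewrite ger0_norm// mulr_ge0 ?expR_ge0 ?normal_peak_ge0.
  have h1 : `|c0 + c1 * (s * n.+1%:R)| <= (`|c0| + `|c1|) * (1 + n.+1%:R).
    apply: le_trans (ler_normD _ _) _; rewrite !normrM s1' mul1r (ger0_norm n0).
    have := normr_ge0 c0; have := normr_ge0 c1; nra.
  (* With m = n + 1 >= 1 and exp(m^2/2) >= 1 + m^2/2, this reduces to m (1 + m) <= 4 + 2 m^2. *)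
  have h2 : (1 + n.+1%:R) * expR (- n.+1%:R ^+ 2 / 2) <= 4 * n.+1%:R^-1 :> R.
    have e : 1 + n.+1%:R ^+ 2 / 2 <= expR (n.+1%:R ^+ 2 / 2) :> R by exact: expR_ge1Dx.
    rewrite mulNr expRN ler_pdivrMr ?expR_gt0// mulrAC ler_pdivlMr ?ltr0n//.
    have : 1 <= n.+1%:R :> R by rewrite ler1n.
    nra.
  apply: le_trans (ler_wpM2r _ h1) _; first by rewrite mulr_ge0 ?expR_ge0 ?normal_peak_ge0.
  rewrite /C -!mulrA ler_wpM2l ?addr_ge0// mulrCA ler_wpM2l ?normal_peak_ge0//.
- exact: cvg_cst.
- exact: C0.
Qed.

Lemma near_symmetric_itv (z : R) : \forall n \near \oo,
  \1_`[(-1) * n.+1%:R, 1 * n.+1%:R] z = \1_[set: R] z :> R.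
Proof.
near=> n; rewrite !indicE in_setT/= mem_set//= in_itv/= mulN1r mul1r -ler_norml.
rewrite (@le_trans _ _ n%:R)// ?ler_nat//.
by near: n; exact: nbhs_infty_ger.
Unshelve. all: by end_near. Qed.

Lemma continuous_tame_quad f K : continuous f -> (forall z, `|f z| <= K * (1 + z ^+ 2)) -> tame f.
Proof.
by move=> cf fK; apply: tame_quad; [exact: continuous_measurable_fun|exists K].
Qed.

Lemma continuous_quadratic c0 c1 c2 : continuous (fun z : R => c0 + c1 * z + c2 * z ^+ 2).
Proof.
move=> z; apply: cvgD; first apply: cvgD; [exact: cvg_cst|..].
  by apply: cvgM; [exact: cvg_cst|exact: cvg_id].
by apply: cvgM; [exact: cvg_cst|exact: exprn_continuous].
Qed.

Lemma tame_quadratic c0 c1 c2 : tame (fun z => c0 + c1 * z + c2 * z ^+ 2).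
Proof.
apply: (@continuous_tame_quad _ (`|c0| + `|c1| + `|c2|)); first exact: continuous_quadratic.
move=> z; have h : `|z| <= 1 + z ^+ 2.
  by have := sqr_ge0 (`|z| - 1); rewrite sqrrB -normrX ger0_norm ?sqr_ge0//; have := normr_ge0 z; nra.
rewrite (le_trans (ler_normD _ _))// (le_trans (lerD (ler_normD _ _) (lexx _)))//.
rewrite (normrM c1) (normrM c2) (ger0_norm (sqr_ge0 z)).
by have := normr_ge0 c0; have := normr_ge0 c1; have := normr_ge0 c2; have := sqr_ge0 z; nra.
Qed.

Lemma gauss_quadratic_tail c0 c1 (A : set R) (a b : R^nat) l :
  (\forall n \near \oo, a n < b n) -> measurable A ->
  (forall z, \forall n \near \oo, \1_`[a n, b n] z = \1_A z :> R) ->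
  (fun n => (c0 + c1 * b n) * phi (b n) - (c0 + c1 * a n) * phi (a n)) @ \oo --> l ->
  'E (fun z => (c1 - z * (c0 + c1 * z)) * \1_A z) = l.
Proof.
move=> ab mA hA Fl.
have e : (fun z => c1 - z * (c0 + c1 * z)) = (fun z => c1 + (- c0) * z + (- c1) * z ^+ 2).
  by apply/funext => z; ring.
apply: (@gauss_FTC_lim (fun z => c1 - z * (c0 + c1 * z)) _ A a b l _ _ _ _ _ hA Fl) => //.
- by rewrite e; exact: continuous_quadratic.
- by rewrite e; exact: tame_quadratic.
- by move=> x; exact: is_derive_affine_phi.
Qed.

Lemma gauss_affine_moment c0 c1 : 'E (fun z => c1 - z * (c0 + c1 * z)) = 0.
Proof.
rewrite (@gauss_eq _ (fun z => (c1 - z * (c0 + c1 * z)) * \1_[set: R] z)); last first.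
  by move=> z; rewrite indicE in_setT mulr1.
apply: (@gauss_quadratic_tail _ _ _ (fun n => (-1) * n.+1%:R) (fun n => 1 * n.+1%:R)) => //.
- by apply: nearW => n; rewrite mul1r mulN1r gtrN.
- exact: near_symmetric_itv.
- by rewrite -(subr0 0); apply: cvgB; apply: affine_phi_cvg0; rewrite ?sqrrN expr1n.
Qed.

Lemma gauss_id : 'E (fun z => z) = 0.
Proof.
by rewrite -[RHS](gauss_affine_moment (-1) 0); apply: gauss_eq => z; ring.
Qed.

Lemma gauss_sqr : 'E (fun z => z ^+ 2) = 1.
Proof.
have := gauss_affine_moment 0 1.
rewrite (@gauss_eq _ (fun z => 1 + 0 * z + (-1) * z ^+ 2)); last by move=> z; ring.
rewrite (@gauss_eq _ (fun z => (cst 1) z - z ^+ 2)); last by move=> z /=; ring.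
rewrite gaussB//; last first.
- by have := tame_quadratic 0 0 1; rewrite (_ : (fun _ => _) = (fun z => z ^+ 2))//; apply/funext => z; ring.
- exact: tame_cst.
by rewrite gauss_cst => /eqP; rewrite subr_eq0 => /eqP.
Qed.

Lemma tame_id : tame (fun z => z).
Proof. by have := tame_quadratic 0 1 0; rewrite (_ : (fun _ => _) = (fun z => z))//; apply/funext => z; ring. Qed.

Lemma tame_sqr : tame (fun z => z ^+ 2).
Proof. by have := tame_quadratic 0 0 1; rewrite (_ : (fun _ => _) = (fun z => z ^+ 2))//; apply/funext => z; ring. Qed.

Lemma gauss_indic (A : set R) : measurable A -> 'E (\1_A) = fine (gamma A).
Proof. by move=> mA; rewrite /Rintegral integral_indic// setIT. Qed.

Lemma phiN (x : R) : phi (- x) = phi x.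
Proof. by rewrite !phiE sqrrN. Qed.

Lemma gauss_tail_sym a : gamma `[a, +oo[ = gamma `]-oo, (- a)].
Proof.
rewrite /normal_prob ge0_integration_by_substitutionNy.
- by apply: eq_integral => x _; rewrite /= -/(phi x) -phiN.
- by apply: continuous_subspaceT; exact: continuous_phi.
- by move=> x _; exact: phi_ge0.
Qed.

(** (z - a)^2 is the sum of -1 - z (2 a - z), whose primitive against the density is (2 a - z)
    phi(z) and contributes -a phi(a) at the endpoint, and of 1 + a^2, which contributes (1 + a^2)
    Phi(-a) by symmetry. *)
Lemma gauss_soft_right a :
  'E (fun z => (z - a) ^+ 2 * \1_`[a, +oo[ z) = Mfun a.
Proof.
rewrite (@gauss_eq _ (fun z => (-1 - z * (2 * a + (-1) * z)) * \1_`[a, +oo[ z +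
    (1 + a ^+ 2) * \1_`[a, +oo[ z)); last by move=> z; ring.
have mA : measurable (`[a, +oo[ : set R) by [].
rewrite gaussD; [|apply: tameM_indic => //|apply: tameZ; rewrite (_ : \1_ _ = (fun z => (cst 1) z * \1_`[a, +oo[ z))]; last 3 first.
- have := tame_quadratic (-1) (-2 * a) 1; rewrite (_ : (fun _ => _) = (fun z => -1 - z * (2 * a + (-1) * z)))//.
  by apply/funext => z; ring.
- by apply: tameM_indic => //; exact: tame_cst.
- by apply/funext => z; rewrite mul1r.
rewrite gaussZ; last first.
  rewrite (_ : \1_ _ = (fun z => (cst 1) z * \1_`[a, +oo[ z)); last by apply/funext => z; rewrite mul1r.
  by apply: tameM_indic => //; exact: tame_cst.
rewrite gauss_indic// gauss_tail_sym -/(Phi _).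
rewrite (@gauss_quadratic_tail _ _ _ (fun=> a) (fun n => 1 * n.+1%:R) (- (a * phi a)))//.
- by rewrite /Mfun addrC.
- near=> n; rewrite mul1r -natr1 (@le_lt_trans _ _ n%:R)// ?ltrDl//.
  by near: n; exact: nbhs_infty_ger.
- move=> z; near=> n; rewrite !indicE; congr ((nat_of_bool _)%:R).
  apply: asbool_equiv_eq; split; rewrite /= !in_itv/= andbT; first by case/andP.
  move=> ->/=; rewrite mul1r -natr1 (@le_trans _ _ n%:R)// ?lerDl//.
  by near: n; exact: nbhs_infty_ger.
- rewrite -(sub0r (a * phi a)); apply: cvgB.
    by apply: affine_phi_cvg0; rewrite expr1n.
  rewrite (_ : 2 * a + -1 * a = a); last by ring.
  exact: cvg_cst.
Unshelve. all: by end_near. Qed.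

Lemma gauss_soft_left a :
  'E (fun z => (z + a) ^+ 2 * \1_`]-oo, - a] z) = Mfun a.
Proof.
rewrite (@gauss_eq _ (fun z => (-1 - z * (-2 * a + (-1) * z)) * \1_`]-oo, - a] z +
    (1 + a ^+ 2) * \1_`]-oo, - a] z)); last by move=> z; ring.
have mA : measurable (`]-oo, - a] : set R) by [].
have t1 : tame (\1_`]-oo, - a] : R -> R).
  rewrite (_ : \1_ _ = (fun z => (cst 1) z * \1_`]-oo, - a] z)); last by apply/funext => z; rewrite mul1r.
  by apply: tameM_indic => //; exact: tame_cst.
rewrite gaussD; [|apply: tameM_indic => //|exact: tameZ]; last first.
  have := tame_quadratic (-1) (2 * a) 1; rewrite (_ : (fun _ => _) = (fun z => -1 - z * (-2 * a + (-1) * z)))//.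
  by apply/funext => z; ring.
rewrite gaussZ// gauss_indic// -/(Phi _).
rewrite (@gauss_quadratic_tail _ _ _ (fun n => (-1) * n.+1%:R) (fun=> - a) (- (a * phi a)))//.
- by rewrite /Mfun addrC.
- near=> n; rewrite mulN1r ltrN2 -natr1 (@le_lt_trans _ _ n%:R)// ?ltrDl//.
  by near: n; exact: nbhs_infty_ger.
- move=> z; near=> n; rewrite !indicE; congr ((nat_of_bool _)%:R).
  apply: asbool_equiv_eq; split; rewrite /= !in_itv/= ; first by case/andP.
  move=> ->; rewrite andbT mulN1r lerNl -natr1 (@le_trans _ _ n%:R)// ?lerDl//.
  by near: n; exact: nbhs_infty_ger.
- rewrite -(subr0 (- (a * phi a))); apply: cvgB.
    rewrite (_ : (-2 * a + -1 * - a) = - a) ?phiN ?mulNr; last by ring.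
    exact: cvg_cst.
  by apply: affine_phi_cvg0; rewrite sqrrN expr1n.
Unshelve. all: by end_near. Qed.

(** This identifies [Mfun a] as half the second moment of the soft-thresholded gaussian. As a > 0
    the two tails are disjoint, and the square splits into one term on each. *)
Lemma gauss_soft_sqr a : 0 < a ->
  'E (fun z => pospart (`|z| - a) ^+ 2) = 2 * Mfun a.
Proof.
move=> a0; rewrite mulr_natl mulr2n -{1}gauss_soft_right -gauss_soft_left -gaussD.
- apply: gauss_eq => z; rewrite !indicE.
  rewrite (_ : (z \in `[a, +oo[%classic) = (a <= z)); last by rewrite mem_setE/= in_itv/= andbT.
  rewrite (_ : (z \in `]-oo, - a]%classic) = (z <= - a)); last by rewrite mem_setE/= in_itv/=.
  rewrite /pospart.
  have [az|za] := leP a z.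
    rewrite ger0_norm; last lra.
    rewrite max_l; last lra.
    have -> : (z <= - a) = false by apply/negbTE; rewrite -ltNge; lra.
    by rewrite mulr1 mulr0 addr0.
  have [zNa|Naz] := leP z (- a).
    rewrite ler0_norm; last lra.
    rewrite max_l; last lra.
    by rewrite mulr0 mulr1 add0r; ring.
  rewrite max_r; last first.
    by rewrite subr_le0 ler_norml; apply/andP; split; exact: ltW.
  by rewrite expr0n/= !mulr0 addr0.
- apply: tameM_indic => //; have := tame_quadratic (a ^+ 2) (-2 * a) 1.
  by rewrite (_ : (fun _ => _) = (fun z => (z - a) ^+ 2))//; apply/funext => z; ring.
- apply: tameM_indic => //; have := tame_quadratic (a ^+ 2) (2 * a) 1.
  by rewrite (_ : (fun _ => _) = (fun z => (z + a) ^+ 2))//; apply/funext => z; ring.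
Qed.
End gauss.

(** * Concentration *)

Section independence.
Variable R : realType.
Notation gamma := (normal_prob (0 : R) 1).
Notation "'E f" := (Rintegral gamma setT f) (at level 10, f at level 8).
Variables (I : finType) (d : measure_display) (T : measurableType d).
Variables (P : probability T R) (X : I -> T -> R).
Hypothesis iid : iid_std_normal P X.

Lemma measurable_bigprod (J : Type) (r : seq J) (Q : pred J) (h : J -> T -> R) :
  (forall i, measurable_fun setT (h i)) ->
  measurable_fun setT (fun t => \prod_(i <- r | Q i) h i t).
Proof.
move=> mh; elim: r => [|i r IH]; first by under eq_fun do rewrite big_nil; exact: measurable_cst.
under eq_fun do rewrite big_cons.
by case: (Q i) => //; exact: measurable_funM.
Qed.

(** The product rule passes from sets to functions one coordinate at a time: the product of the
    remaining factors is the weight in [ge0_integral_weighted_image]. *)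
Lemma integral_prod_iid (f : I -> R -> R) :
  (forall i, tame (f i)) -> (forall i x, 0 <= f i x) ->
  (\int[P]_t (\prod_i f i (X i t))%:E = (\prod_i 'E (f i))%:E)%E.
Proof.
move=> tf f0; have [mX pX] := iid.
(* Coordinates in [s] already carry [f i], the others an indicator. Keeping the sets [A] arbitrary
   in the induction allows the next coordinate to be tested on every measurable set. *)
pose term (s : seq I) (A : I -> set R) i x := if i \in s then f i x else \1_(A i) x.
pose val (s : seq I) (A : I -> set R) i := if i \in s then 'E (f i) else fine (gamma (A i)).
have term0 s A i x : 0 <= term s A i x by rewrite /term; case: ifP.
have fin A : measurable A -> gamma A \is a fin_num.
  by move=> mA; apply: (@fin_num_measure _ _ _ (normal_prob (0:R) 1)).
have val0 s A i : 0 <= val s A i.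
  rewrite /val; case: ifP => _; first by apply: Rintegral_ge0.
  by apply: fine_ge0; apply: (@measure_ge0 _ _ _ (normal_prob (0:R) 1)).
have mterm s A i : (forall i, measurable (A i)) -> measurable_fun setT (fun t => term s A i (X i t)).
  move=> mA; apply: measurableT_comp (mX i); rewrite /term.
  by case: (i \in s); [exact: (tf i).1|exact: measurable_indic].
have main (s : seq I) : uniq s -> forall A, (forall i, measurable (A i)) ->
    (\int[P]_t (\prod_i term s A i (X i t))%:E = (\prod_i val s A i)%:E)%E.
  elim: s => [_ A mA|i0 s IH /= /andP[i0s us] A mA].
    transitivity (P (\bigcap_(i in setT) (X i @^-1` A i))).
      rewrite -[RHS]mul1e -integral_cst; last first.
        apply: fin_bigcap_measurable; first exact: finite_finset.
        by move=> i _; rewrite -[X in measurable X]setTI; exact: mX.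
      rewrite [RHS]integral_mkcond; apply: eq_integral => t _.
      rewrite patchE; case: ifPn => [|/negP].
        rewrite inE => h; rewrite big1// => i _; rewrite /term in_nil indicE mem_set//.
        exact: (h i Logic.I).
      rewrite inE => h.
      have [i hi] : exists i, ~ A i (X i t).
        by apply: contra_notP h => /forallNP h i _; have := h i => /contrapT.
      rewrite (bigD1 i)//= {1}/term in_nil indicE memNset// mul0r//.
    rewrite pX// -prodEFin; apply: eq_bigr => i _.
    by apply/esym; rewrite /val in_nil; exact: fineK (fin _ (mA i)).
  pose F t := \prod_(i | i != i0) term s A i (X i t).
  pose c := \prod_(i | i != i0) val s A i.
  have eqF t : \prod_i term (i0 :: s) A i (X i t) = F t * f i0 (X i0 t).
    rewrite (bigD1 i0)//= {1}/term mem_head mulrC; congr (_ * _).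
    by apply: eq_bigr => i ii0; rewrite /term inE (negbTE ii0).
  have -> : \prod_i val (i0 :: s) A i = c * 'E (f i0).
    rewrite (bigD1 i0)//= {1}/val mem_head mulrC; congr (_ * _).
    by apply: eq_bigr => i ii0; rewrite /val inE (negbTE ii0).
  under eq_integral do rewrite eqF.
  rewrite (@ge0_integral_weighted_image R _ _ _ _ P (normal_prob 0 1) F (X i0) c)//.
  - rewrite EFinM /Rintegral fineK//; apply: integrable_fin_num => //.
    exact: tame_integrable.
  - by apply: (@measurable_bigprod _ _ _ (fun i t => term s A i (X i t))) => i; exact: mterm.
  - by move=> t; apply: prodr_ge0 => i _.
  - exact: mX.
  - by apply: prodr_ge0.
  (* The induction hypothesis with the set at [i0] replaced by [B] is exactly the identity on sets
     that the weighted image lemma asks for. *)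
  - move=> B mB; pose A' (i : I) : set R := if i == i0 then B else A i.
    have mA' i : measurable (A' i) by rewrite /A'; case: (i == i0); [exact: mB|exact: mA].
    have A'0 : A' i0 = B by rewrite /A' eqxx.
    have vE : \prod_i val s A' i = fine (gamma B) * c.
      rewrite (bigD1 i0)//= {1}/val (negbTE i0s) A'0; congr (_ * _).
      by apply: eq_bigr => i ii0; rewrite /val /A' (negbTE ii0).
    have tE t : \prod_i term s A' i (X i t) = \1_B (X i0 t) * F t.
      rewrite (bigD1 i0)//= {1}/term (negbTE i0s) A'0; congr (_ * _).
      by apply: eq_bigr => i ii0; rewrite /term /A' (negbTE ii0).
    have := IH us A' mA'; rewrite vE EFinM fineK ?fin// muleC => <-.
    rewrite integral_mkcond; apply: eq_integral => t _.
    rewrite patchE tE indicE.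
    rewrite (_ : (X i0 t \in B) = (t \in X i0 @^-1` B)); last by apply: asbool_equiv_eq.
    by case: ifP => _; rewrite ?mul1r ?mul0r.
  - exact: (tf i0).1.
have := main (enum I) (enum_uniq _) (fun=> setT) (fun=> measurableT).
rewrite (eq_bigr (fun i => 'E (f i))); last first.
  by move=> i _; rewrite /val mem_enum.
move=> <-; apply: eq_integral => t _; congr EFin.
by apply: eq_bigr => i _; rewrite /term mem_enum.
Qed.

Lemma chernoff (u : I -> R -> R) (a : R) :
  (forall i, measurable_fun setT (u i)) -> (forall i, tame (fun z => expR (u i z))) ->
  (P [set t | a <= \sum_i u i (X i t)]%R <=
     (expR (- a) * \prod_i 'E (fun z => expR (u i z)))%:E)%E.
Proof.
move=> mu tu; have [mX _] := iid.
have mS : measurable_fun setT (fun t => expR (\sum_i u i (X i t))).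
  apply: measurableT_comp => //; apply: measurable_sum => i.
  exact: measurableT_comp (mu i) (mX i).
have mES : measurable_fun setT (fun t => (expR (\sum_i u i (X i t)))%:E).
  exact/measurable_EFinP.
have := @le_integral_abse _ _ _ P setT measurableT _ (expR a) mES (expR_gt0 a).
rewrite setTI (_ : [set _ | _] = [set t | a <= \sum_i u i (X i t)]); last first.
  by apply/seteqP; split => t /=; rewrite lee_fin ger0_norm ?expR_ge0// ler_expR.
rewrite (eq_integral (fun t => (\prod_i expR (u i (X i t)))%:E)); last first.
  by move=> t _; rewrite /= ger0_norm ?expR_ge0// expR_sum.
rewrite (@integral_prod_iid (fun i z => expR (u i z)))//.
by move=> h; rewrite expRN mulrC EFinM lee_pdivlMr ?expR_gt0// muleC.
Qed.
End independence.

(** * Bernstein bound for functions of quadratic growth *)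

Section bernstein.
Variable R : realType.
Notation gamma := (normal_prob (0 : R) 1).
Notation "'E f" := (Rintegral gamma setT f) (at level 10, f at level 8).

Lemma measurable_superlevel d (T : measurableType d) (S : T -> R) (a : R) :
  measurable_fun setT S -> measurable [set w | a <= S w].
Proof.
move=> mS; rewrite (_ : [set _ | _] = setT `&` S @^-1` `[a, +oo[); first exact: mS.
by apply/seteqP; split => w /=; rewrite in_itv/= andbT => // -[].
Qed.

(** What matters is a remainder of second order: once the variable is centred, the linear term
    disappears in expectation. *)
Lemma expR_le_quad (x : R) : expR x <= 1 + x + x ^+ 2 * expR `|x|.
Proof.
have e1 : expR x * (1 - x) <= 1.
  have := expR_ge1Dx (- x); rewrite expRN => h.
  by rewrite mulrC -ler_pdivlMr ?expR_gt0// div1r.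
have ep := expR_gt0 x.
have [x0|x0] := leP 0 x.
  rewrite ger0_norm//; nra.
have e2 : 1 <= expR `|x| by rewrite -expR0 ler_expR.
have e3 := expR_ge1Dx x.
nra.
Qed.

Lemma sqr_quad_le_expR (z : R) : (1 + z ^+ 2) ^+ 2 <= 16 ^+ 2 * expR (z ^+ 2 / 8).
Proof.
have u0 : 0 <= z ^+ 2 / 8 by rewrite divr_ge0// sqr_ge0.
have := expR_ge1Dxn 1 u0; rewrite (_ : 2`!%:R = 2)// => h.
have -> : z ^+ 2 = 8 * (z ^+ 2 / 8) by field.
rewrite [8 * _ / 8](_ : _ = z ^+ 2 / 8); last by field.
move: u0 h; set u := z ^+ 2 / 8 => u0 h; have := sqr_ge0 (u - 1).
by nra.
Qed.

Lemma gauss_quad_bound (f : R -> R) (K : R) : measurable_fun setT f ->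
  (forall z, `|f z| <= K * (1 + z ^+ 2)) -> `|'E f| <= 2 * K.
Proof.
move=> mf fK; have tf : tame f by apply: tame_quad => //; exists K.
have tK : tame (fun z => K * (1 + z ^+ 2)).
  by apply: tameZ; apply: tameD; [exact: tame_cst|exact: tame_sqr].
have EK : 'E (fun z => K * (1 + z ^+ 2)) = 2 * K.
  rewrite gaussZ; last by apply: tameD; [exact: tame_cst|exact: tame_sqr].
  rewrite (@gaussD _ (cst 1)); [|exact: tame_cst|exact: tame_sqr].
  by rewrite gauss_cst gauss_sqr mulrC.
rewrite ler_norml; apply/andP; split.
  rewrite -EK -gaussN//; apply: gauss_le => //; first exact: tameN.
  by move=> z; have := fK z; rewrite ler_norml => /andP[].
by rewrite -EK; apply: gauss_le => // z; have := fK z; rewrite ler_norml => /andP[].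
Qed.

(** 48 is 3 times 16: the factor 3 bounds a centred function, the factor 16 is that of
    [sqr_quad_le_expR]. The other two factors are what remains of the exponentials in
    [mgf_bound]. *)
Definition mgf_cst : R := 48 ^+ 2 * expR 8^-1 * 'E (fun z => expR (z ^+ 2 / 4)).

Lemma tame_expR4 : tame (fun z : R => expR (z ^+ 2 / 4)).
Proof.
split; first exact: measurable_expR_sqr4.
by exists 1 => z; rewrite mul1r ger0_norm// expR_ge0.
Qed.

Lemma mgf_cst_ge0 : 0 <= mgf_cst.
Proof.
apply: mulr_ge0; first by apply: mulr_ge0 => //; exact: expR_ge0.
by apply: Rintegral_ge0 => z _; exact: expR_ge0.
Qed.

(** The bound on [s] keeps the exponent below (1 + z^2)/8 in absolute value (24 is 3 times 8). In
    the remainder s^2 Y^2 exp|s Y| the square and the exponential then cost a factor exp(z^2/8)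
    each, together the integrable exp(z^2/4), and the linear term has mean zero. *)
Lemma mgf_bound (f : R -> R) (K s : R) : measurable_fun setT f -> 0 < K ->
  (forall z, `|f z| <= K * (1 + z ^+ 2)) -> `|s| * (24 * K) <= 1 ->
  tame (fun z => expR (s * (f z - 'E f))) /\
  'E (fun z => expR (s * (f z - 'E f))) <= expR (mgf_cst * K ^+ 2 * s ^+ 2).
Proof.
move=> mf K0 fK sK.
pose Y z := f z - 'E f.
have mY : measurable_fun setT Y by exact: measurable_funB.
have YK z : `|Y z| <= 3 * K * (1 + z ^+ 2).
  apply: le_trans (ler_normB _ _) _.
  have := gauss_quad_bound mf fK; have := fK z; have := sqr_ge0 z.
  move: (`|f z|) (`|'E f|) (z ^+ 2) => a b c; clear - K0; nra.
have sY z : `|s * Y z| <= (1 + z ^+ 2) / 8.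
  rewrite normrM; apply: (le_trans (ler_wpM2l (normr_ge0 s) (YK z))).
  rewrite (_ : `|s| * (3 * K * (1 + z ^+ 2)) = (`|s| * (24 * K)) * ((1 + z ^+ 2) / 8)); last by field.
  by rewrite ler_piMl// divr_ge0// addr_ge0// sqr_ge0.
have eb z : expR `|s * Y z| <= expR 8^-1 * expR (z ^+ 2 / 8).
  by rewrite -expRD ler_expR (le_trans (sY z))//; lra.
have pt z : expR (s * Y z) <= 1 + s * Y z + (48 ^+ 2 * expR 8^-1 * K ^+ 2 * s ^+ 2) * expR (z ^+ 2 / 4).
  apply: le_trans (expR_le_quad _) _; rewrite lerD2l.
  have Y2 : Y z ^+ 2 <= 9 * K ^+ 2 * (16 ^+ 2 * expR (z ^+ 2 / 8)).
    rewrite -(ger0_norm (sqr_ge0 _)) normrX.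
    apply: (@le_trans _ _ ((3 * K * (1 + z ^+ 2)) ^+ 2)).
      rewrite ler_sqr// nnegrE mulr_ge0// ?mulr_ge0 ?addr_ge0 ?sqr_ge0//; lra.
    rewrite exprMn (_ : (3 * K) ^+ 2 = 9 * K ^+ 2); last by ring.
    by rewrite ler_wpM2l ?sqr_quad_le_expR// mulr_ge0 ?sqr_ge0.
  rewrite exprMn.
  apply: (@le_trans _ _ (s ^+ 2 * (9 * K ^+ 2 * (16 ^+ 2 * expR (z ^+ 2 / 8))) * (expR 8^-1 * expR (z ^+ 2 / 8)))).
    apply: ler_pM => //; first by rewrite mulr_ge0 ?sqr_ge0.
    by rewrite ler_wpM2l ?sqr_ge0.
  rewrite (_ : z ^+ 2 / 4 = z ^+ 2 / 8 + z ^+ 2 / 8); last by field.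
  by rewrite expRD le_eqVlt; apply/orP; left; apply/eqP; ring.
have tY : tame Y by apply: tame_quad => //; exists (3 * K).
have texp : tame (fun z => expR (s * Y z)).
  split; first by apply: measurableT_comp => //; exact: measurable_funM.
  exists (expR 8^-1) => z; rewrite ger0_norm ?expR_ge0//.
  apply: (@le_trans _ _ (expR `|s * Y z|)); first by rewrite ler_expR ler_norm.
  apply: (le_trans (eb z)); rewrite ler_wpM2l ?expR_ge0// ler_expR.
  by have := sqr_ge0 z; lra.
split=> //.
have tR := tameZ (48 ^+ 2 * expR 8^-1 * K ^+ 2 * s ^+ 2) tame_expR4.
have tL : tame (fun z => 1 + s * Y z).
  by apply: tameD; [exact: tame_cst|exact: tameZ].
apply: (@le_trans _ _ ('E (fun z => 1 + s * Y z + (48 ^+ 2 * expR 8^-1 * K ^+ 2 * s ^+ 2) * expR (z ^+ 2 / 4)))).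
  by apply: gauss_le => //; exact: tameD.
rewrite gaussD// (@gaussD _ (cst 1) (fun z => s * Y z)); [|exact: tame_cst|exact: tameZ].
have E4 : 'E (fun z => 48 ^+ 2 * expR 8^-1 * K ^+ 2 * s ^+ 2 * expR (z ^+ 2 / 4)) =
    48 ^+ 2 * expR 8^-1 * K ^+ 2 * s ^+ 2 * 'E (fun z => expR (z ^+ 2 / 4)).
  exact: gaussZ tame_expR4.
rewrite E4 gauss_cst gaussZ//.
have -> : 'E Y = 0.
  rewrite gaussB//; [|by apply: tame_quad => //; exists K|exact: tame_cst].
  by rewrite gauss_cst subrr.
rewrite mulr0 addr0 (le_trans _ (expR_ge1Dx _))// lerD2l /mgf_cst.
by rewrite le_eqVlt; apply/orP; left; apply/eqP; ring.
Qed.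

(** [M] stands for the scale n. The constant [c] is chosen before the index set, the probability
    space and the functions: this order makes the final constants independent of N, theta and
    lambda. With t <= 1 the bound stays in its gaussian regime. *)
Lemma bernstein_upper_tail (K kap : R) : 0 < K -> 0 < kap ->
  exists2 c : R, 0 < c &
  forall (I : finType) (d : measure_display) (T : measurableType d)
    (P : probability T R) (X : I -> T -> R), iid_std_normal P X ->
  forall (M : R), #|I|%:R <= kap * M ->
  forall f : I -> R -> R, (forall i, measurable_fun setT (f i)) ->
    (forall i z, `|f i z| <= K * (1 + z ^+ 2)) ->
  forall t, 0 <= t <= 1 ->
  (P [set w | M * t <= \sum_i (f i (X i w) - 'E (f i))]%R <= (expR (- (c * M * t ^+ 2)))%:E)%E.
Proof.
move=> K0 kap0.
have C0 := mgf_cst_ge0.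
(* The Chernoff parameter is t/D. The first term of D makes it admissible in [mgf_bound]; the second
   keeps the quadratic term of the exponent below half of the linear one, whence the rate 1/(2
   D). *)
pose D := 24 * K + 2 * mgf_cst * K ^+ 2 * kap.
have D0 : 0 < D by rewrite ltr_pwDl ?mulr_gt0// mulr_ge0 ?(ltW kap0)// mulr_ge0 ?sqr_ge0// mulr_ge0.
pose s1 := D^-1.
have s10 : 0 < s1 by rewrite invr_gt0.
have s1D : s1 * D = 1 by rewrite mulVf// gt_eqF.
exists (s1 / 2); first by rewrite divr_gt0.
move=> I d T P X iid M IM f mf fK t /andP[t0 t1].
have M0 : 0 <= M by rewrite -(pmulr_rge0 _ kap0) (le_trans _ IM).
pose s := s1 * t.
have s0 : 0 <= s by rewrite mulr_ge0// ltW.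
have A0 : 0 <= mgf_cst * K ^+ 2 by rewrite mulr_ge0// sqr_ge0.
have sK : `|s| * (24 * K) <= 1.
  rewrite ger0_norm// /s; apply: (@le_trans _ _ (s1 * D)); last by rewrite s1D.
  rewrite -mulrA ler_wpM2l ?(ltW s10)//; apply: (@le_trans _ _ (24 * K)).
    by rewrite ler_piMl// mulr_ge0// ltW.
  by rewrite /D lerDl mulr_ge0 ?(ltW kap0)// mulr_ge0 ?sqr_ge0// mulr_ge0.
have mg i := mgf_bound (mf i) K0 (fK i) sK.
pose u i z := s * (f i z - 'E (f i)).
apply: (@le_trans _ _ (P [set w | s * (M * t) <= \sum_i u i (X i w)])).
  have mS : measurable [set w | s * (M * t) <= \sum_i u i (X i w)].
    apply: measurable_superlevel; apply: measurable_sum => i.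
    apply: measurableT_comp (iid.1 i); apply: measurable_funM => //.
    exact: measurable_funB.
  apply: le_measure => //; rewrite ?inE//.
    apply: measurable_superlevel; apply: measurable_sum => i.
    apply: measurable_funB => //; exact: measurableT_comp (iid.1 i).
  by move=> w /= h; rewrite -mulr_sumr ler_wpM2l.
apply: le_trans (chernoff iid _ _ _) _.
- move=> i; apply: measurable_funM => //; exact: measurable_funB.
- by move=> i; exact: (mg i).1.
rewrite lee_fin.
apply: (@le_trans _ _ (expR (- (s * (M * t))) * \prod_(i : I) expR (mgf_cst * K ^+ 2 * s ^+ 2))).
  rewrite ler_wpM2l ?expR_ge0// ler_prod// => i _.
  rewrite (mg i).2 andbT; apply: Rintegral_ge0 => z _; exact: expR_ge0.
rewrite -expR_sum -expRD ler_expR sumr_const -(mulr_natr (mgf_cst * K ^+ 2 * s ^+ 2)).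
have : mgf_cst * K ^+ 2 * s ^+ 2 * #|I|%:R <= mgf_cst * K ^+ 2 * s ^+ 2 * (kap * M).
  by rewrite ler_wpM2l// mulr_ge0// sqr_ge0.
have h2 : 2 * mgf_cst * K ^+ 2 * kap * s1 <= 1.
  rewrite mulrC; apply: (@le_trans _ _ (s1 * D)); last by rewrite s1D.
  by rewrite ler_wpM2l ?(ltW s10)// /D lerDr ltW// mulr_gt0.
have h3 : 0 <= s1 * t ^+ 2 * M by rewrite !mulr_ge0 ?sqr_ge0// ltW.
have -> : mgf_cst * K ^+ 2 * s ^+ 2 * (kap * M) = (2 * mgf_cst * K ^+ 2 * kap * s1) * ((s1 * t ^+ 2 * M) / 2).
  by rewrite /s; field.
have -> : s * (M * t) = s1 * t ^+ 2 * M by rewrite /s; ring.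
have -> : s1 / 2 * M * t ^+ 2 = s1 * t ^+ 2 * M / 2 by ring.
move: (2 * mgf_cst * K ^+ 2 * kap * s1) (s1 * t ^+ 2 * M) h2 h3 => a b h2 h3.
nra.
Qed.

Lemma bernstein (K kap : R) : 0 < K -> 0 < kap ->
  exists2 c : R, 0 < c &
  forall (I : finType) (d : measure_display) (T : measurableType d)
    (P : probability T R) (X : I -> T -> R), iid_std_normal P X ->
  forall (M : R), #|I|%:R <= kap * M ->
  forall f : I -> R -> R, (forall i, measurable_fun setT (f i)) ->
    (forall i z, `|f i z| <= K * (1 + z ^+ 2)) ->
  forall t, 0 <= t <= 1 ->
  (P [set w | M * t <= `|\sum_i (f i (X i w) - 'E (f i))|]%R <= (2 * expR (- (c * M * t ^+ 2)))%:E)%E.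
Proof.
move=> K0 kap0; have [c c0 H] := bernstein_upper_tail K0 kap0.
exists c => // I d T P X iid M IM f mf fK t t01.
have H1 := H I d T P X iid M IM f mf fK t t01.
have H2 := H I d T P X iid M IM (fun i z => - f i z) (fun i => measurable_funN (mf i)) _ t t01.
have {}H2 := H2 (fun i z => eq_ind_r (fun x => x <= K * (1 + z ^+ 2)) (fK i z) (normrN (f i z))).
have tf i : tame (f i) by apply: tame_quad => //; exists K.
have mS (g : I -> R -> R) : (forall i, measurable_fun setT (g i)) ->
    measurable [set w | M * t <= \sum_i (g i (X i w) - 'E (g i))].
  move=> mg; apply: measurable_superlevel; apply: measurable_sum => i.
  apply: measurable_funB => //; exact: measurableT_comp (iid.1 i).
apply: (@le_trans _ _ (P ([set w | M * t <= \sum_i (f i (X i w) - 'E (f i))] `|`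
   [set w | M * t <= \sum_i (- f i (X i w) - 'E (fun z => - f i z))]))).
  apply: le_measure; rewrite ?inE.
  - apply: measurable_superlevel; apply: measurableT_comp => //; apply: measurable_sum => i.
    apply: measurable_funB => //; exact: measurableT_comp (iid.1 i).
  - apply: measurableU; first exact: mS.
    by apply: (mS (fun i z => - f i z)) => i; exact: measurable_funN.
  - move=> w /=; rewrite ler_normr => /orP[h|h]; [by left|right].
    rewrite (eq_bigr (fun i => - (f i (X i w) - 'E (f i)))) ?sumrN// => i _.
    by rewrite gaussN// opprB opprK addrC.
have mf' i : measurable_fun setT (fun z => - f i z) by exact: measurable_funN.
apply: (@le_trans _ _ (P [set w | M * t <= \sum_i (f i (X i w) - 'E (f i))]%R +
   P [set w | M * t <= \sum_i (- f i (X i w) - 'E (fun z => - f i z))]%R)%E).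
  apply: measureU2; [exact: mS|exact: (mS (fun i z => - f i z))].
by rewrite mulr_natl mulr2n EFinD leeD.
Qed.

(** The term g'/sqrt n of the objective is a single variable and not an average; Markov's inequality
    for exp(z^2/4) bounds it directly. *)
Lemma gauss_tail_iid : exists2 C : R, 0 < C &
  forall (I : finType) (d : measure_display) (T : measurableType d)
    (P : probability T R) (X : I -> T -> R), iid_std_normal P X ->
  forall i0 (a : R), (P [set w | a <= X i0 w ^+ 2]%R <= (C * expR (- (a / 4)))%:E)%E.
Proof.
exists ('E (fun z => expR (z ^+ 2 / 4))).
  apply: (@lt_le_trans _ _ ('E (cst 1))); first by rewrite gauss_cst.
  apply: gauss_le; [exact: tame_cst|exact: tame_expR4|move=> z /=].
  by rewrite -expR0 ler_expR divr_ge0 ?sqr_ge0.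
move=> I d T P X iid i0 a.
pose u i z : R := if i == i0 then z ^+ 2 / 4 else 0.
have mu i : measurable_fun setT (u i).
  by rewrite /u; case: (i == i0) => //; exact: measurable_funM.
apply: (@le_trans _ _ (P [set w | a / 4 <= \sum_i u i (X i w)])).
  have e w : \sum_i u i (X i w) = X i0 w ^+ 2 / 4.
    rewrite (bigD1 i0)//= big1 ?addr0 /u ?eqxx// => i ii0.
    by rewrite (negbTE ii0).
  apply: le_measure; rewrite ?inE.
  - by apply: measurable_superlevel; apply: measurable_funX; exact: iid.1.
  - apply: measurable_superlevel; apply: measurable_sum => i.
    exact: measurableT_comp (iid.1 i).
  - by move=> w /= h; rewrite e ler_wpM2r.
apply: le_trans (chernoff iid _ mu _) _.
  move=> i; rewrite /u; case: (i == i0); first exact: tame_expR4.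
  rewrite expR0; exact: (tame_cst 1).
rewrite (bigD1 i0)//= big1 ?mulr1; last first.
  move=> i ii0; rewrite /u (negbTE ii0).
  by rewrite expR0 (gauss_cst 1).
by rewrite /u eqxx mulrC.
Qed.
End bernstein.

(** * Saddle point conditions *)

Section scalar.
Variable R : realType.
Implicit Types (x y b z t : R).

(* Strong convexity of [w |-> sqrt (|w|^2 + sg^2)]: [T] and [T'] are its values at [w] and
   [w + d], [p] is the scalar product of [w] and [d], and [x] is the norm of [d]. *)
Lemma hyper_gap (T T' p x sg : R) : 0 < T -> 0 <= T' -> 0 <= x ->
  T' ^+ 2 = T ^+ 2 + 2 * p + x ^+ 2 -> p ^+ 2 <= (T ^+ 2 - sg ^+ 2) * x ^+ 2 ->
  `|T' - T| <= x /\
  sg ^+ 2 * x ^+ 2 / (2 * T ^+ 2 * (T + x)) <= T' - T - p / T.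
Proof.
move=> T0 T'0 x0 eT' ep.
have pTx : `|p| <= T * x.
  rewrite -(@ler_pXn2r _ 2)// ?nnegrE ?mulr_ge0 ?(ltW T0)// real_normK ?num_real//.
  by rewrite exprMn (le_trans ep)// ler_wpM2r ?sqr_ge0// gerBl sqr_ge0.
move: (pTx); rewrite ler_norml => /andP[p1 p2].
have up : T' <= T + x.
  rewrite -(@ler_pXn2r _ 2)// ?nnegrE ?addr_ge0 ?(ltW T0)//.
  by rewrite eT' sqrrD; lra.
have lo : T - x <= T'.
  have [h|h] := leP (T - x) 0; first exact: le_trans h T'0.
  rewrite -(@ler_pXn2r _ 2)// ?nnegrE ?(ltW h)//.
  by rewrite eT' sqrrB; lra.
split; first by rewrite ler_norml; apply/andP; split; lra.
have pp : `|T ^+ 2 + p| <= T * T'.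
  rewrite -(@ler_pXn2r _ 2)// ?nnegrE ?mulr_ge0 ?(ltW T0)// real_normK ?num_real//.
  rewrite exprMn eT'; have : 0 <= sg ^+ 2 * x ^+ 2 by rewrite mulr_ge0 ?sqr_ge0.
  by move: ep; rewrite sqrrD; lra.
move: pp; rewrite ler_norml => /andP[pp1 pp2].
have [x00|x00] := eqVneq x 0.
  have p0 : p = 0.
    by apply/eqP; rewrite -normr_le0 (le_trans pTx)// x00 mulr0.
  by rewrite x00 expr0n/= mulr0 mul0r p0 mul0r subr0; move: lo; rewrite x00 subr0 subr_ge0.
have xp : 0 < x by rewrite lt_def x00.
have Tx : 0 < T + x by rewrite addr_gt0.
have T2 : 0 < T ^+ 2 by rewrite exprn_gt0.
rewrite ler_pdivrMr ?mulr_gt0//.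
have -> : (T' - T - p / T) * (2 * T ^+ 2 * (T + x)) =
  (T * T' - (T ^+ 2 + p)) * (2 * (T * (T + x))) by field; rewrite gt_eqF.
(* The conjugate factor T T' + T^2 + p turns the difference into T^2 x^2 - p^2, which is at least
   sg^2 x^2 by the Cauchy-Schwarz hypothesis; that factor itself is at most 2 T (T + x). *)
apply: (@le_trans _ _ ((T * T' - (T ^+ 2 + p)) * (T * T' + (T ^+ 2 + p)))).
  have -> : (T * T' - (T ^+ 2 + p)) * (T * T' + (T ^+ 2 + p)) = T ^+ 2 * T' ^+ 2 - (T ^+ 2 + p) ^+ 2 by ring.
  by rewrite eT'; move: ep; rewrite [(T ^+ 2 + p) ^+ 2]sqrrD; lra.
apply: ler_wpM2l; first by rewrite subr_ge0.
have : T * T' <= T * (T + x) by rewrite ler_wpM2l// ltW.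
lra.
Qed.

Lemma soft_thrE x b : 0 <= b -> soft_thr x b = Num.max (x - b) 0 - Num.max (- x - b) 0.
Proof.
move=> b0; rewrite /soft_thr /pospart.
have [x0|x0|->] := ltgtP x 0; last 1 first.
- by rewrite sgr0 mul0r oppr0 subrr.
- rewrite ltr0_sg// ltr0_norm// (@max_r _ _ (x - b)) ?sub0r ?mulN1r//; lra.
- rewrite gtr0_sg// gtr0_norm// mul1r (@max_r _ _ (- x - b)) ?subr0//; lra.
Qed.

Lemma soft_thr_dist x b : 0 <= b -> `|x - soft_thr x b| <= b.
Proof.
move=> b0; rewrite soft_thrE// ler_norml.
case: (leP (x - b) 0) => h1; case: (leP (- x - b) 0) => h2; apply/andP; split; lra.
Qed.

Lemma soft_thr_dual x b : 0 <= b ->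
  (x - soft_thr x b) * soft_thr x b = b * `|soft_thr x b|.
Proof.
move=> b0; rewrite soft_thrE//.
case: (leP (x - b) 0) => h1; case: (leP (- x - b) 0) => h2.
- by rewrite subrr mulr0 normr0 mulr0.
- by rewrite sub0r normrN ger0_norm ?(ltW h2)//; ring.
- by rewrite subr0 ger0_norm ?(ltW h1)//; ring.
- lra.
Qed.

(** The residual left by soft thresholding is b times a subgradient of the absolute value at the
    thresholded point: it is at most b in size ([soft_thr_dist]) and attains the duality pairing
    ([soft_thr_dual]). *)
Lemma soft_thr_subgrad x b y : 0 <= b ->
  (x - soft_thr x b) * (y - soft_thr x b) <= b * (`|y| - `|soft_thr x b|).
Proof.
move=> b0; rewrite mulrBr soft_thr_dual// mulrBr lerD2r.
rewrite (le_trans (ler_norm _))// normrM ler_wpM2r//; exact: soft_thr_dist.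
Qed.

Lemma measurable_soft_thr b : 0 <= b -> measurable_fun setT (fun x : R => soft_thr x b).
Proof.
move=> b0; under eq_fun do rewrite soft_thrE//.
apply: measurable_funB; apply: measurable_maxr => //; apply: measurable_funB => //.
Qed.
End scalar.

Section linear_growth.
Variable R : realType.
Implicit Types f g : R -> R.

(** Both z and the optimal w, as a function of z, grow linearly, so the second moments below are
    expectations of products of two such functions, which are [tame]. *)
Definition lin f := measurable_fun setT f /\
  exists K, forall z : R, `|f z| <= K * (1 + `|z|).

Lemma linM_quad f g : lin f -> lin g ->
  measurable_fun setT (fun z => f z * g z) /\
  exists K, forall z, `|f z * g z| <= K * (1 + z ^+ 2).
Proof.
move=> [mf [K fK]] [mg [K' gK]]; split; first exact: measurable_funM.
exists (2 * (`|K| * `|K'|)) => z; rewrite normrM.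
have z0 := normr_ge0 z.
have h1 : `|f z| <= `|K| * (1 + `|z|).
  by apply: le_trans (fK z) _; rewrite ler_wpM2r ?ler_norm// addr_ge0.
have h2 : `|g z| <= `|K'| * (1 + `|z|).
  by apply: le_trans (gK z) _; rewrite ler_wpM2r ?ler_norm// addr_ge0.
apply: le_trans (ler_pM (normr_ge0 _) (normr_ge0 _) h1 h2) _.
rewrite mulrACA [2 * _]mulrC -[leRHS]mulrA ler_wpM2l ?mulr_ge0//.
by rewrite -(real_normK (num_real z)); have := sqr_ge0 (`|z| - 1); rewrite sqrrB -expr2 sqrrD; lra.
Qed.

Lemma linM_tame f g : lin f -> lin g -> tame (fun z => f z * g z).
Proof. by move=> lf lg; have [mfg] := linM_quad lf lg; exact: tame_quad. Qed.

Lemma linX_tame f : lin f -> tame (fun z => f z ^+ 2).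
Proof. by move=> lf; have := linM_tame lf lf. Qed.

Lemma lin_cst c : lin (cst c).
Proof. by split => //; exists `|c| => z /=; rewrite ler_peMr// lerDl. Qed.

Lemma lin_id : lin (fun z => z).
Proof. by split => //; exists 1 => z; rewrite mul1r lerDr. Qed.

Lemma lin_tame f : lin f -> tame f.
Proof.
move=> lf; have := linM_tame lf (lin_cst 1).
by under eq_fun do rewrite /= mulr1.
Qed.

Lemma linD f g : lin f -> lin g -> lin (fun z => f z + g z).
Proof.
move=> [mf [K fK]] [mg [K' gK]]; split; first exact: measurable_funD.
by exists (K + K') => z; rewrite mulrDl (le_trans (ler_normD _ _))// lerD.
Qed.

Lemma linZ c f : lin f -> lin (fun z => c * f z).
Proof.
move=> [mf [K fK]]; split; first exact: measurable_funM.
by exists (`|c| * K) => z; rewrite normrM -mulrA ler_wpM2l.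
Qed.

Lemma linB f g : lin f -> lin g -> lin (fun z => f z - g z).
Proof.
move=> lf lg; have := linD lf (linZ (-1) lg).
by under eq_fun do rewrite mulN1r.
Qed.

Lemma lin_norm f : lin f -> lin (fun z => `|f z|).
Proof.
move=> [mf [K fK]]; split; last by exists K => z; rewrite normr_id.
exact: measurableT_comp.
Qed.

End linear_growth.

(** * Averages over the coordinates and a gaussian *)

Section mean.
Variable R : realType.
Notation gamma := (normal_prob (0 : R) 1).
Notation "'E f" := (Rintegral gamma setT f) (at level 10, f at level 8).
Variable N : nat.
Hypothesis N0 : (0 < N)%N.
Implicit Types F G : 'I_N -> R -> R.

(** The expectation under (Theta, Z), with the index i in the place of Theta: competitors may depend
    on the coordinate, and vectors of R^N are the families that are constant in z. *)
Definition Em F : R := (\sum_(i < N) 'E (F i)) / N%:R.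

Let Npos : 0 < N%:R :> R. Proof. by rewrite ltr0n. Qed.

Lemma Em_eq F G : (forall i z, F i z = G i z) -> Em F = Em G.
Proof. by move=> FG; congr (_ / _); apply: eq_bigr => i _; apply: gauss_eq => z. Qed.

Lemma EmD F G : (forall i, tame (F i)) -> (forall i, tame (G i)) ->
  Em (fun i z => F i z + G i z) = Em F + Em G.
Proof.
move=> tF tG; rewrite /Em -mulrDl -big_split; congr (_ / _).
by apply: eq_bigr => i _; exact: gaussD.
Qed.

Lemma EmZ c F : (forall i, tame (F i)) -> Em (fun i z => c * F i z) = c * Em F.
Proof.
move=> tF; rewrite /Em mulrA mulr_sumr; congr (_ / _).
by apply: eq_bigr => i _; exact: gaussZ.
Qed.

Lemma EmB F G : (forall i, tame (F i)) -> (forall i, tame (G i)) ->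
  Em (fun i z => F i z - G i z) = Em F - Em G.
Proof.
move=> tF tG; rewrite /Em -mulrBl -sumrB; congr (_ / _).
by apply: eq_bigr => i _; exact: gaussB.
Qed.

Lemma Em_le F G : (forall i, tame (F i)) -> (forall i, tame (G i)) ->
  (forall i z, F i z <= G i z) -> Em F <= Em G.
Proof.
move=> tF tG FG; rewrite /Em ler_wpM2r ?invr_ge0 ?(ltW Npos)//.
by apply: ler_sum => i _; exact: gauss_le.
Qed.

Lemma Em_ge0 F : (forall i z, 0 <= F i z) -> 0 <= Em F.
Proof.
move=> F0; apply: divr_ge0; last exact: ltW.
by apply: sumr_ge0 => i _; exact: Rintegral_ge0.
Qed.

Lemma Em_mean (c : 'I_N -> R) : Em (fun i => cst (c i)) = (\sum_i c i) / N%:R.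
Proof. by congr (_ / _); apply: eq_bigr => i _; exact: gauss_cst. Qed.

Lemma Em_const f : Em (fun _ => f) = 'E f.
Proof. by rewrite /Em sumr_const card_ord -(mulr_natr ('E f)) mulfK// gt_eqF. Qed.

Lemma Em_cauchy_schwarz F G : (forall i, lin (F i)) -> (forall i, lin (G i)) ->
  Em (fun i z => F i z * G i z) ^+ 2 <=
  Em (fun i z => F i z ^+ 2) * Em (fun i z => G i z ^+ 2).
Proof.
move=> lF lG.
have key t : 0 <= Em (fun i z => F i z ^+ 2) + (2 * t * Em (fun i z => F i z * G i z) +
    t ^+ 2 * Em (fun i z => G i z ^+ 2)).
  rewrite -EmZ; last by move=> i; exact: linM_tame.
  rewrite -EmZ; last by move=> i; exact: linX_tame.
  rewrite -EmD; last 2 first.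
  - by move=> i; apply: tameZ; exact: linM_tame.
  - by move=> i; apply: tameZ; exact: linX_tame.
  rewrite -EmD; last 2 first.
  - by move=> i; exact: linX_tame.
  - move=> i; apply: tameD; apply: tameZ; [exact: linM_tame|exact: linX_tame].
  rewrite (@Em_eq _ (fun i z => (F i z + t * G i z) ^+ 2)); last by move=> i z; ring.
  by apply: Em_ge0 => i z; exact: sqr_ge0.
have c0 : 0 <= Em (fun i z => G i z ^+ 2) by apply: Em_ge0 => i z; exact: sqr_ge0.
move: key c0; move: (Em (fun i z => F i z * G i z)) (Em (fun i z => F i z ^+ 2))
  (Em (fun i z => G i z ^+ 2)) => b a c key c0.
have [c00|cn0] := eqVneq c 0.
  rewrite c00 mulr0; have [->|bn0] := eqVneq b 0; first by rewrite expr0n.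
  (* If the second factor vanishes in mean square while b does not, the quadratic is affine in t and
     takes the value -1 at this t. *)
  have := key (- (a + 1) / (2 * b)); rewrite c00.
  have -> : a + (2 * (- (a + 1) / (2 * b)) * b + (- (a + 1) / (2 * b)) ^+ 2 * 0) = -1.
    by field.
  by rewrite oppr_ge0 ler10.
have cp : 0 < c by rewrite lt_def cn0.
have := key (- b / c).
have -> : a + (2 * (- b / c) * b + (- b / c) ^+ 2 * c) = (a * c - b ^+ 2) / c by field.
by rewrite ler_pdivlMr// mul0r subr_ge0.
Qed.

End mean.

(** * Perturbation of the saddle function *)

Section saddle.
Variable R : realType.
Variables (N : nat) (delta sigma lam : R) (theta : 'I_N -> R).
Hypothesis N0 : (0 < N)%N.
Hypothesis delta0 : 0 < delta.
Hypothesis sigma0 : 0 < sigma.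
Hypothesis lam0 : 0 < lam.
Implicit Types (beta tau th z b t x y : R) (w : 'I_N -> R -> R).

Notation linf w := (forall i, lin (w i)).

Definition obj beta tau th z x : R :=
  x ^+ 2 / (2 * tau) * beta - beta * z * x + lam * `|x + th| - lam * `|th|.

Definition wopt beta tau th z := soft_thr (th + tau * z) (tau * lam / beta) - th.

Definition wst beta tau (i : 'I_N) z := wopt beta tau (theta i) z.

(** First-order optimality in the scalar problem: beta (z - w/tau) is lam times a subgradient of y
    -> |y + th| at the minimiser w. Averaged over coordinates, it replaces every derivative of the
    l1 norm. *)
Lemma wopt_subgrad beta tau th z y : 0 < beta -> 0 < tau ->
  beta * (z - wopt beta tau th z / tau) * (y - wopt beta tau th z) <=
  lam * (`|y + th| - `|wopt beta tau th z + th|).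
Proof.
move=> b0 t0; set b := tau * lam / beta.
have b_ge0 : 0 <= b by rewrite divr_ge0 ?mulr_ge0 ?ltW.
have := soft_thr_subgrad (th + tau * z) (y + th) b_ge0.
rewrite /wopt -/b; set s := soft_thr _ _ => h.
rewrite subrK.
have bt : 0 < beta / tau by rewrite divr_gt0.
rewrite -(@ler_pM2l _ (beta / tau)) // in h.
have e1 : beta / tau * (b * (`|y + th| - `|s|)) = lam * (`|y + th| - `|s|).
  by rewrite /b; field; rewrite !gt_eqF.
have e2 : beta / tau * ((th + tau * z - s) * (y + th - s)) =
  beta * (z - (s - th) / tau) * (y - (s - th)).
  by field; rewrite gt_eqF.
by rewrite -e1 -e2.
Qed.

Lemma obj_wopt beta tau th z y : 0 < beta -> 0 < tau ->
  obj beta tau th z (wopt beta tau th z) <= obj beta tau th z y.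
Proof.
move=> b0 t0; have := wopt_subgrad th z y b0 t0.
set w := wopt _ _ _ _ => h; rewrite -subr_ge0.
have -> : obj beta tau th z y - obj beta tau th z w =
  lam * (`|y + th| - `|w + th|) - beta * (z - w / tau) * (y - w)
  + beta / (2 * tau) * (y - w) ^+ 2.
  by rewrite /obj; field; rewrite gt_eqF.
rewrite addr_ge0 ?subr_ge0// mulr_ge0 ?sqr_ge0// divr_ge0 ?(ltW b0)// mulr_ge0// ltW//.
Qed.

Lemma scalar_min_le beta tau th z y : 0 < beta -> 0 < tau ->
  scalar_min beta tau lam th z <= obj beta tau th z y.
Proof.
move=> b0 t0; apply: ge_inf; last by exists y.
(* [inf] is a lower bound only for a set that is bounded below; the value at [wopt] supplies the
   bound. *)
by exists (obj beta tau th z (wopt beta tau th z)) => _ [x _ <-]; exact: obj_wopt.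
Qed.

Lemma scalar_min_ge beta tau th z c : (forall y, c <= obj beta tau th z y) ->
  c <= scalar_min beta tau lam th z.
Proof.
move=> h; apply: lb_le_inf; first by exists (obj beta tau th z 0); exists 0.
by move=> _ [x _ <-]; exact: h.
Qed.

Lemma scalar_minE beta tau th z : 0 < beta -> 0 < tau ->
  scalar_min beta tau lam th z = obj beta tau th z (wopt beta tau th z).
Proof.
move=> b0 t0; apply/eqP; rewrite eq_le scalar_min_le//=.
by apply: scalar_min_ge => y; exact: obj_wopt.
Qed.

Lemma wopt_bound beta tau th z : 0 < beta -> 0 < tau ->
  `|wopt beta tau th z| <= tau * `|z| + tau * lam / beta.
Proof.
move=> b0 t0; set b := tau * lam / beta.
have b_ge0 : 0 <= b by rewrite divr_ge0 ?mulr_ge0 ?ltW.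
have := soft_thr_dist (th + tau * z) b_ge0; rewrite /wopt -/b.
set s := soft_thr _ _ => h.
rewrite (_ : s - th = tau * z - (th + tau * z - s)); last by ring.
by rewrite (le_trans (ler_normB _ _))// lerD// normrM (gtr0_norm t0).
Qed.

Lemma lin_wopt beta tau th : 0 < beta -> 0 < tau -> lin (wopt beta tau th).
Proof.
move=> b0 t0; have b_ge0 : 0 <= tau * lam / beta by rewrite divr_ge0 ?mulr_ge0 ?ltW.
split.
  apply: measurable_funB => //.
  apply: (measurableT_comp (measurable_soft_thr b_ge0)).
  by apply: measurable_funD => //; exact: measurable_funM.
exists (tau + tau * lam / beta) => z; apply: le_trans (wopt_bound _ _ b0 t0) _.
rewrite -subr_ge0 (_ : _ - _ = tau + tau * lam / beta * `|z|); last by ring.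
by rewrite addr_ge0 ?(ltW t0)// mulr_ge0.
Qed.

Lemma lin_wst beta tau : 0 < beta -> 0 < tau -> linf (wst beta tau).
Proof. by move=> b0 t0 i; exact: lin_wopt. Qed.

Definition W2 w := Em (fun i z => w i z ^+ 2).
Definition ZW w := Em (fun i z => z * w i z).
Definition L1 w := Em (fun i z => `|w i z + theta i| - `|theta i|).

(** The saddle function with the inner minimum replaced by an arbitrary competitor w. By [psi_opt]
    and [psi_le], [psi] is its minimum over w, so freezing w while tau moves gives one-sided
    comparisons. *)
Definition Psi beta tau w : R :=
  (sigma ^+ 2 / tau + tau) * beta / 2 - 2^-1 * beta ^+ 2
  + delta^-1 * (beta / (2 * tau) * W2 w - beta * ZW w + lam * L1 w).

Lemma tame_L1 w i : linf w -> tame (fun z => `|w i z + theta i| - `|theta i|).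
Proof.
move=> lw; apply: tameB; last exact: tame_cst.
by apply: lin_tame; apply: lin_norm; apply: linD => //; exact: lin_cst.
Qed.

Lemma tame_ZW w i : linf w -> tame (fun z => z * w i z).
Proof. by move=> lw; apply: linM_tame => //; exact: lin_id. Qed.

Lemma Em_obj beta tau w : linf w ->
  Em (fun i z => obj beta tau (theta i) z (w i z)) =
  beta / (2 * tau) * W2 w - beta * ZW w + lam * L1 w.
Proof.
move=> lw.
rewrite -EmZ; last by move=> i; exact: linX_tame.
rewrite -EmZ; last by move=> i; exact: tame_ZW.
rewrite -EmZ; last by move=> i; exact: tame_L1.
rewrite -EmB; last 2 first.
- by move=> i; apply: tameZ; exact: linX_tame.
- by move=> i; apply: tameZ; exact: tame_ZW.
rewrite -EmD; last 2 first.
- by move=> i; apply: tameB; apply: tameZ; [exact: linX_tame|exact: tame_ZW].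
- by move=> i; apply: tameZ; exact: tame_L1.
by apply: Em_eq => i z; rewrite /obj; ring.
Qed.

Lemma tame_obj beta tau w i : linf w -> tame (fun z => obj beta tau (theta i) z (w i z)).
Proof.
move=> lw; rewrite (_ : (fun z => _) = (fun z => beta / (2 * tau) * w i z ^+ 2 - beta * (z * w i z)
  + lam * (`|w i z + theta i| - `|theta i|))).
  by apply: tameD; [apply: tameB; apply: tameZ; [exact: linX_tame|exact: tame_ZW]|apply: tameZ; exact: tame_L1].
by apply/funext => z; rewrite /obj; ring.
Qed.

Lemma psiE beta tau : psi delta sigma lam theta beta tau =
  (sigma ^+ 2 / tau + tau) * beta / 2 - 2^-1 * beta ^+ 2
  + delta^-1 * Em (fun i z => scalar_min beta tau lam (theta i) z).
Proof. by []. Qed.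

Lemma psi_opt beta tau : 0 < beta -> 0 < tau ->
  psi delta sigma lam theta beta tau = Psi beta tau (wst beta tau).
Proof.
move=> b0 t0; rewrite psiE /Psi -Em_obj; last exact: lin_wst.
by congr (_ + _); congr (_ * _); apply: Em_eq => i z; exact: scalar_minE.
Qed.

Lemma psi_le beta tau w : 0 < beta -> 0 < tau -> linf w ->
  psi delta sigma lam theta beta tau <= Psi beta tau w.
Proof.
move=> b0 t0 lw; rewrite psiE /Psi -Em_obj// lerD2l ler_wpM2l ?invr_ge0 ?(ltW delta0)//.
apply: Em_le => //.
- move=> i; rewrite (_ : (fun z => _) = (fun z => obj beta tau (theta i) z (wst beta tau i z))).
    by apply: tame_obj; exact: lin_wst.
  by apply/funext => z; exact: scalar_minE.
- by move=> i; exact: tame_obj.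
- by move=> i z; exact: scalar_min_le.
Qed.

Variables beta tau : R.
Hypothesis att : attains_maxmin delta sigma lam theta beta tau.

Notation psi' := (psi delta sigma lam theta).

Let tau0 : 0 < tau.
Proof. by have [_ st _ _] := att; exact: lt_le_trans st. Qed.

(** Put c = lam/b. For |z| <= c the objective stays above -lam |th| + b th z, and the excess r =
    (|z| - c)_+ measures the failure of this bound. As r <= z^2/c and r^2 <= z^4/c^2, the loss
    proportional to t carries b^3 and the one proportional to |th| carries b^2, so for small b both
    are beaten by the term b t/2 of [psi], for every t >= sigma. *)
Lemma obj_ge_small_beta b t th z y : 0 < b -> 0 < t ->
  - (lam * `|th|) + b * th * z - b * t * b ^+ 2 / (2 * lam ^+ 2) * z ^+ 4
   - b * `|th| * b / lam * z ^+ 2 <= obj b t th z y.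
Proof.
move=> b0 t0; set c := lam / b.
have c0 : 0 < c by rewrite divr_gt0.
pose r : R := Num.max (`|z| - c) 0.
have r0 : 0 <= r by rewrite le_max lexx orbT.
have rz : r * c <= z ^+ 2.
  rewrite /r -(real_normK (num_real z)); have := normr_ge0 z.
  case: (leP (`|z| - c) 0) => h z0; first by rewrite mul0r sqr_ge0.
  rewrite -subr_ge0 (_ : _ - _ = (`|z| - c) ^+ 2 + `|z| * c); last by ring.
  by rewrite addr_ge0 ?sqr_ge0// mulr_ge0// ltW.
have r2 : r ^+ 2 * c ^+ 2 <= z ^+ 4.
  rewrite -exprMn (_ : z ^+ 4 = (z ^+ 2) ^+ 2); last by rewrite -exprM.
  by apply: lerXn2r => //; rewrite ?nnegrE ?sqr_ge0// mulr_ge0// ltW.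
have lz : b * `|z| - lam <= b * r.
  rewrite (_ : lam = b * c); last by rewrite /c; field; rewrite gt_eqF.
  by rewrite -mulrBr ler_wpM2l ?(ltW b0)// /r le_max lexx.
apply: (@le_trans _ _ (- (lam * `|th|) + b * th * z - b * (t * r ^+ 2 / 2) - b * (`|th| * r))).
  have h1 : b * (t * r ^+ 2 / 2) <= b * t * b ^+ 2 / (2 * lam ^+ 2) * z ^+ 4.
    rewrite (_ : _ * z ^+ 4 = b * t / 2 * (z ^+ 4 / c ^+ 2)); last by rewrite /c; field; rewrite !gt_eqF.
    rewrite (_ : b * (t * r ^+ 2 / 2) = b * t / 2 * r ^+ 2); last by field.
    rewrite ler_wpM2l ?divr_ge0 ?mulr_ge0 ?(ltW b0) ?(ltW t0)//.
    by rewrite ler_pdivlMr ?exprn_gt0.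
  have h2 : b * (`|th| * r) <= b * `|th| * b / lam * z ^+ 2.
    rewrite (_ : _ * z ^+ 2 = b * `|th| * (z ^+ 2 / c)); last by rewrite /c; field; rewrite !gt_eqF.
    rewrite [leLHS]mulrA ler_wpM2l ?mulr_ge0 ?(ltW b0)//.
    by rewrite ler_pdivlMr.
  by move: h1 h2; move: (_ * z ^+ 4) (_ * z ^+ 2) => u v; lra.
have hu : `|y + th| <= `|y| + `|th| by exact: ler_normD.
have hz : z * (y + th) <= `|z| * `|y + th| by rewrite -normrM ler_norm.
have hy : y ^+ 2 = `|y| ^+ 2 by rewrite real_normK ?num_real.
have sq : 0 <= (`|y| - t * r) ^+ 2 / (2 * t) by rewrite divr_ge0 ?sqr_ge0// mulr_ge0// ltW.
have sqE : (`|y| - t * r) ^+ 2 / (2 * t) = y ^+ 2 / (2 * t) - r * `|y| + t * r ^+ 2 / 2.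
  by rewrite hy; field; rewrite gt_eqF.
rewrite sqE in sq.
rewrite /obj.
have k1 : b * (z * (y + th)) <= b * (`|z| * `|y + th|) by rewrite ler_wpM2l// ltW.
have k2 : (b * `|z| - lam) * `|y + th| <= b * r * `|y + th| by rewrite ler_wpM2r.
have k3 : b * r * `|y + th| <= b * r * (`|y| + `|th|) by rewrite ler_wpM2l// mulr_ge0// ltW.
have k4 : 0 <= b * (y ^+ 2 / (2 * t) - r * `|y| + t * r ^+ 2 / 2) by rewrite mulr_ge0// ltW.
move: k1 k2 k3 k4; move: (y ^+ 2 / (2 * t)) (r ^+ 2) => u v.
move: (`|y + th|) (`|y|) (`|z|) (`|th|) => n1 n2 n3 n4; lra.
Qed.

Lemma scalar_min0 t th z : 0 < t -> scalar_min 0 t lam th z <= - (lam * `|th|).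
Proof.
move=> t0; apply: ge_inf.
  exists (- (lam * `|th|)) => _ [x _ <-]; rewrite mulr0 !mul0r subr0 add0r.
  by rewrite lerDr mulr_ge0// ltW.
by exists (- th) => //; rewrite mulr0 !mul0r subr0 addNr normr0 mulr0 !add0r.
Qed.

Definition M4 : R := Rintegral (normal_prob (0:R) 1) setT (fun z => z ^+ 4).

Lemma M4_ge0 : 0 <= M4.
Proof.
apply: Rintegral_ge0 => z _.
by rewrite (_ : z ^+ 4 = (z ^+ 2) ^+ 2) ?sqr_ge0// -exprM.
Qed.

Lemma tame_pow4 : tame (fun z : R => z ^+ 4).
Proof.
split; first exact: measurable_funX.
exists (16 ^+ 2) => z; rewrite ger0_norm; last by rewrite (_ : z ^+ 4 = (z ^+ 2) ^+ 2) ?sqr_ge0// -exprM.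
apply: (@le_trans _ _ ((1 + z ^+ 2) ^+ 2)).
  by rewrite sqrrD -exprM; have := sqr_ge0 z; lra.
apply: le_trans (sqr_quad_le_expR z) _.
rewrite ler_wpM2l ?sqr_ge0// ler_expR; have := sqr_ge0 z; lra.
Qed.

Lemma psi_ge_small_beta b t : 0 < b -> 0 < t ->
  (sigma ^+ 2 / t + t) * b / 2 - 2^-1 * b ^+ 2 + delta^-1 *
  (- (lam * ((\sum_i `|theta i|) / N%:R)) - b * t * b ^+ 2 / (2 * lam ^+ 2) * M4
   - b * ((\sum_i `|theta i|) / N%:R) * b / lam) <= psi' b t.
Proof.
move=> b0 t0; rewrite psiE lerD2l ler_wpM2l ?invr_ge0 ?(ltW delta0)//.
set m1 := _ / N%:R.
pose G i z : R := - (lam * `|theta i|) + b * theta i * z - b * t * b ^+ 2 / (2 * lam ^+ 2) * z ^+ 4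
   - b * `|theta i| * b / lam * z ^+ 2.
have tG1 (i : 'I_N) : tame (fun z => b * theta i * z) by apply: tameZ; exact: tame_id.
have tG2 (i : 'I_N) : tame (fun z => b * t * b ^+ 2 / (2 * lam ^+ 2) * z ^+ 4) by apply: tameZ; exact: tame_pow4.
have tG3 (i : 'I_N) : tame (fun z => b * `|theta i| * b / lam * z ^+ 2) by apply: tameZ; exact: tame_sqr.
have tG i : tame (G i).
  exact: (tameB (tameB (tameD (tame_cst _) (tG1 i)) (tG2 i)) (tG3 i)).
apply: (@le_trans _ _ (Em G)); last first.
  apply: Em_le => //.
    move=> i; rewrite (_ : (fun z => _) = (fun z => obj b t (theta i) z (wst b t i z))).
      by apply: tame_obj; exact: lin_wst.
    by apply/funext => z; exact: scalar_minE.
  by move=> i z; apply: scalar_min_ge => y; exact: obj_ge_small_beta.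
have EG i : Rintegral (normal_prob (0:R) 1) setT (G i) =
    - (lam * `|theta i|) - b * t * b ^+ 2 / (2 * lam ^+ 2) * M4 - b * `|theta i| * b / lam.
  rewrite (gaussB (tameB (tameD (tame_cst _) (tG1 i)) (tG2 i)) (tG3 i)).
  rewrite (gaussB (tameD (tame_cst _) (tG1 i)) (tG2 i)).
  rewrite (gaussD (tame_cst _) (tG1 i)).
  rewrite gauss_cst (gaussZ _ (@tame_id R)) (gaussZ _ tame_pow4) (gaussZ _ (@tame_sqr R)).
  by rewrite gauss_id gauss_sqr mulr0 addr0 mulr1.
rewrite /Em (eq_bigr _ (fun i _ => EG i)).
rewrite le_eqVlt; apply/orP; left; apply/eqP.
have nN : N%:R != 0 :> R by rewrite pnatr_eq0 -lt0n.
rewrite 2!big_split/= sumrN -mulr_sumr sumr_const card_ord.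
have -> : \sum_(i < N) - (b * `|theta i| * b / lam) = - (b * b / lam) * \sum_i `|theta i|.
  by rewrite mulr_sumr; apply: eq_bigr => i _; ring.
rewrite -(mulr_natr _ N) /m1; field.
by rewrite nN gt_eqF.
Qed.

(* At beta = 0 the value is [- lam |theta|_1 / (N delta)]; the gain is of first order in beta, the losses of second order. *)
Lemma beta_gt0 : 0 < beta.
Proof.
have [b_ge0 st _ hmax] := att.
rewrite lt_def b_ge0 andbT; apply/eqP => b00.
have nN : 0 < N%:R :> R by rewrite ltr0n.
pose m1 : R := (\sum_i `|theta i|) / N%:R.
have m10 : 0 <= m1 by rewrite divr_ge0 ?sumr_ge0// ltW.
have M40 := M4_ge0.
have l20 : 0 < lam ^+ 2 by rewrite exprn_gt0.
pose k1 := delta^-1 * M4 * 2 / lam ^+ 2.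
pose k2 := (2^-1 + delta^-1 * m1 / lam) * (8 / sigma).
have d0 : 0 < delta^-1 by rewrite invr_gt0.
have k10 : 0 <= k1 by rewrite divr_ge0 ?(ltW l20)// mulr_ge0// mulr_ge0// ltW.
have k20 : 0 <= k2.
  rewrite mulr_ge0// ?divr_ge0 ?(ltW sigma0)//.
  by rewrite addr_ge0 ?invr_ge0// divr_ge0 ?(ltW lam0)// mulr_ge0// ltW.
(* At b = 1/D the losses are at most b t/4 and b sigma/8. The gain b t/2 is at least b t/4 + b
   sigma/4, so b sigma/8 is left, more than the tolerance b sigma/16 with which t is chosen. *)
pose D := 1 + k1 + k2.
have D0 : 0 < D by rewrite /D -addrA ltr_pwDl// addr_ge0.
pose b := D^-1.
have b0 : 0 < b by rewrite invr_gt0.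
have bD : b * D = 1 by rewrite mulVf ?gt_eqF.
have b1 : b <= 1 by rewrite invf_le1// /D -addrA lerDl addr_ge0.
have bk1 : b * k1 <= 1.
  by rewrite -{1}bD ler_wpM2l ?(ltW b0)// /D; lra.
have bk2 : b * k2 <= 1.
  by rewrite -{1}bD ler_wpM2l ?(ltW b0)// /D; lra.
have [t [sgt ht]] := hmax b (ltW b0) (b * (sigma / 16)) (mulr_gt0 b0 (divr_gt0 sigma0 (ltr0n _ 16))).
have t0 : 0 < t by exact: lt_le_trans sgt.
have up : psi' beta tau <= delta^-1 * - (lam * m1).
  rewrite b00 psiE mulr0 mul0r expr0n/= mulr0 subr0 add0r ler_wpM2l ?(ltW d0)//.
  rewrite (_ : - (lam * m1) = Em (fun i => cst (- (lam * `|theta i|)))); last first.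
    by rewrite Em_mean sumrN -mulr_sumr mulNr mulrA.
  apply: Em_le => //; last by move=> i z; exact: scalar_min0.
    move=> i; rewrite (_ : (fun z => _) = cst (- (lam * `|theta i|))); first exact: tame_cst.
    apply/funext => z; apply/eqP; rewrite eq_le scalar_min0//=.
    apply: scalar_min_ge => y; rewrite /obj mulr0 !mul0r subr0 add0r.
    by rewrite lerDr mulr_ge0// ltW.
  by move=> i; exact: tame_cst.
have lo := psi_ge_small_beta b0 t0; rewrite -/m1 in lo.
have := le_trans lo ht; rewrite leNgt => /negP; apply.
apply: (@le_lt_trans _ _ (delta^-1 * - (lam * m1) + b * (sigma / 16))); first by rewrite lerD2r.
have f1 : delta^-1 * (b * t * b ^+ 2 / (2 * lam ^+ 2) * M4) <= b * (t / 4).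
  rewrite (_ : delta^-1 * (b * t * b ^+ 2 / (2 * lam ^+ 2) * M4) = b * (t / 4) * (b * (b * k1))); last first.
    by rewrite /k1; field; rewrite !gt_eqF.
  rewrite ler_piMr//; first by rewrite mulr_ge0 ?(ltW b0)// divr_ge0// ltW.
  by rewrite mulr_ile1// ?(ltW b0)// mulr_ge0// ltW.
have f2 : 2^-1 * b ^+ 2 + delta^-1 * (b * m1 * b / lam) <= b * (sigma / 8).
  rewrite (_ : 2^-1 * b ^+ 2 + _ = b * (sigma / 8) * (b * k2)); last first.
    by rewrite /k2; field; rewrite !gt_eqF.
  by rewrite ler_piMr// mulr_ge0 ?(ltW b0)// divr_ge0// ltW.
have f3 : 0 <= sigma ^+ 2 / t * b / 2 by rewrite divr_ge0// mulr_ge0 ?(ltW b0)// divr_ge0 ?sqr_ge0 ?(ltW t0).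
have f4 : b * (sigma / 4) <= b * (t / 4) by rewrite ler_wpM2l ?(ltW b0)// ler_wpM2r.
have f5 : 0 < b * (sigma / 16) by rewrite mulr_gt0// divr_gt0.
rewrite [_ * b / 2](_ : _ = sigma ^+ 2 / t * b / 2 + b * (t / 4) + b * (t / 4)); last by field; rewrite gt_eqF.
rewrite mulrBr mulrBr.
move: f1 f2 f3 f4 f5; move: (delta^-1 * (b * t * _ / _ * _)) (2^-1 * b ^+ 2) (delta^-1 * (b * m1 * b / lam)) (sigma ^+ 2 / t * b / 2).
move: (delta^-1 * - (lam * m1)) => a1 a2 a3 a4 a5; rewrite !mulrA; move: (b * sigma) (b * t) => c1 c2; lra.
Qed.

Let beta0 := beta_gt0.
Let wo := wst beta tau.
Let lwo : linf wo. Proof. exact: lin_wst. Qed.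

Lemma W2_ge0 w : 0 <= W2 w.
Proof. by apply: Em_ge0 => // i z; exact: sqr_ge0. Qed.

Lemma PsiE b t w : 0 < t -> Psi b t w =
  b / 2 * ((sigma ^+ 2 + W2 w / delta) / t + t) - b ^+ 2 / 2 - b * (ZW w / delta) + lam * (L1 w / delta).
Proof. by move=> t0; rewrite /Psi; field; rewrite !gt_eqF. Qed.

(** With w frozen at its optimum, tau enters only through beta/2 (Q/tau + tau), whose unique
    minimiser sqrt Q is at least sigma and hence an admissible competitor. Minimality of tau then
    forces tau = sqrt Q. *)
Lemma tau_sqr : tau ^+ 2 = sigma ^+ 2 + W2 wo / delta.
Proof.
have [_ st hmin _] := att.
set Q := sigma ^+ 2 + _.
have W0 : 0 <= W2 wo / delta by rewrite divr_ge0 ?W2_ge0// ltW.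
have Q0 : 0 <= Q by rewrite addr_ge0 ?sqr_ge0.
pose t := Num.sqrt Q.
have tQ : t ^+ 2 = Q by exact: sqr_sqrtr.
have sgt : sigma <= t.
  by rewrite -(@ler_pXn2r _ 2)// ?nnegrE ?sqrtr_ge0 ?(ltW sigma0)// tQ lerDl.
have t0 : 0 < t by exact: lt_le_trans sgt.
have := hmin t sgt; rewrite psi_opt// => h.
have := le_trans h (psi_le beta0 t0 lwo).
rewrite !PsiE// -/Q -tQ !lerD2r ler_pM2l ?divr_gt0//.
rewrite -subr_ge0 (_ : _ - _ = - ((t - tau) ^+ 2 / tau)); last by field; rewrite !gt_eqF.
rewrite oppr_ge0 => h2; have : (t - tau) ^+ 2 / tau = 0.
  by apply/eqP; rewrite eq_le h2/= divr_ge0 ?sqr_ge0// ltW.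
move/eqP; rewrite mulf_eq0 invr_eq0 (gt_eqF tau0) orbF sqrf_eq0 subr_eq0 => /eqP <-.
by [].
Qed.

(** Here x is the L2 distance between the optimal w at (b, t) and at (beta, tau), divided by sqrt
    delta. The bound consists of the curvature in x, a term of first order in b - beta, a cross
    term, and a square; t occurs only through x. The terms linear in the displacement of w cancel
    between [hyper_gap] and the subgradient inequality. *)
Lemma psi_gap b t : 0 < b -> sigma <= t -> exists2 x : R, 0 <= x &
  beta * (sigma ^+ 2 * x ^+ 2 / (2 * tau ^+ 2 * (tau + x))) + (b - beta) * (tau - ZW wo / delta - beta)
  - `|b - beta| * ((1 + (Num.sqrt delta)^-1) * x) - (b - beta) ^+ 2 / 2 <=
  psi' b t - psi' beta tau.
Proof.
move=> b0 sgt; have t0 : 0 < t by exact: lt_le_trans sgt.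
pose w := wst b t; have lw : linf w by exact: lin_wst.
have ld : linf (fun i z => w i z - wo i z) by move=> i; exact: linB.
pose V := W2 (fun i z => w i z - wo i z) / delta.
have V0 : 0 <= V by rewrite divr_ge0 ?W2_ge0// ltW.
pose p := Em (fun i z => wo i z * (w i z - wo i z)) / delta.
pose x : R := Num.sqrt V.
have xV : x ^+ 2 = V by exact: sqr_sqrtr.
have x0 : 0 <= x by exact: sqrtr_ge0.
exists x => //.
pose Q' := sigma ^+ 2 + W2 w / delta.
have Q'0 : 0 <= Q' by rewrite addr_ge0 ?sqr_ge0// divr_ge0 ?W2_ge0// ltW.
pose T' : R := Num.sqrt Q'.
have T'Q : T' ^+ 2 = Q' by exact: sqr_sqrtr.
have T'0 : 0 <= T' by exact: sqrtr_ge0.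
have eT : T' ^+ 2 = tau ^+ 2 + 2 * p + x ^+ 2.
  rewrite T'Q tau_sqr xV /Q' /V /p -!addrA; congr (_ + _).
  rewrite [2 * _]mulrA -!mulrDl; congr (_ / _).
  rewrite -EmZ; last by move=> i; exact: linM_tame.
  rewrite /W2 -EmD; last 2 first.
  - by move=> i; apply: tameZ; exact: linM_tame.
  - by move=> i; exact: linX_tame.
  rewrite -EmD; last 2 first.
  - by move=> i; exact: linX_tame.
  - by move=> i; apply: tameD; [apply: tameZ; exact: linM_tame|exact: linX_tame].
  by apply: Em_eq => i z; ring.
have ep : p ^+ 2 <= (tau ^+ 2 - sigma ^+ 2) * x ^+ 2.
  rewrite tau_sqr xV addrAC subrr add0r /p /V mulrACA expr_div_n -invfM -expr2 ler_wpM2r//.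
    by rewrite invr_ge0 sqr_ge0.
  exact: Em_cauchy_schwarz.
have [dT gap] := hyper_gap tau0 T'0 x0 eT ep.
(* The factor 1/sqrt delta comes from Cauchy-Schwarz against z, whose second moment is 1. *)
have dZ : `|(ZW w - ZW wo) / delta| <= (Num.sqrt delta)^-1 * x.
  have sd : 0 < Num.sqrt delta by rewrite sqrtr_gt0.
  rewrite -(@ler_pXn2r _ 2)// ?nnegrE ?mulr_ge0 ?invr_ge0 ?(ltW sd)//.
  rewrite real_normK ?num_real// [leRHS]exprMn xV exprVn sqr_sqrtr ?(ltW delta0)//.
  rewrite expr_div_n ler_pdivrMr ?exprn_gt0//.
  rewrite (_ : delta^-1 * V * delta ^+ 2 = W2 (fun i z => w i z - wo i z)); last first.
    by rewrite /V; field; rewrite gt_eqF.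
  rewrite /ZW -EmB; [|by move=> i; exact: tame_ZW..].
  rewrite (@Em_eq _ _ _ (fun i z => z * (w i z - wo i z))); last by move=> i z; ring.
  apply: le_trans (Em_cauchy_schwarz _ _ _) _ => //; first by move=> i; exact: lin_id.
  by rewrite (Em_const N0) gauss_sqr mul1r.
have dL : beta * ((ZW w - ZW wo) / delta) - beta * (p / tau) <= lam * ((L1 w - L1 wo) / delta).
  have main : beta * (ZW w - ZW wo) - beta / tau * Em (fun i z => wo i z * (w i z - wo i z)) <=
      lam * (L1 w - L1 wo).
    have tZ i : tame (fun z => z * w i z - z * wo i z) by apply: tameB; exact: tame_ZW.
    have tL i : tame (fun z => `|w i z + theta i| - `|theta i| - (`|wo i z + theta i| - `|theta i|)).
      by apply: tameB; exact: tame_L1.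
    have tM i : tame (fun z => wo i z * (w i z - wo i z)) by exact: linM_tame.
    rewrite /ZW /L1 -EmB; [|by move=> i; exact: tame_ZW..].
    rewrite -[in leRHS]EmB; [|by move=> i; exact: tame_L1..].
    rewrite -!EmZ// -EmB; [|by move=> i; exact: tameZ..].
    apply: Em_le => //; [by move=> i; apply: tameB; exact: tameZ|by move=> i; exact: tameZ|].
    move=> i z; have := wopt_subgrad (theta i) z (w i z) beta0 tau0.
    rewrite -/(wst beta tau i z) -/wo => h.
    rewrite (_ : beta * (z * w i z - z * wo i z) - _ = beta * (z - wo i z / tau) * (w i z - wo i z)); last by ring.
    by apply: le_trans h _; rewrite ler_wpM2l ?(ltW lam0)//; lra.
  rewrite (_ : beta * ((ZW w - ZW wo) / delta) - beta * (p / tau) =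
    (beta * (ZW w - ZW wo) - beta / tau * Em (fun i z => wo i z * (w i z - wo i z))) / delta); last first.
    by rewrite /p; ring.
  by rewrite mulrA ler_wpM2r// invr_ge0 ltW.
rewrite (psi_opt b0 t0) (psi_opt beta0 tau0) !PsiE// -/w -/wo -/Q' -tau_sqr.
(* AM-GM: the right-hand side is least at t = T', so the uncontrolled t disappears. *)
have h1 : b * T' <= b / 2 * (Q' / t + t).
  rewrite -T'Q -subr_ge0 (_ : _ - _ = b / 2 * ((T' - t) ^+ 2 / t)); last by field; rewrite gt_eqF.
  by rewrite mulr_ge0 ?divr_ge0 ?sqr_ge0 ?(ltW b0) ?(ltW t0).
have -> : beta / 2 * (tau ^+ 2 / tau + tau) = beta * tau by field; rewrite gt_eqF.
have h2 : beta * (sigma ^+ 2 * x ^+ 2 / (2 * tau ^+ 2 * (tau + x))) <= beta * (T' - tau - p / tau).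
  by rewrite ler_wpM2l ?(ltW beta0).
have h3 : - (`|b - beta| * ((1 + (Num.sqrt delta)^-1) * x)) <= (b - beta) * (T' - tau - (ZW w - ZW wo) / delta).
  rewrite lerNl -mulrN (le_trans (ler_norm _))// normrM ler_wpM2l// normrN.
  by rewrite (le_trans (ler_normB _ _))// [leRHS]mulrDl mul1r lerD.
move: h1 h2 h3 dL; rewrite !mulrDl !mulNr.
move: (`|_| * _) (beta * (sigma ^+ 2 * x ^+ 2 / _)) (ZW w / delta) (ZW wo / delta) (L1 w / delta) (L1 wo / delta) (b / 2 * (Q' / t + t)) (p / tau) => a1 a2 a3 a4 a5 a6 a7 a8.
by lra.
Qed.

(** The number m = tau - E[Z w]/delta - beta plays the role of the derivative in beta of the minimum
    over tau. Were it nonzero, moving beta by a small r in the direction of its sign would raise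
    [psi] by r |m| - O(r^2) at every t, against maximality. *)
Lemma beta_fixed_point : beta = tau - ZW wo / delta.
Proof.
have [_ st _ hmax] := att.
set A := tau - _; apply/eqP; rewrite eq_sym -subr_eq0; apply/negPn/negP => m0.
set m := A - beta in m0.
have am0 : 0 < `|m| by rewrite normr_gt0.
pose L := 1 + (Num.sqrt delta)^-1.
have L0 : 0 <= L by rewrite addr_ge0// invr_ge0 sqrtr_ge0.
pose kap := beta * sigma ^+ 2 / (2 * tau ^+ 2).
have kap0 : 0 < kap by rewrite divr_gt0 ?mulr_gt0 ?exprn_gt0.
pose U := L ^+ 2 * tau / (2 * kap) + 2^-1.
have U0 : 0 <= U.
  rewrite /U addr_ge0 ?invr_ge0//; apply: divr_ge0; first by rewrite mulr_ge0 ?sqr_ge0// ltW.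
  by rewrite mulr_ge0// ltW.
(* For r = 1/D the three terms give r <= beta/2, which keeps b positive; r L <= kap/2, with which
   the curvature absorbs the cross term even at large x; and r U <= |m|/2, which leaves a gain of r
   |m|/2, above the tolerance r |m|/4. *)
pose D := 2 / beta + 2 * L / kap + 2 * U / `|m|.
have D1 : 0 < 2 / beta by rewrite divr_gt0.
have D2 : 0 <= 2 * L / kap by apply: divr_ge0; [exact: mulr_ge0|exact: ltW].
have D3 : 0 <= 2 * U / `|m| by apply: divr_ge0; [exact: mulr_ge0|exact: ltW].
have D0 : 0 < D by rewrite /D -addrA ltr_pwDl// addr_ge0.
pose r := D^-1.
have r0 : 0 < r by rewrite invr_gt0.
have rD : r * D = 1 by rewrite mulVf// gt_eqF.
have le_r q : q <= D -> r * q <= 1.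
  by move=> h; apply: (@le_trans _ _ (r * D)); [rewrite ler_wpM2l ?(ltW r0)|rewrite rD].
have r1 : r * (2 / beta) <= 1 by apply: le_r; rewrite /D -addrA lerDl addr_ge0.
have r2 : r * (2 * L / kap) <= 1.
  by apply: le_r; rewrite /D addrAC lerDr addr_ge0// ltW.
have r3 : r * (2 * U / `|m|) <= 1.
  by apply: le_r; rewrite /D lerDr addr_ge0// ltW.
have {}r1 : r <= beta / 2.
  by move: r1; rewrite mulrA ler_pdivrMr// mul1r ler_pdivlMr.
have {}r2 : r * L <= kap / 2.
  move: r2; rewrite mulrA ler_pdivrMr// mul1r => h.
  by rewrite ler_pdivlMr// (_ : r * L * 2 = r * (2 * L))//; ring.
have {}r3 : r * U <= `|m| / 2.
  move: r3; rewrite mulrA ler_pdivrMr// mul1r => h.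
  by rewrite ler_pdivlMr// (_ : r * U * 2 = r * (2 * U))//; ring.
pose s := Num.sg m * r.
have sm : s * m = r * `|m| by rewrite /s mulrAC -normrEsg mulrC.
have as_ : `|s| = r by rewrite /s normrM normr_sg m0 mul1r gtr0_norm.
have s2 : s ^+ 2 = r ^+ 2 by rewrite -(real_normK (num_real s)) as_.
pose b := beta + s.
have b0 : 0 < b.
  have : - r <= s by rewrite -as_ lerNl; have := ler_norm (- s); rewrite normrN.
  by rewrite /b; lra.
have e0 : 0 < r * `|m| / 4 by rewrite divr_gt0// mulr_gt0.
have [t [sgt ht]] := hmax b (ltW b0) _ e0.
have [x x0 gap] := psi_gap b0 sgt.
have bs : b - beta = s by rewrite /b; ring.
rewrite bs -/A -/m sm as_ s2 -/L in gap.
have tx : 0 < tau + x by rewrite ltr_pwDl.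
have key : - (r ^+ 2 * (L ^+ 2 * tau / (2 * kap))) <=
    beta * (sigma ^+ 2 * x ^+ 2 / (2 * tau ^+ 2 * (tau + x))) - r * (L * x).
  rewrite (_ : beta * _ = kap * x ^+ 2 / (tau + x)); last by rewrite /kap; field; rewrite !gt_eqF.
  rewrite -subr_ge0 (_ : _ - _ = ((kap * x - r * L * tau) ^+ 2 / (2 * kap) +
     (kap / 2 - r * L) * x ^+ 2 + (r * L) ^+ 2 * tau * x / (2 * kap)) / (tau + x)); last first.
    by field; rewrite !gt_eqF.
  rewrite divr_ge0 ?(ltW tx)// addr_ge0//; first rewrite addr_ge0//.
  - by apply: divr_ge0; rewrite ?sqr_ge0// mulr_ge0// ltW.
  - by rewrite mulr_ge0 ?sqr_ge0// subr_ge0.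
  - apply: divr_ge0; last by rewrite mulr_ge0// ltW.
    by rewrite mulr_ge0// mulr_ge0 ?sqr_ge0 ?(ltW tau0).
have rU : r * (r * U) <= r * (`|m| / 2) by rewrite ler_wpM2l// ltW.
move: gap key rU e0 ht; rewrite /U.
move: (beta * (sigma ^+ 2 * x ^+ 2 / _)) (r * (L * x)) (L ^+ 2 * tau / (2 * kap)) => a1 a2 a3.
lra.
Qed.

(** * Uniform bounds on the saddle point *)

(** The mean over coordinates of E (Z - a nu)^2, where nu is the sign of theta_i if |theta_i| > K
    and otherwise the element of [-1, 1], depending on Z, for which Z - a nu is the soft threshold
    of Z at level a. *)
Definition vmean (K a : R) : R :=
  (\sum_(i < N) (if K < `|theta i| then 1 + a ^+ 2 else 2 * Mfun a)) / N%:R.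

Lemma soft_thr_normE x a : 0 <= a -> `|soft_thr x a| = pospart (`|x| - a).
Proof.
move=> a0; rewrite soft_thrE// /pospart.
have [x0|x0] := leP 0 x.
  rewrite (@max_r _ _ (- x - a)); last lra.
  by rewrite (ger0_norm x0) subr0 ger0_norm ?le_max ?lexx ?orbT.
rewrite (@max_r _ _ (x - a)); last lra.
by rewrite (ltr0_norm x0) sub0r normrN ger0_norm ?le_max ?lexx ?orbT.
Qed.

Lemma soft_thr_lip x y a : 0 <= a -> `|soft_thr x a - soft_thr y a| <= `|x - y|.
Proof.
move=> a0; rewrite !soft_thrE//.
case: (leP (x - a) 0); case: (leP (- x - a) 0); case: (leP (y - a) 0); case: (leP (- y - a) 0);
  move=> h1 h2 h3 h4; rewrite ler_norml; apply/andP; split; have := ler_norm (x - y); have := ler_norm (y - x); rewrite (distrC y x); lra.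
Qed.

Lemma lin_soft a : 0 <= a -> lin (fun z => soft_thr z a).
Proof.
move=> a0; split; first exact: measurable_soft_thr.
exists 1 => z; rewrite mul1r soft_thr_normE// /pospart ge_max; have := normr_ge0 z.
by move=> h; apply/andP; split; lra.
Qed.

(* Split [z = u + (z - u)], where [z - u] is [a] times a subgradient of the l1 norm at theta
   (at 0 for the coordinates below [K], which costs [2 K]); the second moment of [u] is [vmean]. *)
Lemma ZW_le_vmean K a w : 0 <= K -> 0 < a -> linf w ->
  ZW w <= Num.sqrt (vmean K a) * Num.sqrt (W2 w) + a * (L1 w + 2 * K).
Proof.
move=> K0 a0 lw.
pose u (i : 'I_N) z : R := if K < `|theta i| then z - a * Num.sg (theta i) else soft_thr z a.
have lu i : lin (u i).
  rewrite /u; case: (K < `|theta i|); last exact: (lin_soft (ltW a0)).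
  by apply: linB; [exact: lin_id|exact: lin_cst].
have Eu : Em (fun i z => u i z ^+ 2) = vmean K a.
  congr (_ / _); apply: eq_bigr => i _; rewrite /u; case: ifP => Ki.
    have sg1 : Num.sg (theta i) ^+ 2 = 1.
      have : theta i != 0 by rewrite -normr_gt0 (le_lt_trans K0).
      by move=> t0; rewrite sqr_sg t0.
    rewrite (@gauss_eq _ _ (fun z => (1 * z ^+ 2 - 2 * (a * Num.sg (theta i)) * z) + (cst (a ^+ 2)) z)).
      rewrite gaussD; [|by apply: tameB; apply: tameZ; [exact: tame_sqr|exact: tame_id]|exact: tame_cst].
      rewrite gaussB; [|by apply: tameZ; exact: tame_sqr|by apply: tameZ; exact: tame_id].
      rewrite (gaussZ _ (@tame_sqr R)) (gaussZ _ (@tame_id R)) gauss_id gauss_sqr gauss_cst.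
      by rewrite mulr1 mulr0 subr0.
    by move=> z /=; rewrite sqrrB exprMn sg1; ring.
  rewrite -gauss_soft_sqr//; apply: gauss_eq => z.
  by rewrite -soft_thr_normE ?(ltW a0)// real_normK ?num_real.
have luw i : tame (fun z => u i z * w i z) by exact: linM_tame.
have lv i : tame (fun z => (z - u i z) * w i z).
  by apply: linM_tame => //; apply: linB => //; exact: lin_id.
have lb i : tame (fun z => a * ((`|w i z + theta i| - `|theta i|) + 2 * K)).
  by apply: tameZ; apply: tameD; [exact: tame_L1|exact: tame_cst].
have -> : ZW w = Em (fun i z => u i z * w i z) + Em (fun i z => (z - u i z) * w i z).
  by rewrite -EmD//; apply: Em_eq => i z; ring.
apply: lerD.
  have W0 : 0 <= W2 w by apply: Em_ge0 => // i z; exact: sqr_ge0.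
  have v0 : 0 <= vmean K a by rewrite -Eu; apply: Em_ge0 => // i z; exact: sqr_ge0.
  rewrite -sqrtrM//; apply: (@le_trans _ _ (Num.sqrt (Em (fun i z => u i z * w i z) ^+ 2))).
    by rewrite sqrtr_sqr ler_norm.
  by rewrite ler_wsqrtr// -Eu; exact: Em_cauchy_schwarz.
apply: (@le_trans _ _ (Em (fun i z => a * ((`|w i z + theta i| - `|theta i|) + 2 * K)))).
  apply: Em_le => // i z; rewrite /u; case: ifPn => Ki.
    rewrite opprB addrCA subrr addr0 -mulrA ler_wpM2l ?(ltW a0)//.
    have h1 : Num.sg (theta i) * (w i z + theta i) <= `|w i z + theta i|.
      rewrite (le_trans (ler_norm _))// normrM normr_sg.
      by case: (theta i != 0); rewrite ?mul1r// mul0r.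
    rewrite mulrDr -normrEsg in h1.
    by move: h1; move: (Num.sg (theta i) * w i z) (`|theta i|) (`|w i z + theta i|) => p q r; lra.
  apply: (@le_trans _ _ (a * `|w i z|)).
    rewrite (le_trans (ler_norm _))// normrM ler_wpM2r//.
    exact: soft_thr_dist (ltW a0).
  rewrite ler_wpM2l ?(ltW a0)//.
  have := ler_normB (w i z + theta i) (theta i); rewrite addrK.
  by move: Ki; rewrite -leNgt; move: (`|theta i|) (`|w i z + theta i|) (`|w i z|) => p q r; lra.
rewrite le_eqVlt; apply/orP; left; apply/eqP.
rewrite EmZ; last by move=> i; apply: tameD; [exact: tame_L1|exact: tame_cst].
rewrite (@EmD _ _ _ (fun i => cst (2 * K))); [|by move=> i; exact: tame_L1|by move=> i; exact: tame_cst].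
by rewrite (Em_const N0) gauss_cst.
Qed.

(** The competitor t = sigma, w = 0 has value beta sigma - beta^2/2, while by the two fixed-point
    equations the value at the saddle is beta^2/2 + lam L1/delta. *)
Lemma L1_le : lam * (L1 wo / delta) <= beta * sigma - beta ^+ 2.
Proof.
have [_ st hmin _] := att.
have l0 : linf (fun (i : 'I_N) (z : R) => 0 : R) by move=> i; exact: lin_cst.
have := le_trans (hmin sigma (lexx _)) (psi_le beta0 sigma0 l0).
rewrite (psi_opt beta0 tau0) !PsiE// -/wo -tau_sqr.
have z1 : W2 (fun (i : 'I_N) (z : R) => 0 : R) = 0.
  rewrite /W2 (@Em_eq _ _ _ (fun _ => cst 0)) ?(Em_const N0) ?gauss_cst// => i z.
  by rewrite expr0n.
have z2 : ZW (fun (i : 'I_N) (z : R) => 0 : R) = 0.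
  rewrite /ZW (@Em_eq _ _ _ (fun _ => cst 0)) ?(Em_const N0) ?gauss_cst// => i z.
  by rewrite mulr0.
have z3 : L1 (fun (i : 'I_N) (z : R) => 0 : R) = 0.
  rewrite /L1 (@Em_eq _ _ _ (fun _ => cst 0)) ?(Em_const N0) ?gauss_cst// => i z.
  by rewrite add0r subrr.
rewrite z1 z2 z3 !mul0r !mulr0 !addr0 subr0.
have -> : beta / 2 * (tau ^+ 2 / tau + tau) = beta * tau by field; rewrite gt_eqF.
have -> : beta / 2 * (sigma ^+ 2 / sigma + sigma) = beta * sigma by field; rewrite gt_eqF.
have -> : ZW wo / delta = tau - beta by rewrite [in RHS]beta_fixed_point; ring.
move: (lam * _) => a; lra.
Qed.

(** Let om^2 = E|w|^2/delta, so that om <= tau <= sigma + om. In tau = beta + E[Z w]/delta,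
    [ZW_le_vmean] bounds the last term by kap om plus a multiple of the l1 increment, and kap < 1
    lets kap om be absorbed on the left. *)
Lemma tau_le K a kap lmin lmax : 0 <= K -> 0 < a -> 0 <= kap < 1 ->
  vmean K a <= kap ^+ 2 * delta -> 0 < lmin -> lmin <= lam <= lmax ->
  tau <= sigma + ((1 + a / lmin * sigma) ^+ 2 * lmax / (4 * a) + 2 * K * a / delta) / (1 - kap).
Proof.
move=> K0 a0 /andP[k0 k1] hv lmin0 /andP[l1 l2].
have W0 : 0 <= W2 wo / delta by rewrite divr_ge0 ?W2_ge0// ltW.
pose om : R := Num.sqrt (W2 wo / delta).
have om0 : 0 <= om by exact: sqrtr_ge0.
have om2 : om ^+ 2 = W2 wo / delta by exact: sqr_sqrtr.
have omt : om <= tau.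
  rewrite -(@ler_pXn2r _ 2)// ?nnegrE ?(ltW tau0)//.
  by rewrite om2 tau_sqr lerDr sqr_ge0.
have tom : tau <= sigma + om.
  rewrite -(@ler_pXn2r _ 2)// ?nnegrE ?(ltW tau0) ?addr_ge0 ?(ltW sigma0)//.
  rewrite tau_sqr -om2 sqrrD.
  have : 0 <= sigma * om by rewrite mulr_ge0// ltW.
  by lra.
apply: (le_trans tom); rewrite lerD2l ler_pdivlMr ?subr_gt0//.
have cert := ZW_le_vmean K0 a0 lwo.
have sW : Num.sqrt (W2 wo) = om * Num.sqrt delta.
  by rewrite /om -sqrtrM// divfK// gt_eqF.
have sv : Num.sqrt (vmean K a) <= kap * Num.sqrt delta.
  rewrite -(ger0_norm k0) -sqrtr_sqr -sqrtrM ?sqr_ge0//.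
  exact: ler_wsqrtr.
have h1 : ZW wo / delta <= kap * om + a * (L1 wo / delta) + 2 * K * a / delta.
  rewrite ler_pdivrMr//; apply: (le_trans cert).
  rewrite (_ : _ * delta = kap * om * delta + a * (L1 wo + 2 * K)); last by field; rewrite gt_eqF.
  rewrite lerD2r sW; apply: (@le_trans _ _ (kap * Num.sqrt delta * (om * Num.sqrt delta))).
    by rewrite ler_wpM2r// mulr_ge0// sqrtr_ge0.
  by rewrite mulrACA -expr2 sqr_sqrtr// ltW.
pose c := a / lam.
have c0 : 0 < c by rewrite divr_gt0.
have h2 : a * (L1 wo / delta) <= c * (beta * sigma - beta ^+ 2).
  rewrite (_ : a * (L1 wo / delta) = c * (lam * (L1 wo / delta))).
    by rewrite ler_wpM2l ?(ltW c0)// L1_le.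
  by rewrite /c; field; rewrite !gt_eqF.
have h3 : beta * (1 + c * sigma) - c * beta ^+ 2 <= (1 + c * sigma) ^+ 2 / (4 * c).
  rewrite -subr_ge0 (_ : _ - _ = (1 + c * sigma - 2 * c * beta) ^+ 2 / (4 * c)).
    by rewrite divr_ge0 ?sqr_ge0// mulr_ge0// ltW.
  by field; rewrite gt_eqF.
have h4 : (1 + c * sigma) ^+ 2 / (4 * c) <= (1 + a / lmin * sigma) ^+ 2 * lmax / (4 * a).
  have -> : (1 + c * sigma) ^+ 2 / (4 * c) = (1 + c * sigma) ^+ 2 * lam / (4 * a).
    by rewrite /c; field; rewrite !gt_eqF.
  rewrite ler_wpM2r ?invr_ge0 ?mulr_ge0 ?(ltW a0)//.
  have p0 : 0 <= 1 + c * sigma by rewrite addr_ge0// mulr_ge0 ?(ltW c0) ?(ltW sigma0).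
  apply: ler_pM => //; [exact: sqr_ge0|exact: ltW|].
  apply: lerXn2r; rewrite ?nnegrE//.
    by rewrite addr_ge0// mulr_ge0 ?(ltW sigma0)// divr_ge0 ?(ltW a0)// ltW.
  rewrite lerD2l ler_wpM2r ?(ltW sigma0)// ler_wpM2l ?(ltW a0)//.
  by rewrite lef_pV2 ?posrE.
have fp := beta_fixed_point.
move: h1 h2 h3 h4 fp omt; move: (ZW wo / delta) (a * (L1 wo / delta)) ((1 + c * sigma) ^+ 2 / (4 * c))
  ((1 + a / lmin * sigma) ^+ 2 * lmax / (4 * a)) (2 * K * a / delta) => x1 x2 x3 x4 x5.
lra.
Qed.

(** Either al = lam/beta is bounded, which bounds beta from below, or the threshold al tau is so
    large that coordinates with |theta_i| <= K hardly contribute to E[Z w]. The others contribute at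
    most tau each, as soft thresholding is 1-Lipschitz, and their proportion is at most [vmean].
    Then beta = tau - E[Z w]/delta is at least tau (1 - kap^2)/2. *)
Lemma beta_ge K a kap lmin : 0 <= K -> 0 < a -> 0 <= kap < 1 ->
  vmean K a <= kap ^+ 2 * delta -> 0 < lmin -> lmin <= lam ->
  Num.min (lmin / (1 + 2 * K / sigma + 8 * M4 / (delta * (1 - kap ^+ 2)))) (sigma * (1 - kap ^+ 2) / 2)
   <= beta.
Proof.
move=> K0 a0 /andP[k0 k1] hv lmin0 l1.
have nN : 0 < N%:R :> R by rewrite ltr0n.
have [_ st _ _] := att.
have M40 := M4_ge0.
have k2 : 0 < 1 - kap ^+ 2.
  by rewrite subr_gt0 expr_lt1.
have q1 : 0 <= 2 * K / sigma by rewrite divr_ge0 ?mulr_ge0// ltW.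
have q2 : 0 <= 8 * M4 / (delta * (1 - kap ^+ 2)).
  by rewrite divr_ge0 ?mulr_ge0// ltW// mulr_gt0.
(* Above [al1], the term 2 K/sigma makes K at most half of the threshold al tau, and the last term
   makes the contribution of the small coordinates at most half of 1 - kap^2. *)
set al1 := 1 + _ + _.
have al1_ge1 : 1 <= al1 by rewrite /al1 -addrA lerDl addr_ge0.
pose al := lam / beta.
have al0 : 0 < al by rewrite divr_gt0.
rewrite ge_min; have [hal|hal] := ltP al al1.
  apply/orP; left; rewrite ler_pdivrMr ?(lt_le_trans _ al1_ge1)//.
  apply: (le_trans l1); by move/ltW: hal; rewrite /al ler_pdivrMr// mulrC.
apply/orP; right.
have al_ge1 : 1 <= al by exact: le_trans hal.
have b_ge0 : 0 <= tau * lam / beta by rewrite divr_ge0 ?mulr_ge0 ?ltW.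
have h2K : 2 * K <= al * tau.
  apply: (@le_trans _ _ (2 * K / sigma * sigma)); first by rewrite divfK// gt_eqF.
  apply: ler_pM => //; first exact: ltW.
  by apply: le_trans hal; rewrite /al1; lra.
(* A pointwise majorant of z w(z). Its first summand is linear in z and has mean zero. For small
   coordinates the rest comes from |z| (|z| - al/2)_+ <= z^4/(al/2)^2. *)
pose G (i : 'I_N) z : R := z * (if K < `|theta i| then soft_thr (theta i) (tau * lam / beta) - theta i else - theta i)
   + (if K < `|theta i| then tau * z ^+ 2 else 4 * tau / al ^+ 2 * z ^+ 4).
have tG i : tame (G i).
  apply: tameD.
    by apply: linM_tame; [exact: lin_id|exact: lin_cst].
  by case: (K < `|theta i|); apply: tameZ; [exact: tame_sqr|exact: tame_pow4].
have EG i : Rintegral (normal_prob (0:R) 1) setT (G i) = if K < `|theta i| then tau else 4 * tau / al ^+ 2 * M4.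
  rewrite gaussD; last 2 first.
  - by apply: linM_tame; [exact: lin_id|exact: lin_cst].
  - by case: (K < `|theta i|); apply: tameZ; [exact: tame_sqr|exact: tame_pow4].
  rewrite (@gauss_eq _ (fun z => z * _) (fun z => (if K < `|theta i| then soft_thr (theta i) (tau * lam / beta) - theta i else - theta i) * z)); last by move=> z; rewrite mulrC.
  rewrite (gaussZ _ (@tame_id R)) gauss_id mulr0 add0r.
  case: ifP => _; [by rewrite (gaussZ _ (@tame_sqr R)) gauss_sqr mulr1|exact: gaussZ tame_pow4].
have hZ : ZW wo <= Em G.
  apply: Em_le => //; first by move=> i; exact: tame_ZW.
  move=> i z; rewrite /G /wo /wst /wopt; case: ifPn => Ki.
    rewrite -lerBlDl -mulrBr (_ : soft_thr _ _ - theta i - _ = soft_thr (theta i + tau * z) (tau * lam / beta) - soft_thr (theta i) (tau * lam / beta)); last by ring.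
    rewrite (le_trans (ler_norm _))// normrM.
    have := soft_thr_lip (theta i + tau * z) (theta i) b_ge0; rewrite addrAC subrr add0r => h.
    apply: (le_trans (ler_wpM2l (normr_ge0 z) h)).
    by rewrite normrM (gtr0_norm tau0) mulrCA -normrM -expr2 ger0_norm ?sqr_ge0.
  rewrite -lerBlDl -mulrBr opprK subrK.
  rewrite (le_trans (ler_norm _))// normrM soft_thr_normE//.
  have c0 : 0 < al / 2 by rewrite divr_gt0.
  have hp : pospart (`|theta i + tau * z| - tau * lam / beta) <= tau * Num.max (`|z| - al / 2) 0.
    rewrite /pospart ge_max; apply/andP; split; last by rewrite mulr_ge0 ?(ltW tau0)// le_max lexx orbT.
    apply: (@le_trans _ _ (tau * (`|z| - al / 2))); last by rewrite ler_wpM2l ?(ltW tau0)// le_max lexx.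
    have := ler_normD (theta i) (tau * z); rewrite (normrM tau) (gtr0_norm tau0).
    have -> : tau * lam / beta = al * tau by rewrite /al; field; rewrite gt_eqF.
    move: Ki; rewrite -leNgt; move: (`|theta i|) (`|theta i + tau * z|) (`|z|) => p q r.
    by lra.
  apply: (le_trans (ler_wpM2l (normr_ge0 z) hp)).
  rewrite mulrCA (_ : 4 * tau / al ^+ 2 * z ^+ 4 = tau * (z ^+ 4 / (al / 2) ^+ 2)); last by field; rewrite gt_eqF.
  rewrite ler_wpM2l ?(ltW tau0)//.
  have [hc|hc] := leP (`|z| - al / 2) 0.
    by rewrite mulr0 divr_ge0 ?sqr_ge0// (_ : z ^+ 4 = (z ^+ 2) ^+ 2) ?sqr_ge0// -exprM.
  rewrite ler_pdivlMr ?exprn_gt0//.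
  have z4 : z ^+ 4 = `|z| ^+ 2 * `|z| ^+ 2 by rewrite real_normK ?num_real// -exprD.
  rewrite z4; apply: ler_pM.
  - by rewrite mulr_ge0// ltW.
  - exact: sqr_ge0.
  - by rewrite expr2 ler_wpM2l// gerBl ltW.
  - by apply: lerXn2r; rewrite ?nnegrE ?(ltW c0)//; lra.
have h1 : tau * (1 - kap ^+ 2 - 4 * M4 / (al ^+ 2 * delta)) <= beta.
  rewrite beta_fixed_point -/wo mulrBr mulrBr mulr1 -addrA -opprD lerD2l lerN2 ler_pdivrMr//.
  apply: (le_trans hZ); rewrite mulrDl.
  apply: (@le_trans _ _ (tau * vmean K a + 4 * tau / al ^+ 2 * M4)).
    rewrite /Em (eq_bigr _ (fun i _ => EG i)) /vmean.
    rewrite ler_pdivrMr//; set S := (X in tau * (X / _)); set q := (X in _ + X).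
    rewrite (_ : (tau * (S / N%:R) + q) * N%:R = tau * S + q * N%:R); last first.
      by field; rewrite gt_eqF.
    rewrite /S mulr_sumr (_ : q * N%:R = \sum_(i < N) q); last first.
      by rewrite sumr_const card_ord mulr_natr.
    rewrite -big_split/=; apply: ler_sum => i _.
    have q0 : 0 <= q by rewrite /q mulr_ge0// divr_ge0 ?sqr_ge0// mulr_ge0// ltW.
    case: ifP => _.
      by rewrite -[leLHS]addr0 lerD// ler_peMr ?(ltW tau0)// lerDl sqr_ge0.
    rewrite lerDr mulr_ge0 ?(ltW tau0)// -gauss_soft_sqr//.
    by apply: Rintegral_ge0 => z _; exact: sqr_ge0.
  apply: lerD; first by rewrite -mulrA ler_wpM2l// ltW.
  by rewrite le_eqVlt; apply/orP; left; apply/eqP; field; rewrite !gt_eqF.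
apply: (le_trans _ h1).
have h5 : 4 * M4 / (al ^+ 2 * delta) <= (1 - kap ^+ 2) / 2.
  rewrite ler_pdivrMr; last by apply: mulr_gt0 => //; exact: exprn_gt0.
  have h6 : 8 * M4 <= al * (delta * (1 - kap ^+ 2)).
    rewrite -ler_pdivrMr ?mulr_gt0//; apply: le_trans hal; rewrite /al1; lra.
  have h7 : al * (delta * (1 - kap ^+ 2)) <= al ^+ 2 * (delta * (1 - kap ^+ 2)).
    by rewrite ler_wpM2r ?mulr_ge0 ?(ltW delta0) ?(ltW k2)// expr2 ler_peMr// ltW.
  have -> : (1 - kap ^+ 2) / 2 * (al ^+ 2 * delta) = al ^+ 2 * (delta * (1 - kap ^+ 2)) / 2 by ring.
  by lra.
apply: (@le_trans _ _ (tau * ((1 - kap ^+ 2) / 2))).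
  by rewrite -mulrA ler_wpM2r// divr_ge0// ltW.
by rewrite ler_wpM2l ?(ltW tau0)//; lra.
Qed.

End saddle.

(** * The level [a] on the two sparsity classes *)

Section sparsity_classes.
Variable R : realType.
Implicit Types (delta a K : R).

Lemma Mfun2_ge0 a : 0 < a -> 0 <= 2 * Mfun a.
Proof. by move=> a0; rewrite -gauss_soft_sqr//; apply: Rintegral_ge0 => z _; exact: sqr_ge0. Qed.

Lemma tame_pospart_sqr a : 0 < a -> tame (fun z : R => pospart (`|z| - a) ^+ 2).
Proof.
move=> a0; have := linX_tame (lin_soft (ltW a0)).
under eq_fun do rewrite -(real_normK (num_real (soft_thr _ _))) soft_thr_normE ?(ltW a0)//.
by [].
Qed.

Lemma Mfun2_le1 a : 0 < a -> 2 * Mfun a <= 1.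
Proof.
move=> a0; rewrite -gauss_soft_sqr//.
apply: (@le_trans _ _ (Rintegral (normal_prob (0:R) 1) setT (fun z => z ^+ 2))).
  2: by rewrite gauss_sqr.
apply: gauss_le.
- exact: tame_pospart_sqr.
- exact: tame_sqr.
move=> z; rewrite -[leRHS](real_normK (num_real z)); apply: lerXn2r; rewrite ?nnegrE ?le_max ?lexx ?orbT//.
by rewrite /pospart ge_max normr_ge0 andbT gerBl ltW.
Qed.

Lemma Mfun2_le_pow4 a : 0 < a -> 2 * Mfun a <= M4 R / a ^+ 2.
Proof.
move=> a0; rewrite -gauss_soft_sqr// mulrC /M4 -(gaussZ _ (@tame_pow4 R)).
apply: gauss_le; [exact: tame_pospart_sqr|exact: tameZ (@tame_pow4 R)|].
move=> z; rewrite mulrC ler_pdivlMr ?exprn_gt0// -exprMn.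
rewrite (_ : z ^+ 4 = (`|z| ^+ 2) ^+ 2); last by rewrite real_normK ?num_real// -exprM.
apply: lerXn2r; rewrite ?nnegrE ?sqr_ge0//; first by rewrite mulr_ge0 ?(ltW a0)// le_max lexx orbT.
rewrite /pospart; case: (leP (`|z| - a) 0) => h; first by rewrite mul0r sqr_ge0.
have z0 := normr_ge0 z.
rewrite -subr_ge0 (_ : _ - _ = (`|z| - a) ^+ 2 + `|z| * a); last by ring.
by rewrite addr_ge0 ?sqr_ge0// mulr_ge0// ltW.
Qed.

Lemma vmean_le (N : nat) (theta : 'I_N -> R) K a q : (0 < N)%N -> 0 < a ->
  #|[pred i : 'I_N | K < `|theta i|]|%:R <= q * N%:R ->
  vmean theta K a <= 2 * Mfun a + (1 + a ^+ 2 - 2 * Mfun a) * q.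
Proof.
move=> N0 a0 hq; rewrite /vmean ler_pdivrMr ?ltr0n//.
have den : 0 <= 1 + a ^+ 2 - 2 * Mfun a.
  by have := Mfun2_le1 a0; have := sqr_ge0 a; lra.
rewrite (eq_bigr (fun i => 2 * Mfun a + (if K < `|theta i| then 1 + a ^+ 2 - 2 * Mfun a else 0))); last first.
  by move=> i _; case: ifP => _; rewrite ?addr0// addrCA subrr addr0.
rewrite big_split/= -big_mkcond/= !sumr_const card_ord -(mulr_natr (2 * Mfun a)).
rewrite -(mulr_natr (1 + a ^+ 2 - 2 * Mfun a)) [leRHS]mulrDl lerD2l -[leRHS]mulrA.
by rewrite ler_wpM2l//; apply: le_trans hq; rewrite ler_nat.
Qed.

(** By definition of the supremum some a satisfies s < delta [smax_ratio delta a]. Clearing the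
    denominator, this is v < delta for the bound v of [vmean_le] with K = 0 and proportion s; hence
    kap^2 = v/delta. *)
Lemma sparse_vmean delta s : 0 < delta -> 0 <= s -> (s%:E < smax delta)%E ->
  exists a kap : R, [/\ 0 < a, 0 <= kap < 1 &
    forall (N : nat) (theta : 'I_N -> R), (0 < N)%N -> F0 s theta -> vmean theta 0 a <= kap ^+ 2 * delta].
Proof.
move=> delta0 s0 hs.
have [a [a0 ha]] : exists a : R, 0 < a /\ s < delta * smax_ratio delta a.
  apply: contrapT => /forallNP h; move: hs; apply/negP; rewrite -leNgt /smax.
  have : (ereal_sup [set (smax_ratio delta a)%:E | a in [set a : R | (0 < a)%R]] <= (s / delta)%:E)%E.
    apply: ge_ereal_sup => _ [a a0 <-]; rewrite lee_fin ler_pdivlMr// mulrC leNgt.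
    by apply/negP => h2; apply: (h a).
  move=> /(lee_wpmul2l _) => /(_ delta%:E); rewrite lee_fin => /(_ (ltW delta0)).
  by rewrite -EFinM mulrC divfK// gt_eqF.
have M0 := Mfun2_ge0 a0; have M1 := Mfun2_le1 a0.
have den : 0 < 1 + a ^+ 2 - 2 * Mfun a.
  have : 0 < a ^+ 2 by rewrite exprn_gt0.
  lra.
pose v := 2 * Mfun a + (1 + a ^+ 2 - 2 * Mfun a) * s.
have vd : v < delta.
  move: ha; rewrite /smax_ratio mulrA ltr_pdivlMr// (_ : delta * (1 - 2 / delta * Mfun a) = delta - 2 * Mfun a); last by field; rewrite gt_eqF.
  by rewrite /v [_ * s]mulrC; move: (s * _) => q; lra.
have v0 : 0 <= v by rewrite addr_ge0// mulr_ge0// ltW.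
exists a, (Num.sqrt (v / delta)); split=> //.
  rewrite sqrtr_ge0/= -[ltRHS]sqrtr1 ltr_sqrt//.
  by rewrite ltr_pdivrMr// mul1r.
move=> N theta N0 hF; rewrite sqr_sqrtr ?divr_ge0 ?(ltW delta0)// divfK ?gt_eqF//.
apply: vmean_le => //; apply: le_trans hF; rewrite ler_nat.
by apply: eq_leq; apply: eq_card => i; rewrite !inE normr_gt0.
Qed.

(** A large level a makes 2 M(a) <= delta/4 by a fourth moment bound. Then K is taken so large that,
    by Markov's inequality for |theta_i|^p, the proportion s of coordinates above K satisfies (1 +
    a^2) s = delta/4. The sum is at most delta/2, whence kap^2 = 1/2. *)
Lemma lp_vmean delta p xi : 0 < delta -> 0 < p -> 0 < xi ->
  exists K a kap : R, [/\ 0 <= K, 0 < a, 0 <= kap < 1 &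
    forall (N : nat) (theta : 'I_N -> R), (0 < N)%N -> Fp p xi theta -> vmean theta K a <= kap ^+ 2 * delta].
Proof.
move=> delta0 p0 xi0.
have M40 := M4_ge0 R.
have q0 : 0 <= 4 * M4 R / delta by rewrite divr_ge0 ?mulr_ge0// ltW.
pose a := 1 + 4 * M4 R / delta.
have a1 : 1 <= a by rewrite /a lerDl.
have a0 : 0 < a by exact: lt_le_trans a1.
have a20 : 0 < 1 + a ^+ 2 by rewrite ltr_wpDr ?sqr_ge0.
pose s := delta / (4 * (1 + a ^+ 2)).
have s0 : 0 < s by rewrite /s divr_gt0// mulr_gt0.
pose K := (xi `^ p / s) `^ p^-1.
have xp : 0 < xi `^ p by rewrite powR_gt0.
have K0 : 0 < K by rewrite powR_gt0// divr_gt0.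
have Kp : K `^ p = xi `^ p / s.
  by rewrite /K -powRrM mulVf ?gt_eqF// powRr1// ltW// divr_gt0.
exists K, a, (Num.sqrt 2^-1); split=> //; first exact: ltW.
  rewrite sqrtr_ge0/= -[ltRHS]sqrtr1 ltr_sqrt// invf_lt1//.
  by rewrite ltr1n.
move=> N theta N0 hF; rewrite sqr_sqrtr//.
have nN : 0 < N%:R :> R by rewrite ltr0n.
have card : #|[pred i : 'I_N | K < `|theta i|]|%:R <= s * N%:R.
  rewrite -(@ler_pM2r _ (K `^ p)); last exact: powR_gt0.
  apply: (@le_trans _ _ (\sum_i `|theta i| `^ p)); last first.
    move: hF; rewrite /Fp ler_pdivrMr// => h; apply: (le_trans h).
    by rewrite Kp le_eqVlt; apply/orP; left; apply/eqP; field; rewrite gt_eqF.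
  rewrite mulr_natl -sumr_const.
  rewrite [leRHS](bigID (fun i => K < `|theta i|))/= -[leLHS]addr0 lerD//.
    apply: ler_sum => i Ki; apply: ge0_ler_powR; rewrite ?nnegrE ?(ltW p0) ?(ltW K0)//.
    exact: ltW.
  by apply: sumr_ge0 => i _; exact: powR_ge0.
apply: (le_trans (vmean_le N0 a0 card)).
have m2 : 2 * Mfun a <= delta / 4.
  apply: (le_trans (Mfun2_le_pow4 a0)); rewrite ler_pdivrMr ?exprn_gt0//.
  have h1 : M4 R <= delta / 4 * a.
    rewrite -ler_pdivrMl ?divr_gt0// /a.
    rewrite (_ : (delta / 4)^-1 * M4 R = 4 * M4 R / delta); last by field; rewrite gt_eqF.
    by rewrite lerDr.
  apply: (le_trans h1); rewrite ler_wpM2l ?divr_ge0 ?(ltW delta0)//.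
  by rewrite expr2 ler_peMr// ltW.
have m0 := Mfun2_ge0 a0.
have e : (1 + a ^+ 2) * s = delta / 4 by rewrite /s; field; rewrite gt_eqF.
have h3 : 0 <= 2 * Mfun a * s by rewrite mulr_ge0// ltW.
rewrite mulrBl e; move: h3 m2; move: (2 * Mfun a) => u; lra.
Qed.

Lemma class_vmean delta (D : forall N : nat, ('I_N -> R) -> Prop) : 0 < delta ->
  (exists s : R, 0 <= s /\ (s%:E < smax delta)%E /\ D = F0 s) \/
  (exists p xi : R, 0 < p /\ 0 < xi /\ D = Fp p xi) ->
  exists K a kap : R, [/\ 0 <= K, 0 < a, 0 <= kap < 1 &
    forall (N : nat) (theta : 'I_N -> R), (0 < N)%N -> D N theta -> vmean theta K a <= kap ^+ 2 * delta].
Proof.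
move=> delta0 [[s [s0 [hs ->]]]|[p [xi [p0 [xi0 ->]]]]]; last exact: lp_vmean.
by have [a [kap [a0 k01 H]]] := sparse_vmean delta0 s0 hs; exists 0, a, kap.
Qed.
End sparsity_classes.

(** * The gap of the Lasso objective *)

Section gordon_gap.
Variable R : realType.

Lemma inner_cauchy_schwarz (N : nat) (x y : 'I_N -> R) : (0 < N)%N ->
  inner x y ^+ 2 <= sqnorm x * sqnorm y.
Proof.
move=> N0; have nN : 0 < N%:R :> R by rewrite ltr0n.
have := Em_cauchy_schwarz N0 (fun i => lin_cst (x i)) (fun i => lin_cst (y i)).
rewrite [X in X ^+ 2 <= _](_ : _ = inner x y / N%:R); last by rewrite -Em_mean.
rewrite [X in _ <= X * _](_ : _ = sqnorm x / N%:R); last by rewrite -Em_mean.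
rewrite [X in _ <= _ * X](_ : _ = sqnorm y / N%:R); last by rewrite -Em_mean.
by rewrite expr_div_n mulrACA -invfM -expr2 ler_pM2r// invr_gt0 exprn_gt0.
Qed.

Lemma sqnorm_ge0 (N : nat) (x : 'I_N -> R) : 0 <= sqnorm x.
Proof. by apply: sumr_ge0 => i _; exact: sqr_ge0. Qed.

(** For beta >= 0, (x)_+^2/2 is at least beta x - beta^2/2, and at most x^2/2. Using the first at w
    and the second at w_lambda linearises the square with beta as dual variable, at the cost (v -
    beta)^2/2 and whatever the sign of v. The term g.(w - w_lambda) then cancels against the
    subgradient of the l1 norm. *)
Lemma lassoL_gap (N n : nat) (sigma lam beta tau : R) (theta g : 'I_N -> R) (g' : R)
    (h : 'I_n -> R) (w : 'I_N -> R) :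
  (0 < n)%N -> 0 < lam -> 0 < beta -> 0 < tau ->
  let w0 := wlam theta g beta tau lam in
  let T u := Num.sqrt (sqnorm u / n%:R + sigma ^+ 2) in
  let H := Num.sqrt (sqnorm h) / Num.sqrt n%:R in
  let v := T w0 * H - inner g w0 / n%:R + g' * sigma / Num.sqrt n%:R in
  beta * (H * (T w - T w0) - inner w0 (fun i => w i - w0 i) / n%:R / tau) - (v - beta) ^+ 2 / 2
  <= lassoL sigma lam theta g g' h w - lassoL sigma lam theta g g' h w0.
Proof.
move=> n0 lam0 beta0 tau0; lazy zeta beta.
set w0 := wlam theta g beta tau lam.
pose T (u : 'I_N -> R) : R := Num.sqrt (sqnorm u / n%:R + sigma ^+ 2).
pose H : R := Num.sqrt (sqnorm h) / Num.sqrt n%:R.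
pose v := T w0 * H - inner g w0 / n%:R + g' * sigma / Num.sqrt n%:R.
rewrite -/(T w) -/(T w0) -/H -/v.
have nn : 0 < n%:R :> R by rewrite ltr0n.
have pos_sq (a b : R) : 0 <= b -> b * a - b ^+ 2 / 2 <= 2^-1 * pospart a ^+ 2.
  move=> b0; rewrite /pospart; case: (leP a 0) => ha.
    rewrite expr0n mulr0 subr_le0; apply: (@le_trans _ _ 0); first by rewrite mulr_ge0_le0.
    by rewrite divr_ge0// sqr_ge0.
  by rewrite -subr_ge0 (_ : _ - _ = (a - b) ^+ 2 / 2) ?divr_ge0 ?sqr_ge0//; field.
have pos_le (a : R) : 2^-1 * pospart a ^+ 2 <= a ^+ 2 / 2.
  rewrite /pospart; case: (leP a 0) => ha; last by rewrite mulrC.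
  by rewrite expr0n mulr0 divr_ge0// sqr_ge0.
have l1 : beta * (inner g (fun i => w i - w0 i) / n%:R) - beta / tau * (inner w0 (fun i => w i - w0 i) / n%:R)
    <= lam / n%:R * norm1 (fun i => w i + theta i) - lam / n%:R * norm1 (fun i => w0 i + theta i).
  rewrite -mulrBr !mulrA -mulrBl [lam / n%:R * _]mulrAC ler_wpM2r ?invr_ge0 ?(ltW nn)//.
  rewrite /inner /norm1 -sumrB !mulr_sumr -sumrB; apply: ler_sum => i _.
  have := wopt_subgrad lam0 (theta i) (g i) (w i) beta0 tau0.
  rewrite -[wopt _ _ _ _ _]/(w0 i) => hs; apply: le_trans hs.
  by rewrite le_eqVlt; apply/orP; left; apply/eqP; ring.
have ig : inner g (fun i => w i - w0 i) = inner g w - inner g w0.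
  by rewrite /inner -sumrB; apply: eq_bigr => i _; rewrite mulrBr.
have k1 := pos_sq (T w * H - inner g w / n%:R + g' * sigma / Num.sqrt n%:R) beta (ltW beta0).
have k2 := pos_le v.
have k3 : beta * v = beta * (T w0 * H - inner g w0 / n%:R + g' * sigma / Num.sqrt n%:R) by [].
rewrite /lassoL -/(T w) -/(T w0) -/H -/v.
clearbody v; move: l1 k1 k2 k3; rewrite ig mulrBl.
move: (2^-1 * pospart v ^+ 2) (2^-1 * pospart _ ^+ 2) => p1 p2.
move: (lam / n%:R * norm1 (fun i => w i + theta i)) (lam / n%:R * norm1 (fun i => w0 i + theta i)) (lam / n%:R * norm1 theta).
move: (inner g w / n%:R) (inner g w0 / n%:R) (g' * sigma / Num.sqrt n%:R) (inner w0 _ / n%:R) H (T w) (T w0).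
move=> i1 i0 gg p H0 t1 t0 m1 m0 mt.
move=> *; lra.
Qed.

(** Deterministic: eta bounds the four fluctuations, [Tm] bounds the square root at w_lambda, [C1]
    and [C2] turn eta into errors on the slope and on v - beta, and [kap] is the curvature. Only the
    radius x0 is bounded by [X0]; the distance of w is not. *)
Lemma lassoL_far (N n : nat) (sigma lam beta tau tm bmin eta x0 X0 : R) (theta g : 'I_N -> R) (g' : R)
    (h : 'I_n -> R) (w : 'I_N -> R) :
  (0 < N)%N -> (0 < n)%N -> 0 < lam -> 0 < sigma -> 0 < bmin -> bmin <= beta ->
  sigma <= tau -> tau <= tm ->
  let w0 := wlam theta g beta tau lam in
  let Tm := tm + sigma^-1 in
  let C1 := 1 + (sigma ^+ 2)^-1 in
  let C2 := Tm + sigma^-1 + 1 + sigma in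
  let kap := sigma ^+ 2 / (4 * Tm ^+ 2 * (Tm + X0)) in
  0 <= eta <= 2^-1 ->
  `|sqnorm w0 / n%:R - (tau ^+ 2 - sigma ^+ 2)| <= eta ->
  `|inner g w0 / n%:R - (tau - beta)| <= eta ->
  `|sqnorm h / n%:R - 1| <= eta ->
  `|g' / Num.sqrt n%:R| <= eta ->
  0 < x0 <= X0 -> x0 ^+ 2 <= sqnorm (fun i => w i - w0 i) / n%:R ->
  C1 * eta <= kap * x0 / 2 -> C2 ^+ 2 * eta ^+ 2 <= bmin * kap * x0 ^+ 2 / 2 ->
  lassoL sigma lam theta g g' h w0 + bmin * kap * x0 ^+ 2 / 4 <= lassoL sigma lam theta g g' h w.
Proof.
move=> N0 n0 lam0 sigma0 bmin0 hb hst htm w0 Tm C1 C2 kap /andP[eta0 eta1] hW hZ hh hg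
  /andP[x00 hX] hx hC1 hC2.
have beta0 : 0 < beta by exact: lt_le_trans hb.
have tau0 : 0 < tau by exact: lt_le_trans hst.
have nn : 0 < n%:R :> R by rewrite ltr0n.
have gap := lassoL_gap sigma theta g g' h w n0 lam0 beta0 tau0.
lazy zeta beta in gap; rewrite -/w0 in gap.
set T1 := Num.sqrt (sqnorm w / _ + _) in gap.
set T0 := Num.sqrt (sqnorm w0 / _ + _) in gap.
set H := Num.sqrt (sqnorm h) / _ in gap.
set v := T0 * H - _ + _ in gap.
set p := inner w0 _ / _ in gap.
have s20 : 0 < sigma ^+ 2 by rewrite exprn_gt0.
have arg0 u : 0 < sqnorm u / n%:R + sigma ^+ 2 :> R.
  by rewrite ltr_wpDl// divr_ge0 ?sqnorm_ge0// ltW.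
have T0p : 0 < T0 by rewrite sqrtr_gt0.
have T1p : 0 <= T1 by exact: sqrtr_ge0.
have T0sq : T0 ^+ 2 = sqnorm w0 / n%:R + sigma ^+ 2 by rewrite sqr_sqrtr// ltW.
have T1sq : T1 ^+ 2 = sqnorm w / n%:R + sigma ^+ 2 by rewrite sqr_sqrtr// ltW.
set dw := fun i => w i - w0 i in hx p gap.
pose x : R := Num.sqrt (sqnorm dw / n%:R).
have V0 : 0 <= sqnorm dw / n%:R by rewrite divr_ge0 ?sqnorm_ge0// ltW.
have x_sq : x ^+ 2 = sqnorm dw / n%:R by rewrite sqr_sqrtr.
have x_ge0 : 0 <= x by exact: sqrtr_ge0.
have xx0 : x0 <= x.
  by rewrite -(@ler_pXn2r _ 2)// ?nnegrE ?(ltW x00)// x_sq.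
have eT : T1 ^+ 2 = T0 ^+ 2 + 2 * p + x ^+ 2.
  rewrite T1sq T0sq x_sq /p /inner /sqnorm /dw [in RHS]addrAC -!addrA [sigma ^+ 2 + _]addrC !addrA; congr (_ + _).
  rewrite mulrA -!mulrDl; congr (_ / _).
  rewrite mulr_sumr -!big_split/=; apply: eq_bigr => i _; ring.
have ep : p ^+ 2 <= (T0 ^+ 2 - sigma ^+ 2) * x ^+ 2.
  rewrite T0sq addrK x_sq /p expr_div_n mulrACA -invfM -expr2 ler_wpM2r ?invr_ge0 ?sqr_ge0//.
  exact: inner_cauchy_schwarz.
have [dT hg1] := hyper_gap T0p T1p x_ge0 eT ep.
have H0 : 0 <= H by rewrite divr_ge0 ?sqrtr_ge0.
have Hsq : H ^+ 2 = sqnorm h / n%:R by rewrite expr_div_n !sqr_sqrtr ?sqnorm_ge0// ltW.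
have dH : `|H - 1| <= eta.
  apply: le_trans hh; rewrite -Hsq (_ : H ^+ 2 - 1 = (H - 1) * (H + 1)); last by ring.
  by rewrite normrM ler_peMr// ger0_norm ?addr_ge0// lerDr.
have dT0 : `|T0 - tau| <= eta / sigma.
  rewrite ler_pdivlMr//; apply: le_trans hW.
  rewrite (_ : sqnorm w0 / n%:R - _ = (T0 - tau) * (T0 + tau)); last by rewrite -subr_sqr T0sq; ring.
  rewrite normrM ler_wpM2l// ger0_norm ?addr_ge0 ?(ltW T0p) ?(ltW tau0)//.
  by rewrite (le_trans hst)// lerDr ltW.
have is0 : 0 < sigma^-1 by rewrite invr_gt0.
have eta_s : eta / sigma <= sigma^-1 by rewrite ler_piMl ?(ltW is0)//; lra.
have T0m : T0 <= Tm by move: dT0; rewrite ler_norml => /andP[_ h2]; rewrite /Tm; lra.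
have Tm0 : 0 < Tm by exact: lt_le_trans T0m.
have X00 : 0 < X0 by exact: lt_le_trans hX.
have kap0 : 0 < kap.
  apply: divr_gt0 => //; apply: mulr_gt0; last exact: addr_gt0.
  by apply: mulr_gt0 => //; exact: exprn_gt0.
have Hhalf : 2^-1 <= H by move: dH; rewrite ler_norml => /andP[h1 _]; lra.
have dv : `|v - beta| <= C2 * eta.
  have -> : v - beta = T0 * (H - 1) + (T0 - tau) - (inner g w0 / n%:R - (tau - beta)) + sigma * (g' / Num.sqrt n%:R).
    by rewrite /v; ring.
  apply: le_trans (ler_normD _ _) _.
  have e1 : `|sigma * (g' / Num.sqrt n%:R)| <= sigma * eta.
    by rewrite normrM (gtr0_norm sigma0) ler_wpM2l// ltW.
  have e2 : `|T0 * (H - 1)| <= Tm * eta.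
    by rewrite normrM (gtr0_norm T0p) ler_pM// ltW.
  have -> : C2 * eta = Tm * eta + eta / sigma + eta + sigma * eta by rewrite /C2; ring.
  apply: lerD => //; apply: (le_trans (ler_normB _ _)); apply: lerD => //.
  by apply: (le_trans (ler_normD _ _)); apply: lerD.
have pT : `|p| <= T0 * x.
  rewrite -(@ler_pXn2r _ 2)// ?nnegrE ?mulr_ge0 ?(ltW T0p)// real_normK ?num_real// [leRHS]exprMn.
  by apply: (le_trans ep); rewrite ler_wpM2r ?sqr_ge0// gerBl ltW.
(* The scalar product p can be as large as T0 x, but its two occurrences have coefficients H/T0 and
   1/tau that differ by O(eta), so only an error linear in x remains. *)
have err : `|p * (H / T0 - tau^-1)| <= C1 * eta * x.
  have -> : p * (H / T0 - tau^-1) = p / T0 * ((H - 1) - (T0 - tau) / tau) by field; rewrite !gt_eqF.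
  rewrite normrM mulrC; apply: ler_pM => //.
    rewrite /C1 [leRHS]mulrDl mul1r; apply: (le_trans (ler_normB _ _)); apply: lerD => //.
    rewrite normrM [`|tau^-1|]gtr0_norm ?invr_gt0//.
    apply: (@le_trans _ _ (eta / sigma * sigma^-1)).
      by apply: ler_pM => //; [rewrite invr_ge0 ltW|rewrite lef_pV2 ?posrE].
    by rewrite le_eqVlt; apply/orP; left; apply/eqP; field; rewrite gt_eqF.
  by rewrite normrM normfV (gtr0_norm T0p) ler_pdivrMr// mulrC.
(* The bound H >= 1/2 and the 2 of [hyper_gap] make the 4 in [kap]. As x^2/(T0 + x) >= x0 x/(Tm +
   X0), the curvature grows at least linearly in x, like the error to be beaten. *)
have main : kap * x0 * x <= H * (T1 - T0 - p / T0).
  apply: (@le_trans _ _ (2^-1 * (sigma ^+ 2 * x ^+ 2 / (2 * T0 ^+ 2 * (T0 + x))))); last first.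
    apply: ler_pM => //; apply: divr_ge0; first by rewrite mulr_ge0 ?sqr_ge0.
    by apply: mulr_ge0; [rewrite mulr_ge0 ?sqr_ge0|rewrite addr_ge0// ltW].
  have d1 : 0 < T0 + x by rewrite ltr_pwDl.
  have d2 : 0 < Tm + x by rewrite ltr_pwDl.
  have d3 : 0 < Tm + X0 by rewrite addr_gt0.
  have d4 : 0 < Tm + x0 by rewrite addr_gt0.
  have step1 : x0 * x / (Tm + X0) <= x ^+ 2 / (T0 + x).
    apply: (@le_trans _ _ (x0 * x / (Tm + x0))).
      by rewrite ler_wpM2l ?mulr_ge0 ?(ltW x00)// lef_pV2 ?posrE// lerD2l.
    apply: (@le_trans _ _ (x ^+ 2 / (Tm + x))).
      rewrite ler_pdivrMr// mulrAC ler_pdivlMr//.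
      rewrite -subr_ge0 (_ : _ - _ = x * (Tm * (x - x0))); last by ring.
      by rewrite mulr_ge0// mulr_ge0 ?(ltW Tm0)// subr_ge0.
    by rewrite ler_wpM2l ?sqr_ge0// lef_pV2 ?posrE// lerD2r.
  have -> : kap * x0 * x = sigma ^+ 2 / 4 * (Tm ^+ 2)^-1 * (x0 * x / (Tm + X0)).
    by rewrite /kap; field; rewrite !gt_eqF.
  have -> : 2^-1 * (sigma ^+ 2 * x ^+ 2 / (2 * T0 ^+ 2 * (T0 + x))) =
     sigma ^+ 2 / 4 * (T0 ^+ 2)^-1 * (x ^+ 2 / (T0 + x)).
    by field; rewrite !gt_eqF.
  apply: ler_pM => //.
  - by rewrite mulr_ge0 ?divr_ge0 ?invr_ge0 ?sqr_ge0.
  - by rewrite divr_ge0 ?mulr_ge0 ?(ltW x00) ?(ltW d3).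
  - rewrite ler_wpM2l ?divr_ge0 ?sqr_ge0// lef_pV2 ?posrE ?exprn_gt0//.
    by apply: lerXn2r; rewrite ?nnegrE ?(ltW T0p) ?(ltW Tm0).
have lower : kap * x0 * x / 2 <= H * (T1 - T0) - p / tau.
  have -> : H * (T1 - T0) - p / tau = H * (T1 - T0 - p / T0) + p * (H / T0 - tau^-1).
    by field; rewrite !gt_eqF.
  have := ler_norm (- (p * (H / T0 - tau^-1))); rewrite normrN => n1.
  have : C1 * eta * x <= kap * x0 / 2 * x by rewrite ler_wpM2r.
  rewrite [kap * x0 / 2 * x]mulrAC.
  move: main err n1; move: (kap * x0 * x) (H * (T1 - T0 - p / T0)) (p * (H / T0 - tau^-1)) (C1 * eta * x) => a1 a2 a3 a4.
  by lra.
have l2 : bmin * kap * x0 ^+ 2 / 2 <= beta * (H * (T1 - T0) - p / tau).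
  have -> : bmin * kap * x0 ^+ 2 / 2 = bmin * (kap * x0 * x0 / 2) by ring.
  apply: ler_pM => //; first exact: ltW.
    by rewrite divr_ge0// mulr_ge0 ?(ltW x00)// mulr_ge0 ?(ltW x00)// ltW.
  apply: le_trans lower; rewrite ler_wpM2r// ler_wpM2l// mulr_ge0 ?(ltW x00)//; exact: ltW.
have l3 : (v - beta) ^+ 2 <= bmin * kap * x0 ^+ 2 / 2.
  apply: le_trans hC2; rewrite -exprMn -(real_normK (num_real (v - beta))).
  by apply: lerXn2r; rewrite ?nnegrE// (le_trans _ dv).
move: gap l2 l3.
move: (lassoL _ _ _ _ _ _ w) (lassoL _ _ _ _ _ _ w0) => L1 L0.
move: (beta * _) ((v - beta) ^+ 2) (bmin * kap * x0 ^+ 2) => b1 b2 b3 b4.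
lra.
Qed.
End gordon_gap.

Section wopt_growth.
Variable R : realType.

(** The size of theta does not enter, because w differs from tau z by at most the threshold. One
    growth constant thus serves all coordinates, all theta in the class and all lambda, as
    [bernstein] requires. *)
Lemma wopt_sqr_growth (lam beta tau th z tm b : R) : 0 < lam -> 0 < beta -> 0 < tau ->
  tau <= tm -> tau * lam / beta <= b ->
  `|wopt lam beta tau th z ^+ 2| <= (1 + 2 * tm ^+ 2 + 2 * b ^+ 2 + tm + b) * (1 + z ^+ 2) /\
  `|z * wopt lam beta tau th z| <= (1 + 2 * tm ^+ 2 + 2 * b ^+ 2 + tm + b) * (1 + z ^+ 2).
Proof.
move=> lam0 beta0 tau0 htm hb.
have tm0 : 0 < tm by exact: lt_le_trans htm.
have b0 : 0 <= b by apply: le_trans hb; rewrite divr_ge0 ?mulr_ge0 ?ltW.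
have hw : `|wopt lam beta tau th z| <= tm * `|z| + b.
  apply: (le_trans (wopt_bound lam0 th z beta0 tau0)); apply: lerD => //.
  by rewrite ler_wpM2r.
have z0 := normr_ge0 z.
have z2 : z ^+ 2 = `|z| ^+ 2 by rewrite real_normK ?num_real.
have t2 := sqr_ge0 tm; have b2 := sqr_ge0 b.
have zz := sqr_ge0 (`|z| - 1).
split.
  rewrite normrX; apply: (@le_trans _ _ ((tm * `|z| + b) ^+ 2)).
    by apply: lerXn2r; rewrite ?nnegrE// addr_ge0// mulr_ge0// ltW.
  rewrite z2 -subr_ge0 (_ : _ - _ = (tm * `|z| - b) ^+ 2 + (1 + tm + b) * (1 + `|z| ^+ 2) + 2 * tm ^+ 2 + 2 * b ^+ 2 * `|z| ^+ 2); last by ring.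
  rewrite !addr_ge0 ?sqr_ge0// mulr_ge0 ?sqr_ge0//.
  - by rewrite !addr_ge0// ltW.
  - by rewrite mulr_ge0.
rewrite normrM; apply: (le_trans (ler_wpM2l z0 hw)).
rewrite z2 -subr_ge0 (_ : _ - _ = (1 + 2 * tm ^+ 2 + 2 * b ^+ 2) * (1 + `|z| ^+ 2) + tm + b * ((`|z| - 1) ^+ 2 + `|z|)); last by ring.
have q : 0 <= (1 + 2 * tm ^+ 2 + 2 * b ^+ 2) * (1 + `|z| ^+ 2).
  apply: mulr_ge0; last by rewrite addr_ge0 ?sqr_ge0.
  by rewrite !addr_ge0// mulr_ge0.
by rewrite addr_ge0 ?addr_ge0 ?(ltW tm0)// mulr_ge0// addr_ge0.
Qed.

Lemma inf_lassoL_le (N n : nat) (sigma lam : R) (theta g : 'I_N -> R) (g' : R) (h : 'I_n -> R)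
    (w : 'I_N -> R) : 0 < lam ->
  inf (range (lassoL sigma lam theta g g' h)) <= lassoL sigma lam theta g g' h w.
Proof.
move=> lam0; apply: ge_inf; last by exists w.
exists (- (lam / n%:R * norm1 theta)) => _ [u _ <-]; rewrite /lassoL lerDr addr_ge0//.
  by rewrite mulr_ge0 ?invr_ge0 ?sqr_ge0.
by rewrite mulr_ge0 ?divr_ge0 ?(ltW lam0)//; apply: sumr_ge0.
Qed.
End wopt_growth.

(** * Choice of the constants and the exceptional event *)

Unset Implicit Arguments.

Theorem theoremB2 (R : realType) (delta sigma lmin lmax : R)
    (hdelta : 0 < delta) (hsigma : 0 < sigma)
    (hlmin : 0 < lmin) (hlminmax : lmin <= lmax)
    (D : forall N : nat, ('I_N -> R) -> Prop)
    (hD : (exists s : R, 0 <= s /\ (s%:E < smax delta)%E /\ D = F0 s) \/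
          (exists p xi : R, 0 < p /\ 0 < xi /\ D = Fp p xi)) :
  exists gam c C : R, [/\ 0 < gam, 0 < c, 0 < C &
    forall (N n : nat), (0 < N)%N -> n%:R = delta * N%:R ->
    forall theta : 'I_N -> R, D N theta ->
    forall lam : R, lmin <= lam <= lmax ->
    forall beta tau : R, attains_maxmin delta sigma lam theta beta tau ->
    forall eps : R, 0 < eps <= 1 ->
    forall (d : measure_display) (T : measurableType d) (P : probability T R)
           (X : gidx N n -> T -> R),
    iid_std_normal P X ->
    let g := fun t (i : 'I_N) => X (inl i) t in
    let g' := fun t => X (inr (inl ord0)) t in
    let h := fun t (j : 'I_n) => X (inr (inr j)) t in
    let L := fun t => lassoL sigma lam theta (g t) (g' t) (h t) in
    exists B : set T, [/\ measurable B,
      [set t | exists w : 'I_N -> R,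
          sqnorm (fun i => w i - wlam theta (g t) beta tau lam i) / N%:R > eps /\
          L t w <= inf (range (L t)) + gam * eps] `<=` B &
      (P B <= (C / eps * expR (- c * n%:R * eps ^+ 2))%:E)%E]].
Proof.
have [K [a [kp [K0 a0 kp01 Hvm]]]] := class_vmean hdelta hD.
have /andP[kp0 kp1] := kp01.
have lmax0 : 0 < lmax by exact: lt_le_trans hlminmax.
pose tm := sigma + ((1 + a / lmin * sigma) ^+ 2 * lmax / (4 * a) + 2 * K * a / delta) / (1 - kp).
pose bmin := Num.min (lmin / (1 + 2 * K / sigma + 8 * M4 R / (delta * (1 - kp ^+ 2)))) (sigma * (1 - kp ^+ 2) / 2).
have k2 : 0 < 1 - kp ^+ 2 by rewrite subr_gt0 expr_lt1.
have M40 := M4_ge0 R.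
have bmin0 : 0 < bmin.
  rewrite /bmin lt_min; apply/andP; split; last by rewrite divr_gt0// mulr_gt0.
  apply: divr_gt0 => //; apply: (@lt_le_trans _ _ 1) => //.
  rewrite -addrA lerDl addr_ge0//; first by rewrite divr_ge0 ?mulr_ge0// ltW.
  by apply: divr_ge0; [exact: mulr_ge0|rewrite mulr_ge0// ltW].
have tm_ge : sigma <= tm.
  rewrite /tm lerDl; apply: divr_ge0; last by rewrite subr_ge0 ltW.
  apply: addr_ge0; last by apply: divr_ge0; [rewrite !mulr_ge0// ltW|exact: ltW].
  apply: divr_ge0; last by rewrite mulr_ge0// ltW.
  by rewrite mulr_ge0 ?sqr_ge0// ltW.
have tm0 : 0 < tm by exact: lt_le_trans tm_ge.
(* An upper bound on the threshold tau lam/beta, uniform over the class. *)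
pose bt := tm * lmax / bmin.
have bt0 : 0 < bt by apply: divr_gt0 => //; exact: mulr_gt0.
pose Kc := 1 + 2 * tm ^+ 2 + 2 * bt ^+ 2 + tm + bt.
have Kc1 : 1 <= Kc.
  rewrite /Kc; have := sqr_ge0 tm; have := sqr_ge0 bt; move: tm0 bt0.
  by move: (tm) (bt) (tm ^+ 2) (bt ^+ 2) => *; lra.
have Kc0 : 0 < Kc by exact: lt_le_trans Kc1.
(* There are N + 1 + n gaussians, at most (1/delta + 2) n since n >= 1. *)
pose kI := delta^-1 + 2.
have kI0 : 0 < kI by rewrite addr_gt0// invr_gt0.
have [c1 c10 bern] := bernstein Kc0 kI0.
have [C4 C40 tail] := gauss_tail_iid R.
(* In the normalisation by n a squared distance above eps N reads eps/delta, so x0 = sqrt eps X0 <=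
   X0. *)
pose X0 := (Num.sqrt delta)^-1.
have sd0 : 0 < Num.sqrt delta by rewrite sqrtr_gt0.
have X00 : 0 < X0 by rewrite invr_gt0.
pose Tm := tm + sigma^-1.
pose C1 := 1 + (sigma ^+ 2)^-1.
pose C2 := Tm + sigma^-1 + 1 + sigma.
pose kap := sigma ^+ 2 / (4 * Tm ^+ 2 * (Tm + X0)).
have is0 : 0 < sigma^-1 by rewrite invr_gt0.
have Tm0 : 0 < Tm by exact: addr_gt0.
have kap0 : 0 < kap.
  apply: divr_gt0; first exact: exprn_gt0.
  by apply: mulr_gt0; [apply: mulr_gt0 => //; exact: exprn_gt0|exact: addr_gt0].
have C10 : 0 < C1 by rewrite addr_gt0// invr_gt0 exprn_gt0.
have C20 : 0 < C2 by rewrite addr_gt0// addr_gt0// addr_gt0.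
(* With eta = c0 sqrt eps and x0 = sqrt(eps/delta), the two smallness conditions of [lassoL_far]
   follow from c0 u1 <= 1, c0 u2 <= 1 and c0 <= 1. The summand 2 of [Dc] gives c0 <= 1/2, hence eta
   <= 1/2. *)
pose u1 := 2 * Num.sqrt delta * C1 / kap.
pose u2 := 2 * C2 ^+ 2 * delta / (bmin * kap).
have u10 : 0 < u1 by apply: divr_gt0 => //; apply: mulr_gt0 => //; exact: mulr_gt0.
have u20 : 0 < u2.
  apply: divr_gt0; last exact: mulr_gt0.
  by apply: mulr_gt0 => //; apply: mulr_gt0 => //; exact: exprn_gt0.
pose Dc := 2 + u1 + u2.
have Dc0 : 0 < Dc by rewrite /Dc -addrA addr_gt0// addr_gt0.
pose c0 := Dc^-1.
have c00 : 0 < c0 by rewrite invr_gt0.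
have c0D : c0 * Dc = 1 by rewrite mulVf// gt_eqF.
have c0le q : q <= Dc -> c0 * q <= 1.
  by move=> h; apply: (@le_trans _ _ (c0 * Dc)); [rewrite ler_wpM2l ?(ltW c00)|rewrite c0D].
have c0h : c0 <= 2^-1.
  have : c0 * 2 <= 1 by apply: c0le; rewrite /Dc -addrA lerDl addr_ge0// ltW.
  by rewrite -ler_pdivlMr// div1r.
have c0u1 : c0 * u1 <= 1 by apply: c0le; rewrite /Dc; lra.
have c0u2 : c0 * u2 <= 1 by apply: c0le; rewrite /Dc; lra.
(* [c1] is the Bernstein rate, 1/4 the rate for g', and c0^2 comes from eta^2 = c0^2 eps. *)
pose cc := Num.min c1 4^-1 * c0 ^+ 2.
have cc0 : 0 < cc by apply: mulr_gt0; [rewrite lt_min c10 invr_gt0 ltr0n|exact: exprn_gt0].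
(* gamma eps is half of the gain bmin kap x0^2/4 of [lassoL_far], which makes the final inequality
   strict. In 6 + C4, each of the three two-sided Bernstein events counts 2 and the tail of g'
   counts C4. *)
exists (bmin * kap / (8 * delta)), cc, (6 + C4); split => //.
- by apply: divr_gt0; apply: mulr_gt0.
- by rewrite addr_gt0.
move=> N n N0 nE theta Dth lam hlam beta tau att eps /andP[eps0 eps1] d T P X iid g g' h L.
have lam0 : 0 < lam by move/andP: hlam => [h1 _]; exact: lt_le_trans h1.
have hv := Hvm N theta N0 Dth.
have nN : 0 < N%:R :> R by rewrite ltr0n.
have nn : 0 < n%:R :> R by rewrite nE mulr_gt0.
have n0 : (0 < n)%N by rewrite -(@ltr0n R).
have beta0 := beta_gt0 N0 hdelta hsigma lam0 att.
have tausq := tau_sqr N0 hdelta hsigma lam0 att.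
have fp := beta_fixed_point N0 hdelta hsigma lam0 att.
have htm : tau <= tm := tau_le N0 hdelta hsigma lam0 att K0 a0 kp01 hv hlmin hlam.
have hbm : bmin <= beta.
  by apply: (beta_ge N0 hdelta hsigma lam0 att K0 a0 kp01 hv hlmin); case/andP: hlam.
have hst : sigma <= tau by case: att.
have tau0 : 0 < tau by exact: lt_le_trans hst.
have hbt : tau * lam / beta <= bt.
  apply: ler_pM; [by rewrite mulr_ge0// ltW|by rewrite invr_ge0 ltW| |by rewrite lef_pV2 ?posrE].
  by apply: ler_pM => //; [exact: ltW|exact: ltW|case/andP: hlam].
pose seps := Num.sqrt eps.
have seps0 : 0 < seps by rewrite sqrtr_gt0.
have seps2 : seps ^+ 2 = eps by rewrite sqr_sqrtr// ltW.
have seps1 : seps <= 1 by rewrite -sqrtr1 ler_wsqrtr.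
pose eta := c0 * seps.
have eta0 : 0 < eta by rewrite mulr_gt0.
have etah : eta <= 2^-1 by rewrite -[leRHS]mulr1 ler_pM// ltW.
have eta01 : 0 <= eta <= 1 by apply/andP; split; [exact: ltW|rewrite (le_trans etah)// invf_le1// ler1n].
(* All three averages are sums over the joint index set, with zero summands on the blocks not
   involved, so that [bernstein] applies to the one family X. *)
pose f1 (k : gidx N n) z : R := match k with inl i => wst lam theta beta tau i z ^+ 2 | _ => 0 end.
pose f2 (k : gidx N n) z : R := match k with inl i => z * wst lam theta beta tau i z | _ => 0 end.
pose f3 (k : gidx N n) z : R := match k with inr (inr j) => z ^+ 2 | _ => 0 end.
have lw := lin_wst theta lam0 beta0 tau0.
have mf1 k : measurable_fun setT (f1 k).
  by case: k => [i|j]; rewrite /f1//; exact: (linX_tame (lw i)).1.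
have mf2 k : measurable_fun setT (f2 k).
  by case: k => [i|j]; rewrite /f2//; exact: (tame_ZW i lw).1.
have mf3 k : measurable_fun setT (f3 k).
  by case: k => [i|[j|j]]; rewrite /f3//; exact: (@tame_sqr R).1.
have growth0 (z : R) : `|0 : R| <= Kc * (1 + z ^+ 2).
  by rewrite normr0 mulr_ge0 ?(ltW Kc0)// addr_ge0 ?sqr_ge0.
have bf1 k z : `|f1 k z| <= Kc * (1 + z ^+ 2).
  case: k => [i|j]; rewrite /f1//.
  exact: (wopt_sqr_growth (theta i) z lam0 beta0 tau0 htm hbt).1.
have bf2 k z : `|f2 k z| <= Kc * (1 + z ^+ 2).
  case: k => [i|j]; rewrite /f2//.
  exact: (wopt_sqr_growth (theta i) z lam0 beta0 tau0 htm hbt).2.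
have bf3 k z : `|f3 k z| <= Kc * (1 + z ^+ 2).
  case: k => [i|[j|j]]; rewrite /f3// ger0_norm ?sqr_ge0//.
  apply: (@le_trans _ _ (1 * (1 + z ^+ 2))); first by rewrite mul1r lerDr.
  by rewrite ler_wpM2r// addr_ge0 ?sqr_ge0.
have cardI : #|{: gidx N n}|%:R <= kI * n%:R.
  rewrite /gidx !card_sum !card_ord !natrD /kI mulrDl nE mulrA mulVf ?gt_eqF// mul1r lerD2l -nE.
  by rewrite mulr_natl mulr2n lerD2r ler1n.
have E1 := bern _ d T P X iid n%:R cardI f1 mf1 bf1 eta eta01.
have E2 := bern _ d T P X iid n%:R cardI f2 mf2 bf2 eta eta01.
have E3 := bern _ d T P X iid n%:R cardI f3 mf3 bf3 eta eta01.
have E4 := tail _ d T P X iid (inr (inl ord0)) (n%:R * eta ^+ 2).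
pose S (f : gidx N n -> R -> R) t := \sum_k (f k (X k t) - Rintegral (normal_prob (0:R) 1) setT (f k)).
have E0 : Rintegral (normal_prob (0:R) 1) setT (fun _ => 0) = 0 by exact: (gauss_cst 0).
pose w0 t := wlam theta (g t) beta tau lam.
have nW F : (\sum_(i < N) Rintegral (normal_prob (0:R) 1) setT (F i)) = n%:R * (Em F / delta).
  by rewrite /Em nE; field; rewrite !gt_eqF.
have S1E t : S f1 t = n%:R * (sqnorm (w0 t) / n%:R - (tau ^+ 2 - sigma ^+ 2)).
  rewrite /S big_sumType/= [X in _ + X]big1 ?addr0; last by move=> j _; rewrite E0 subrr.
  rewrite sumrB nW tausq addrAC subrr add0r mulrBr; congr (_ - _).
  by rewrite mulrCA mulfV ?gt_eqF// mulr1.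
have S2E t : S f2 t = n%:R * (inner (g t) (w0 t) / n%:R - (tau - beta)).
  rewrite /S big_sumType/= [X in _ + X]big1 ?addr0; last by move=> j _; rewrite E0 subrr.
  rewrite sumrB nW (_ : tau - beta = ZW (wst lam theta beta tau) / delta); last by rewrite [in LHS]fp; ring.
  rewrite mulrBr; congr (_ - _).
  by rewrite mulrCA mulfV ?gt_eqF// mulr1.
have S3E t : S f3 t = n%:R * (sqnorm (h t) / n%:R - 1).
  rewrite /S big_sumType/= [X in X + _]big1 ?add0r; last by move=> j _; rewrite E0 subrr.
  rewrite big_sumType/= [X in X + _]big1 ?add0r; last by move=> j _; rewrite E0 subrr.
  rewrite sumrB mulrBr mulr1 mulrCA mulfV ?gt_eqF// mulr1; congr (_ - _).
  rewrite (eq_bigr (fun=> 1)); last by move=> j _; exact: gauss_sqr.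
  by rewrite sumr_const card_ord.
have mS (f : gidx N n -> R -> R) : (forall k, measurable_fun setT (f k)) ->
    measurable [set t | n%:R * eta <= `|S f t|].
  move=> mf; apply: measurable_superlevel; apply: measurableT_comp => //.
  apply: measurable_sum => k; apply: measurable_funB => //.
  exact: measurableT_comp (iid.1 k).
pose A1 := [set t | n%:R * eta <= `|S f1 t|].
pose A2 := [set t | n%:R * eta <= `|S f2 t|].
pose A3 := [set t | n%:R * eta <= `|S f3 t|].
pose A4 := [set t | n%:R * eta ^+ 2 <= X (inr (inl ord0)) t ^+ 2].
have mA1 : measurable A1 by exact: mS.
have mA2 : measurable A2 by exact: mS.
have mA3 : measurable A3 by exact: mS.
have mA4 : measurable A4.
  by apply: measurable_superlevel; apply: measurable_funX; exact: iid.1.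
(* The exceptional set is where one of the four fluctuations reaches eta. It is measurable by
   construction, whereas the event of the theorem quantifies over all w. *)
exists (A1 `|` A2 `|` A3 `|` A4); split.
- by do 3 apply: measurableU => //.
- move=> t [w [hw hL]]; apply: contrapT => /not_orP[/not_orP[/not_orP[/negP n1 /negP n2] /negP n3] /negP n4].
  move: n1 n2 n3 n4; rewrite -!ltNge S1E S2E S3E !normrM (gtr0_norm nn) !ltr_pM2l// => n1 n2 n3 n4.
  have n4' : `|g' t / Num.sqrt n%:R| <= eta.
    rewrite -(@ler_pXn2r _ 2)// ?nnegrE ?(ltW eta0)// real_normK ?num_real//.
    rewrite expr_div_n sqr_sqrtr ?(ltW nn)// ler_pdivrMr// mulrC ltW//.
  have x00 : 0 < seps * X0 <= X0.
    by rewrite mulr_gt0//= ler_piMl// ltW.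
  have x2 : (seps * X0) ^+ 2 = eps / delta.
    by rewrite exprMn seps2 exprVn sqr_sqrtr// ltW.
  have hx : (seps * X0) ^+ 2 <= sqnorm (fun i => w i - w0 t i) / n%:R.
    by rewrite x2 nE invfM mulrA [leRHS]mulrAC ler_wpM2r ?invr_ge0 ?(ltW hdelta)// ltW.
  have cond1 : C1 * eta <= kap * (seps * X0) / 2.
    have -> : C1 * eta = c0 * u1 * (kap * (seps * X0) / 2).
      rewrite /u1 /eta /X0; move: (kap) (kap0) (Num.sqrt delta) sd0 => k k0 s0 s00.
      by field; rewrite !gt_eqF.
    apply: ler_piMl => //; apply: divr_ge0 => //; apply: mulr_ge0; first exact: ltW.
    by case/andP: x00 => /ltW.
  have cond2 : C2 ^+ 2 * eta ^+ 2 <= bmin * kap * (seps * X0) ^+ 2 / 2.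
    have -> : C2 ^+ 2 * eta ^+ 2 = c0 * (c0 * u2) * (bmin * kap * (seps * X0) ^+ 2 / 2).
      rewrite x2 /u2 /eta exprMn seps2; move: (kap) (kap0) (bmin) bmin0 => k k0 b b0.
      by field; rewrite !gt_eqF.
    apply: ler_piMl.
      by rewrite x2; apply: divr_ge0 => //; apply: mulr_ge0; [exact/ltW/mulr_gt0|apply: divr_ge0; exact: ltW].
    rewrite -[leRHS]mulr1; apply: ler_pM => //; first exact: ltW.
      by apply: mulr_ge0; exact: ltW.
    by apply: (le_trans c0h); rewrite invf_le1// ler1n.
  have eta_h : 0 <= eta <= 2^-1 by rewrite (ltW eta0).
  have far := lassoL_far N0 n0 lam0 hsigma bmin0 hbm hst htm eta_h (ltW n1) (ltW n2) (ltW n3) n4' x00 hx cond1 cond2.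
  have := le_trans far hL; rewrite leNgt => /negP; apply.
  have hi : inf (range (L t)) <= L t (w0 t) by exact: inf_lassoL_le.
  rewrite -/kap -/Tm; apply: (@le_lt_trans _ _ (L t (w0 t) + bmin * kap / (8 * delta) * eps)); first by rewrite lerD2r.
  rewrite ltrD2l x2.
  rewrite (_ : bmin * kap * (eps / delta) / 4 = 2 * (bmin * kap / (8 * delta) * eps)); last by field; rewrite gt_eqF.
  by rewrite [ltRHS]mulr_natl mulr2n ltrDl; apply: mulr_gt0 => //; apply: divr_gt0; apply: mulr_gt0.
pose e := expR (- (cc * n%:R * eps)).
have e0 : 0 < e by exact: expR_gt0.
have eta2 : eta ^+ 2 = c0 ^+ 2 * eps by rewrite exprMn seps2.
have c0n : 0 <= c0 ^+ 2 * (n%:R * eps) by rewrite mulr_ge0 ?sqr_ge0// mulr_ge0// ltW.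
have ee : expR (- (c1 * n%:R * eta ^+ 2)) <= e.
  rewrite ler_expR lerN2 eta2 /cc (_ : c1 * _ * _ = c1 * (c0 ^+ 2 * (n%:R * eps))); last by ring.
  by rewrite -[_ * n%:R * eps]mulrA -[leLHS]mulrA ler_wpM2r// ge_min lexx.
have e4 : expR (- (n%:R * eta ^+ 2 / 4)) <= e.
  rewrite ler_expR lerN2 eta2 /cc (_ : n%:R * _ / 4 = 4^-1 * (c0 ^+ 2 * (n%:R * eps))); last by ring.
  by rewrite -[_ * n%:R * eps]mulrA -[leLHS]mulrA ler_wpM2r// ge_min lexx orbT.
apply: (@le_trans _ _ ((2 * e)%:E + (2 * e)%:E + (2 * e)%:E + (C4 * e)%:E)%E).
  have b1 : (P A1 <= (2 * e)%:E)%E by apply: (le_trans E1); rewrite lee_fin ler_wpM2l.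
  have b2 : (P A2 <= (2 * e)%:E)%E by apply: (le_trans E2); rewrite lee_fin ler_wpM2l.
  have b3 : (P A3 <= (2 * e)%:E)%E by apply: (le_trans E3); rewrite lee_fin ler_wpM2l.
  have b4 : (P A4 <= (C4 * e)%:E)%E by apply: (le_trans E4); rewrite lee_fin ler_wpM2l// ltW.
  have u3 : (P (A1 `|` A2 `|` A3 `|` A4) <= P (A1 `|` A2 `|` A3) + P A4)%E.
    by apply: measureU2 => //; do 2 apply: measurableU => //.
  have u2' : (P (A1 `|` A2 `|` A3) <= P (A1 `|` A2) + P A3)%E.
    by apply: measureU2 => //; apply: measurableU.
  have u1' : (P (A1 `|` A2) <= P A1 + P A2)%E by apply: measureU2.
  apply: (le_trans u3); apply: leeD => //.
  apply: (le_trans u2'); apply: leeD => //.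
  by apply: (le_trans u1'); apply: leeD.
rewrite -!EFinD lee_fin (_ : 2 * e + 2 * e + 2 * e + C4 * e = (6 + C4) * e); last by ring.
have C0 : 0 < 6 + C4 by rewrite addr_gt0.
rewrite -[leRHS]mulrA ler_wpM2l ?(ltW C0)// (mulrC eps^-1) ler_pdivlMr//.
(* The hypothesis eps <= 1 is used twice: for the factor 1/eps, and to pass from eps to eps^2 in the
   exponent. *)
apply: (@le_trans _ _ e); first by rewrite ler_piMr// ltW.
rewrite /e ler_expR !mulNr lerN2; apply: ler_wpM2l; first by apply: mulr_ge0; exact: ltW.
by rewrite expr2 ler_piMr// ltW.
Qed.
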